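(* Let $f(z)=z+a_2z^2+a_3z^3+\cdots$ belong to the class $\mathcal{S}_G^{\ast}$. Then the following sharp estimates hold: $$|a_3-\mu a_2^2|\le \frac14\max\left\{1,\left|\mu-\frac13\right|\right\}\quad(\mu\in\mathbb{C}),$$ $$|a_2a_3-a_4|\le\frac16,\qquad |a_2a_4-a_3^2|\le\frac1{16}.$$
   Context: Let $\mathcal{U}=\{z\in\mathbb{C}:|z|<1\}$. Let $\mathcal{S}$ denote the class of functions $f$ analytic and univalent in $\mathcal{U}$ normalized by $f(0)=0$, $f'(0)=1$, i.e. $f(z)=z+\sum_{n\ge2}a_nz^n$. For analytic $g,h$ on $\mathcal{U}$, $g\prec h$ means there is an analytic $w$ on $\mathcal{U}$ with $w(0)=0$, $|w(z)|<1$, and $g(z)=h(w(z))$ for $z\in\mathcal{U}$. Let $\Psi(z)=\frac{z}{\ln(1+z)}$ on $\mathcal{U}$ (principal branch, $\Psi(0)=1$), the generating function of the Gregory coefficients. Define $\mathcal{S}_G^{\ast}=\{f\in\mathcal{S}: zf'(z)/f(z)\prec\Psi(z)\}$. ''Sharp'' means the bound is attained by some function in $\mathcal{S}_G^{\ast}$. *)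

(* Defs.v *)
From Stdlib Require Export Reals.
From Coquelicot Require Export Coquelicot.
Export Complex.

Open Scope R_scope.

Definition in_disk (z : C) : Prop := Cmod z < 1.

(* Principal argument, with values in (-PI, PI]. *)
Definition Carg (z : C) : R :=
  let x := fst z in let y := snd z in
  match Rlt_dec 0 x with
  | left _ => atan (y / x)
  | right _ =>
    match Rlt_dec x 0 with
    | left _ => match Rle_dec 0 y with
                | left _ => atan (y / x) + PI
                | right _ => atan (y / x) - PI
                end
    | right _ => match Rlt_dec 0 y with
                 | left _ => PI / 2
                 | right _ => match Rlt_dec y 0 with
                              | left _ => - (PI / 2)
                              | right _ => 0
                              end
                 end
    end
  end.

Definition Clog (z : C) : C := (ln (Cmod z), Carg z).

(* Psi(z) = z / ln(1+z), principal branch, with Psi(0) = 1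
   (removable singularity). *)
Definition Psi (z : C) : C :=
  match Ceq_dec z 0 with
  | left _ => RtoC 1
  | right _ => (z / Clog (1 + z))%C
  end.

Definition holo_on_disk (f df : C -> C) : Prop :=
  forall z, in_disk z -> is_derive (K := C_AbsRing) (V := C_NormedModule) f z (df z).

Definition univalent_on_disk (f : C -> C) : Prop :=
  forall z1 z2, in_disk z1 -> in_disk z2 -> f z1 = f z2 -> z1 = z2.

Definition class_S (f df : C -> C) : Prop :=
  holo_on_disk f df /\ univalent_on_disk f /\ f 0%C = 0%C /\ df 0%C = 1%C.

Definition subordinate (g h : C -> C) : Prop :=
  exists w : C -> C, exists dw : C -> C,
    holo_on_disk w dw /\ w 0%C = 0%C /\
    (forall z, in_disk z -> Cmod (w z) < 1) /\
    (forall z, in_disk z -> g z = h (w z)).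

(* z f'(z)/f(z), extended at z = 0 by its limit value f'(0) = 1
   (removable singularity for f in S). *)
Definition zfp_over_f (f df : C -> C) (z : C) : C :=
  match Ceq_dec z 0 with
  | left _ => RtoC 1
  | right _ => (z * df z / f z)%C
  end.

Definition class_SG (f df : C -> C) : Prop :=
  class_S f df /\ subordinate (zfp_over_f f df) Psi.

Definition taylor_coeffs (f : C -> C) (a : nat -> C) : Prop :=
  forall z, in_disk z -> is_series (K := C_AbsRing) (V := C_NormedModule)
                           (fun n => (a n * z ^ n)%C) (f z).

(* Main.v *)
(** For f in S*_G write z f'(z)/f(z) = Psi(w(z)) with w(z) = c1 z + c2 z^2 + c3 z^3 + ... a
    Schwarz function; comparing coefficients, a2, a3, a4 are polynomials in c1, c2, c3.

    The Schwarz function is C^1 because w' = (z f'/f)' / Psi'(w) and Psi' does not vanish, so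
    circle means of a holomorphic function built from w do not depend on the radius (differentiate
    under the integral sign).  Expanding |w q|^2 <= |q|^2 for a quadratic polynomial q and letting
    the radius tend to 1, the lower triangular Toeplitz matrix of (c1, c2, c3) is a contraction of
    C^3, which yields |c2| <= 1 - |c1|^2 and, with al = 1 - |c1|^2,
    |al c3 + conj(c1) c2^2| <= al^2 - |c2|^2.  The three bounds then become real inequalities in
    |c1| and |c2|.

    The extremal functions solve z f'/f = Psi(z^k) for k = 1, 2, 3.  By Kaluza's theorem the Taylor
    coefficients of Psi are at most 1 in modulus, so the recursion for the coefficients of f also
    keeps them at most 1.  Writing f(z) = z exp(H(z)), the function s + H(exp s) has derivative
    Psi(exp(k s)), of positive real part, on the half plane Re s < 0; hence it is injective there,
    and so is f on the disk. *)

From Stdlib Require Import Lra Lia Psatz.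
Require Import Defs.

(** * Complex derivatives and paths *)

(** [holo_on_disk] supplies a pointwise derivative of w and nothing more: neither its continuity nor
    a power series. Hence w is never expanded in a series. Its first three coefficients are defined
    through a remainder O(z^4) at the origin, and smoothness is imported from f, whose Taylor series
    is given. On |z| = r one has conj z = r^2/z, so the cross terms of |w q|^2 become real parts of
    a function holomorphic off 0. The products with the remainder involve at most z^(-3), so the
    order 4 leaves O(z): the function tends to 0 at the puncture and its circle means vanish. This
    is why three coefficients go with quadratic q. In terms of w, 4(a3 - mu a2^2) = c2 - (mu - 1/3)
    c1^2, 6(a4 - a2 a3) = c3 - c1 c2/3 - c1^3/6 and a2 a4 - a3^2 = c1 c3/12 - c1^2 c2/144 - c2^2/16.
    For w = z^k only c_k = 1 survives, which shows where each bound is attained: k = 2 or k = 1 for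
    the first, according to |mu - 1/3|, k = 3 for the second, k = 2 for the third. *)

Lemma is_derive_eps {K : AbsRing} {V : NormedModule K} (f : K -> V) (x : K) (l : V) :
  is_derive f x l <->
  (forall eps : posreal, exists d : posreal, forall y : K, abs (minus y x) < d ->
     norm (minus (minus (f y) (f x)) (scal (minus y x) l)) <= eps * abs (minus y x)).
Proof.
  split.
  - intros [_ H] eps.
    destruct (H x (fun P HP => HP) eps) as [d Hd].
    exists d; intros y Hy; exact (Hd y Hy).
  - intros H; split; [apply is_linear_scal_l|].
    intros x' Hx' eps.
    rewrite <- (is_filter_lim_locally_unique (V := AbsRing_NormedModule K) _ _ Hx').
    destruct (H eps) as [d Hd].
    exists d; intros y Hy; exact (Hd y Hy).
Qed.

(** A form independent of the normed-module instance: [holo_on_disk] uses [C_NormedModule], while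
    the product and chain rules are obtained over [AbsRing_NormedModule C_AbsRing]. Both unfold to
    this estimate. *)
Definition cderiv (f : C -> C) (z l : C) : Prop :=
  forall eps, 0 < eps -> exists d, 0 < d /\ forall y, Cmod (y - z)%C < d ->
    Cmod (f y - f z - (y - z) * l)%C <= eps * Cmod (y - z)%C.

Definition ccont (f : C -> C) (z : C) : Prop :=
  forall eps, 0 < eps -> exists d, 0 < d /\ forall y, Cmod (y - z)%C < d ->
    Cmod (f y - f z)%C < eps.

Lemma cderiv_is_derive f z l :
  is_derive (K := C_AbsRing) (V := C_NormedModule) f z l <-> cderiv f z l.
Proof.
  rewrite is_derive_eps; split.
  - intros H eps He. destruct (H (mkposreal eps He)) as [d Hd].
    exists d; split; [apply cond_pos|]. intros y Hy.
    specialize (Hd y Hy). exact Hd.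
  - intros H eps. destruct (H eps (cond_pos eps)) as [d [Hd0 Hd]].
    exists (mkposreal d Hd0). intros y Hy.
    specialize (Hd y Hy). exact Hd.
Qed.

Lemma cderiv_is_derive_absring f z l :
  is_derive (K := C_AbsRing) (V := AbsRing_NormedModule C_AbsRing) f z l <-> cderiv f z l.
Proof.
  rewrite is_derive_eps; split.
  - intros H eps He. destruct (H (mkposreal eps He)) as [d Hd].
    exists d; split; [apply cond_pos|]. exact Hd.
  - intros H eps. destruct (H eps (cond_pos eps)) as [d [Hd0 Hd]].
    exists (mkposreal d Hd0). exact Hd.
Qed.

Lemma ccont_continuous f z :
  continuous (T := AbsRing_UniformSpace C_AbsRing) (U := AbsRing_UniformSpace C_AbsRing) f z
  <-> ccont f z.
Proof.
  split.
  - intros H eps He.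
    destruct (proj1 (filterlim_locally _ _) H (mkposreal eps He)) as [d Hd].
    exists d; split; [apply cond_pos|]. exact Hd.
  - intros H. apply filterlim_locally. intros eps.
    destruct (H eps (cond_pos eps)) as [d [Hd0 Hd]].
    exists (mkposreal d Hd0). exact Hd.
Qed.

Lemma cderiv_unique f z l m : cderiv f z l -> cderiv f z m -> l = m.
Proof.
  intros Hl Hm.
  apply cderiv_is_derive, is_C_derive_unique in Hl.
  apply cderiv_is_derive, is_C_derive_unique in Hm. congruence.
Qed.

Lemma cderiv_ext_loc f g z l r :
  0 < r -> (forall y, Cmod (y - z)%C < r -> f y = g y) -> cderiv f z l -> cderiv g z l.
Proof.
  intros Hr Hfg H eps He. destruct (H eps He) as [d [Hd0 Hd]].
  exists (Rmin d r); split; [apply Rmin_pos; assumption|].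
  intros y Hy. rewrite <- !Hfg.
  - apply Hd. eapply Rlt_le_trans; [exact Hy|apply Rmin_l].
  - replace (z - z)%C with (RtoC 0) by ring. rewrite Cmod_0. exact Hr.
  - eapply Rlt_le_trans; [exact Hy|apply Rmin_r].
Qed.

Lemma ccont_ext_loc f g z r :
  0 < r -> (forall y, Cmod (y - z)%C < r -> f y = g y) -> ccont f z -> ccont g z.
Proof.
  intros Hr Hfg H eps He. destruct (H eps He) as [d [Hd0 Hd]].
  exists (Rmin d r); split; [apply Rmin_pos; assumption|].
  intros y Hy. rewrite <- !Hfg.
  - apply Hd. eapply Rlt_le_trans; [exact Hy|apply Rmin_l].
  - replace (z - z)%C with (RtoC 0) by ring. rewrite Cmod_0. exact Hr.
  - eapply Rlt_le_trans; [exact Hy|apply Rmin_r].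
Qed.

Lemma cderiv_const c z : cderiv (fun _ => c) z 0%C.
Proof. apply cderiv_is_derive_absring. apply @is_derive_const. Qed.

Lemma cderiv_id z : cderiv (fun y => y) z 1%C.
Proof. apply cderiv_is_derive_absring. apply @is_derive_id. Qed.

Lemma cderiv_plus f g z l m :
  cderiv f z l -> cderiv g z m -> cderiv (fun y => (f y + g y)%C) z (l + m)%C.
Proof.
  rewrite <- !cderiv_is_derive_absring. intros Hf Hg.
  exact (is_derive_plus _ _ _ _ _ Hf Hg).
Qed.

Lemma cderiv_mult f g z l m :
  cderiv f z l -> cderiv g z m -> cderiv (fun y => (f y * g y)%C) z (l * g z + f z * m)%C.
Proof.
  rewrite <- !cderiv_is_derive_absring. intros Hf Hg.
  exact (is_derive_mult (K := C_AbsRing) f g z l m Hf Hg Cmult_comm).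
Qed.

Lemma cderiv_comp f g z l m :
  cderiv f (g z) l -> cderiv g z m -> cderiv (fun y => f (g y)) z (m * l)%C.
Proof.
  rewrite <- !cderiv_is_derive_absring. intros Hf Hg.
  exact (is_derive_comp (K := C_AbsRing) (V := AbsRing_NormedModule C_AbsRing) f g z l m Hf Hg).
Qed.

Lemma cderiv_ccont f z l : cderiv f z l -> ccont f z.
Proof.
  rewrite <- cderiv_is_derive_absring, <- ccont_continuous. intros H.
  apply @ex_derive_continuous. exists l; exact H.
Qed.

Lemma ccont_plus f g z : ccont f z -> ccont g z -> ccont (fun y => (f y + g y)%C) z.
Proof.
  rewrite <- !ccont_continuous. intros Hf Hg.
  exact (continuous_plus (U := AbsRing_UniformSpace C_AbsRing)
    (V := AbsRing_NormedModule C_AbsRing) f g z Hf Hg).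
Qed.

Lemma ccont_mult f g z : ccont f z -> ccont g z -> ccont (fun y => (f y * g y)%C) z.
Proof.
  rewrite <- !ccont_continuous. intros Hf Hg.
  exact (continuous_mult (U := AbsRing_UniformSpace C_AbsRing) (K := C_AbsRing) f g z Hf Hg).
Qed.

Lemma ccont_comp f g z : ccont f (g z) -> ccont g z -> ccont (fun y => f (g y)) z.
Proof.
  rewrite <- !ccont_continuous. intros Hf Hg.
  exact (continuous_comp (U := AbsRing_UniformSpace C_AbsRing)
    (V := AbsRing_UniformSpace C_AbsRing) (W := AbsRing_UniformSpace C_AbsRing) g f z Hg Hf).
Qed.

Lemma Cmod_sub_sym (x y : C) : Cmod (x - y)%C = Cmod (y - x)%C.
Proof. rewrite <- Cmod_opp. f_equal. ring. Qed.

Lemma Cmod_triangle_sub (x y : C) : Cmod (x - y)%C <= Cmod x + Cmod y.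
Proof.
  replace (x - y)%C with (x + - y)%C by ring.
  rewrite <- (Cmod_opp y). apply Cmod_triangle.
Qed.

Lemma Cmod_ge_sub (x y : C) : Cmod x - Cmod y <= Cmod (x + y)%C.
Proof.
  pose proof (Cmod_triangle_sub (x + y)%C y) as H.
  replace (x + y - y)%C with x in H by ring. lra.
Qed.

Lemma cderiv_inv (z : C) : z <> RtoC 0 -> cderiv (fun y => (/ y)%C) z (- / (z * z))%C.
Proof.
  intros Hz eps He.
  pose proof (proj1 (Cmod_gt_0 z) Hz) as Hm.
  set (m := Cmod z) in *.
  (* The remainder equals (y - z)^2 / (y z^2). The first radius gives |y| > m/2, hence |y z^2| >
     m^3/2, and the second radius absorbs this factor. *)
  exists (Rmin (m / 2) (eps * m ^ 3 / 2)); split.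
  { apply Rmin_pos; [lra|]. pose proof (pow_lt m 3 Hm). nra. }
  intros y Hy.
  assert (H1 : Cmod (y - z)%C < m / 2) by (eapply Rlt_le_trans; [exact Hy|apply Rmin_l]).
  assert (H2 : Cmod (y - z)%C < eps * m ^ 3 / 2)
    by (eapply Rlt_le_trans; [exact Hy|apply Rmin_r]).
  assert (H3 : m / 2 < Cmod y).
  { pose proof (Cmod_ge_sub z (y - z)%C) as H.
    replace (z + (y - z))%C with y in H by ring. fold m in H. lra. }
  assert (Hy0 : y <> 0%C) by (apply Cmod_gt_0; lra).
  replace (/ y - / z - (y - z) * - / (z * z))%C
    with ((y - z) * (y - z) * / (y * (z * z)))%C by (field; split; assumption).
  rewrite !Cmod_mult, Cmod_inv, !Cmod_mult; fold m.
  2: { apply Cmod_gt_0. rewrite !Cmod_mult. fold m. apply Rmult_lt_0_compat; nra. }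
  set (a := Cmod (y - z)%C) in *. set (b := Cmod y) in *.
  assert (Ha : 0 <= a) by apply Cmod_ge_0.
  assert (Hb : 0 < b * (m * m)) by (apply Rmult_lt_0_compat; nra).
  rewrite Rmult_assoc, (Rmult_comm eps). apply Rmult_le_compat_l; [exact Ha|].
  apply (Rmult_le_reg_r (b * (m * m))); [exact Hb|].
  rewrite Rmult_assoc, Rinv_l, Rmult_1_r by lra.
  apply Rle_trans with (eps * (m / 2 * (m * m))); [lra|].
  apply Rmult_le_compat_l; [lra|]. apply Rmult_le_compat_r; nra.
Qed.

Lemma ccont_inv f z : ccont f z -> f z <> 0%C -> ccont (fun y => (/ f y)%C) z.
Proof.
  intros H H0. apply (ccont_comp (fun y => / y)%C f); [|exact H].
  eapply cderiv_ccont, cderiv_inv, H0.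
Qed.

Lemma ccont_const c z : ccont (fun _ => c) z.
Proof. eapply cderiv_ccont, cderiv_const. Qed.

Lemma ccont_id z : ccont (fun y => y) z.
Proof. eapply cderiv_ccont, cderiv_id. Qed.

Lemma cderiv_bound f z l : cderiv f z l -> exists d, 0 < d /\ forall y, Cmod (y - z)%C < d ->
  Cmod (f y - f z)%C <= (Cmod l + 1) * Cmod (y - z)%C.
Proof.
  intros H. destruct (H 1 Rlt_0_1) as [d [Hd0 Hd]].
  exists d; split; [exact Hd0|]. intros y Hy. specialize (Hd y Hy).
  pose proof (Cmod_triangle (f y - f z - (y - z) * l)%C ((y - z) * l)%C) as H1.
  replace (f y - f z - (y - z) * l + (y - z) * l)%C with (f y - f z)%C in H1 by ring.
  rewrite Cmod_mult in H1. lra.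
Qed.

(** Componentwise, so that real calculus ([auto_derive], the mean value theorem) applies to paths in
    the plane. *)
Definition path_derive (u : R -> C) (t : R) (l : C) : Prop :=
  is_derive (fun s => fst (u s)) t (fst l) /\ is_derive (fun s => snd (u s)) t (snd l).

Lemma Cmod_le_abs (z : C) : Cmod z <= Rabs (fst z) + Rabs (snd z).
Proof.
  replace z with ((fst z, 0) + (0, snd z))%C
    by (destruct z; unfold Cplus; simpl; f_equal; ring).
  eapply Rle_trans; [apply Cmod_triangle|].
  apply Req_le. simpl. rewrite Rplus_0_r, Rplus_0_l. f_equal.
  - rewrite <- Cmod_R. reflexivity.
  - unfold Cmod; simpl. rewrite <- sqrt_Rsqr_abs. f_equal. unfold Rsqr. ring.
Qed.

Lemma abs_fst_le (z : C) : Rabs (fst z) <= Cmod z.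
Proof. eapply Rle_trans; [apply Rmax_l|apply Rmax_Cmod]. Qed.

Lemma abs_snd_le (z : C) : Rabs (snd z) <= Cmod z.
Proof. eapply Rle_trans; [apply Rmax_r|apply Rmax_Cmod]. Qed.

Lemma path_derive_eps u t l : path_derive u t l <->
  forall eps, 0 < eps -> exists d, 0 < d /\ forall s, Rabs (s - t) < d ->
    Cmod (u s - u t - RtoC (s - t) * l)%C <= eps * Rabs (s - t).
Proof.
  unfold path_derive. rewrite !is_derive_eps. split.
  - intros [H1 H2] eps He. assert (He2 : 0 < eps / 2) by lra.
    destruct (H1 (mkposreal _ He2)) as [d1 Hd1].
    destruct (H2 (mkposreal _ He2)) as [d2 Hd2].
    exists (Rmin d1 d2); split; [apply Rmin_pos; apply cond_pos|].
    intros s Hs.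
    assert (Hs1 : Rabs (s - t) < d1) by (eapply Rlt_le_trans; [exact Hs|apply Rmin_l]).
    assert (Hs2 : Rabs (s - t) < d2) by (eapply Rlt_le_trans; [exact Hs|apply Rmin_r]).
    specialize (Hd1 s Hs1). specialize (Hd2 s Hs2).
    change (Rabs (fst (u s) - fst (u t) - (s - t) * fst l) <= eps / 2 * Rabs (s - t)) in Hd1.
    change (Rabs (snd (u s) - snd (u t) - (s - t) * snd l) <= eps / 2 * Rabs (s - t)) in Hd2.
    eapply Rle_trans; [apply Cmod_le_abs|].
    replace (fst (u s - u t - RtoC (s - t) * l)%C)
      with (fst (u s) - fst (u t) - (s - t) * fst l) by (simpl; ring).
    replace (snd (u s - u t - RtoC (s - t) * l)%C)
      with (snd (u s) - snd (u t) - (s - t) * snd l) by (simpl; ring).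
    lra.
  - intros H; split; intros [eps He]; destruct (H eps He) as [d [Hd0 Hd]];
      exists (mkposreal d Hd0); intros s Hs; specialize (Hd s Hs).
    + change (Rabs (fst (u s) - fst (u t) - (s - t) * fst l) <= eps * Rabs (s - t)).
      eapply Rle_trans; [|exact Hd]. eapply Rle_trans; [|apply abs_fst_le].
      apply Req_le. f_equal. simpl. ring.
    + change (Rabs (snd (u s) - snd (u t) - (s - t) * snd l) <= eps * Rabs (s - t)).
      eapply Rle_trans; [|exact Hd]. eapply Rle_trans; [|apply abs_snd_le].
      apply Req_le. f_equal. simpl. ring.
Qed.

Lemma path_derive_comp F u t l m :
  cderiv F (u t) l -> path_derive u t m -> path_derive (fun s => F (u s)) t (l * m)%C.
Proof.
  rewrite !path_derive_eps. intros HF Hu eps He.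
  pose proof (Cmod_ge_0 l) as Hl. pose proof (Cmod_ge_0 m) as Hm.
  assert (He1 : 0 < eps / (2 * (Cmod m + 1))) by (apply Rdiv_lt_0_compat; lra).
  destruct (HF _ He1) as [d1 [Hd1 H1]].
  (* The cap 1 gives the crude bound |u s - u t| <= (|m| + 1)|s - t|; the second entry pays for the
     error of u once it is multiplied by l. *)
  assert (He2 : 0 < Rmin 1 (eps / (2 * (Cmod l + 1))))
    by (apply Rmin_pos; [lra|apply Rdiv_lt_0_compat; lra]).
  destruct (Hu _ He2) as [d2 [Hd2 H2]].
  exists (Rmin d2 (d1 / (Cmod m + 1))); split.
  { apply Rmin_pos; [exact Hd2|apply Rdiv_lt_0_compat; lra]. }
  intros s Hs.
  assert (Hs1 : Rabs (s - t) < d2) by (eapply Rlt_le_trans; [exact Hs|apply Rmin_l]).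
  assert (Hs2 : Rabs (s - t) < d1 / (Cmod m + 1))
    by (eapply Rlt_le_trans; [exact Hs|apply Rmin_r]).
  specialize (H2 s Hs1).
  set (a := Rabs (s - t)) in *. assert (Ha : 0 <= a) by apply Rabs_pos.
  assert (H3 : Cmod (u s - u t)%C <= (Cmod m + 1) * a).
  { pose proof (Cmod_triangle (u s - u t - RtoC (s - t) * m)%C (RtoC (s - t) * m)%C) as H.
    replace (u s - u t - RtoC (s - t) * m + RtoC (s - t) * m)%C
      with (u s - u t)%C in H by ring.
    rewrite Cmod_mult, Cmod_R in H. fold a in H.
    pose proof (Rmin_l 1 (eps / (2 * (Cmod l + 1)))). nra. }
  assert (H4 : Cmod (u s - u t)%C < d1).
  { eapply Rle_lt_trans; [exact H3|]. apply (Rmult_lt_compat_l (Cmod m + 1)) in Hs2; [|lra].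
    replace ((Cmod m + 1) * (d1 / (Cmod m + 1))) with d1 in Hs2 by (field; lra). exact Hs2. }
  specialize (H1 _ H4).
  replace (F (u s) - F (u t) - RtoC (s - t) * (l * m))%C
    with ((F (u s) - F (u t) - (u s - u t) * l) + l * (u s - u t - RtoC (s - t) * m))%C by ring.
  eapply Rle_trans; [apply Cmod_triangle|]. rewrite Cmod_mult.
  assert (E1 : eps / (2 * (Cmod m + 1)) * ((Cmod m + 1) * a) = eps / 2 * a) by (field; lra).
  assert (E2 : (Cmod l + 1) * (eps / (2 * (Cmod l + 1)) * a) = eps / 2 * a) by (field; lra).
  pose proof (Rmin_r 1 (eps / (2 * (Cmod l + 1)))) as H5.
  apply Rle_trans with (eps / 2 * a + eps / 2 * a); [|lra].
  apply Rplus_le_compat.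
  - rewrite <- E1. eapply Rle_trans; [exact H1|]. apply Rmult_le_compat_l; lra.
  - rewrite <- E2. apply Rmult_le_compat; try lra; [apply Cmod_ge_0|].
    eapply Rle_trans; [exact H2|]. apply Rmult_le_compat_r; lra.
Qed.

Lemma path_derive_segment z h t : path_derive (fun s => z + RtoC s * h)%C t h.
Proof.
  split; simpl; auto_derive; trivial; ring.
Qed.

Lemma path_derive_ext u v t l : (forall s, u s = v s) -> path_derive u t l -> path_derive v t l.
Proof.
  intros E [H1 H2]; split; (eapply is_derive_ext; [|eassumption]);
    intros s; simpl; rewrite E; reflexivity.
Qed.

Lemma path_derive_plus u v t l m :
  path_derive u t l -> path_derive v t m -> path_derive (fun s => u s + v s)%C t (l + m)%C.
Proof.
  intros [H1 H2] [H3 H4]; split; simpl.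
  - exact (is_derive_plus _ _ _ _ _ H1 H3).
  - exact (is_derive_plus _ _ _ _ _ H2 H4).
Qed.

Lemma path_derive_scal c u t l :
  path_derive u t l -> path_derive (fun s => c * u s)%C t (c * l)%C.
Proof.
  intros H. apply (path_derive_comp (fun y => c * y)%C u); [|exact H].
  pose proof (cderiv_mult (fun _ => c) (fun y => y) (u t) _ _
    (cderiv_const c _) (cderiv_id _)) as H1. cbv beta in H1.
  replace (0 * u t + c * 1)%C with c in H1 by ring. exact H1.
Qed.

Lemma real_MVT (f df : R -> R) :
  (forall t, 0 <= t <= 1 -> is_derive f t (df t)) ->
  exists t, 0 < t < 1 /\ f 1 - f 0 = df t.
Proof.
  intros H. destruct (MVT_cor2 f df 0 1 Rlt_0_1) as [t [E Ht]].
  - intros t Ht. apply is_derive_Reals, H, Ht.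
  - exists t; split; [exact Ht|]. rewrite E. ring.
Qed.

(** The mean value theorem fails for complex-valued paths, so it is applied to the two components
    separately, at two different points; this costs the factor 2. *)
Lemma path_MVT_bound (u du : R -> C) (M : R) :
  (forall t, 0 <= t <= 1 -> path_derive u t (du t)) ->
  (forall t, 0 <= t <= 1 -> Cmod (du t) <= M) -> Cmod (u 1 - u 0)%C <= 2 * M.
Proof.
  intros H HM.
  destruct (real_MVT (fun t => fst (u t)) (fun t => fst (du t))) as [t1 [Ht1 E1]].
  { intros t Ht. apply (H t Ht). }
  destruct (real_MVT (fun t => snd (u t)) (fun t => snd (du t))) as [t2 [Ht2 E2]].
  { intros t Ht. apply (H t Ht). }
  eapply Rle_trans; [apply Cmod_le_abs|].
  replace (fst (u 1 - u 0)%C) with (fst (u 1) - fst (u 0)) by (simpl; ring).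
  replace (snd (u 1 - u 0)%C) with (snd (u 1) - snd (u 0)) by (simpl; ring).
  rewrite E1, E2.
  pose proof (HM t1 ltac:(lra)). pose proof (HM t2 ltac:(lra)).
  pose proof (abs_fst_le (du t1)). pose proof (abs_snd_le (du t2)). lra.
Qed.

(** Subtracting the linear map h -> dF z * h leaves a path whose velocity (dF(z + t h) - dF z) h is
    small by continuity. This reduces complex differentiability of [log1p] and [Cexp] to
    one-variable calculus. *)
Lemma cderiv_of_segments F dF z r : 0 < r ->
  (forall h t, Cmod h < r -> 0 <= t <= 1 ->
     path_derive (fun s => F (z + RtoC s * h)%C) t (dF (z + RtoC t * h)%C * h)%C) ->
  ccont dF z -> cderiv F z (dF z).
Proof.
  intros Hr H Hc eps He.
  assert (He2 : 0 < eps / 2) by lra.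
  destruct (Hc _ He2) as [d [Hd0 Hd]].
  exists (Rmin d r); split; [apply Rmin_pos; assumption|]. intros y Hy.
  set (h := (y - z)%C) in *.
  assert (H1 : Cmod h < d) by (eapply Rlt_le_trans; [exact Hy|apply Rmin_l]).
  assert (H2 : Cmod h < r) by (eapply Rlt_le_trans; [exact Hy|apply Rmin_r]).
  pose proof (path_MVT_bound (fun s => F (z + RtoC s * h) + (- dF z) * (0 + RtoC s * h))%C
    (fun t => dF (z + RtoC t * h) * h + (- dF z) * h)%C (eps / 2 * Cmod h)) as HM.
  replace (F y - F z - h * dF z)%C with
    ((F (z + RtoC 1 * h) + (- dF z) * (0 + RtoC 1 * h)) -
     (F (z + RtoC 0 * h) + (- dF z) * (0 + RtoC 0 * h)))%C.
  - replace (eps * Cmod h) with (2 * (eps / 2 * Cmod h)) by field. apply HM.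
    + intros t Ht. apply path_derive_plus; [apply H; assumption|].
      apply path_derive_scal, path_derive_segment.
    + intros t Ht. replace (dF (z + RtoC t * h) * h + (- dF z) * h)%C
        with ((dF (z + RtoC t * h) - dF z) * h)%C by ring.
      rewrite Cmod_mult. apply Rmult_le_compat_r; [apply Cmod_ge_0|].
      apply Rlt_le, Hd. replace (z + RtoC t * h - z)%C with (RtoC t * h)%C by ring.
      rewrite Cmod_mult, Cmod_R, Rabs_pos_eq by lra.
      pose proof (Cmod_ge_0 h). nra.
  - replace (z + RtoC 1 * h)%C with y by (unfold h; ring).
    replace (z + RtoC 0 * h)%C with z by ring. ring.
Qed.

(** * Circle means of holomorphic functions *)

(** The origin is left out because the functions to be averaged contain negative powers of z;
    continuity of [dh] is what differentiation under the integral sign requires. *)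
Definition C1_punctured (h dh : C -> C) : Prop :=
  forall z, 0 < Cmod z < 1 -> cderiv h z (dh z) /\ ccont dh z.

Definition polar (r t : R) : C := (r * cos t, r * sin t).

Lemma Cmod_polar r t : 0 <= r -> Cmod (polar r t) = r.
Proof.
  intros Hr. unfold Cmod, polar; simpl.
  replace (r * cos t * (r * cos t * 1) + r * sin t * (r * sin t * 1)) with (r * r).
  - apply sqrt_square, Hr.
  - pose proof (sin2_cos2 t) as H. unfold Rsqr in H.
    transitivity (r * r * (sin t * sin t + cos t * cos t)); [rewrite H; ring|ring].
Qed.

Lemma polar_derive_r r t : path_derive (fun s => polar s t) r (cos t, sin t).
Proof. split; unfold polar; simpl; auto_derive; trivial; ring. Qed.

Lemma polar_derive_t r t : path_derive (fun s => polar r s) t (- r * sin t, r * cos t).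
Proof. split; unfold polar; simpl; auto_derive; trivial; ring. Qed.

Lemma continuity_2d_ccont (F : C -> C) (p q : R -> R -> R) x y :
  continuity_2d_pt p x y -> continuity_2d_pt q x y -> ccont F (p x y, q x y) ->
  continuity_2d_pt (fun u v => fst (F (p u v, q u v))) x y /\
  continuity_2d_pt (fun u v => snd (F (p u v, q u v))) x y.
Proof.
  intros Hp Hq HF.
  assert (H : forall eps : posreal, locally_2d (fun u v =>
    Cmod (F (p u v, q u v) - F (p x y, q x y))%C < eps) x y).
  { intros eps. destruct (HF eps (cond_pos eps)) as [d [Hd0 Hd]].
    assert (Hd2 : 0 < d / 2) by lra.
    generalize (locally_2d_and _ _ _ _ (Hp (mkposreal _ Hd2)) (Hq (mkposreal _ Hd2))).
    apply locally_2d_impl, locally_2d_forall. intros u v [H1 H2].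
    apply Hd. eapply Rle_lt_trans; [apply Cmod_le_abs|]. simpl in *.
    unfold Rminus in *. lra. }
  split; intros eps; generalize (H eps); apply locally_2d_impl, locally_2d_forall;
    intros u v Huv; (eapply Rle_lt_trans; [|exact Huv]).
  - apply (abs_fst_le (F (p u v, q u v) - F (p x y, q x y))%C).
  - apply (abs_snd_le (F (p u v, q u v) - F (p x y, q x y))%C).
Qed.

Lemma continuity_2d_snd_comp (f : R -> R) x y : continuity_pt f y ->
  continuity_2d_pt (fun _ v => f v) x y.
Proof.
  intros H. apply (continuity_1d_2d_pt_comp f (fun _ v => v)); [exact H|].
  apply continuity_2d_pt_id2.
Qed.

(** This is Re(e^(it) h'(r e^(it))). By the Cauchy-Riemann equations it is both the r-derivative of
    Re h and 1/r times the t-derivative of Im h. *)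
Definition radial_part (dh : C -> C) (r t : R) : R :=
  fst (dh (polar r t)) * cos t - snd (dh (polar r t)) * sin t.

Lemma radial_part_continuous h dh r t : C1_punctured h dh -> 0 < r < 1 ->
  continuity_2d_pt (radial_part dh) r t.
Proof.
  intros H Hr.
  destruct (continuity_2d_ccont dh (fun u v => u * cos v) (fun u v => u * sin v) r t)
    as [H1 H2].
  - apply continuity_2d_pt_mult; [apply continuity_2d_pt_id1|].
    apply continuity_2d_snd_comp, continuity_cos.
  - apply continuity_2d_pt_mult; [apply continuity_2d_pt_id1|].
    apply continuity_2d_snd_comp, continuity_sin.
  - apply (H (polar r t)). rewrite Cmod_polar; lra.
  - apply continuity_2d_pt_minus; apply continuity_2d_pt_mult; trivial;
      apply continuity_2d_snd_comp; [apply continuity_cos|apply continuity_sin].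
Qed.

Lemma circle_derive_r h dh r t : C1_punctured h dh -> 0 < r < 1 ->
  is_derive (fun s => fst (h (polar s t))) r (radial_part dh r t).
Proof.
  intros H Hr. destruct (H (polar r t)) as [Hd _]; [rewrite Cmod_polar; lra|].
  exact (proj1 (path_derive_comp h (fun s => polar s t) r _ _ Hd (polar_derive_r r t))).
Qed.

(** Under the integral sign the r-derivative of Re h is the t-derivative of the periodic function Im
    h / r, so it integrates to 0 over a full turn. *)
Lemma circle_integral_derive h dh r : C1_punctured h dh -> 0 < r < 1 ->
  is_derive (fun s => RInt (fun t => fst (h (polar s t))) 0 (2 * PI)) r 0.
Proof.
  intros H Hr.
  assert (Hloc : locally r (fun s : R => 0 < s < 1)).
  { assert (Hp : 0 < Rmin r (1 - r)) by (apply Rmin_pos; lra).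
    exists (mkposreal _ Hp). intros s Hs.
    change (Rabs (s - r) < Rmin r (1 - r)) in Hs.
    pose proof (Rmin_l r (1 - r)). pose proof (Rmin_r r (1 - r)).
    apply Rabs_def2 in Hs. lra. }
  assert (HI : is_RInt (radial_part dh r) 0 (2 * PI) 0).
  { assert (E : minus (/ r * snd (h (polar r (2 * PI)))) (/ r * snd (h (polar r 0))) = 0).
    { unfold polar. rewrite cos_2PI, sin_2PI, cos_0, sin_0.
      unfold minus, plus, opp; simpl. ring. }
    refine (eq_ind _ (is_RInt (radial_part dh r) 0 (2 * PI)) _ 0 E).
    apply (is_RInt_derive (fun t => / r * snd (h (polar r t)))).
    - intros t _. destruct (H (polar r t)) as [Hd _]; [rewrite Cmod_polar; lra|].
      destruct (path_derive_comp h (fun s => polar r s) t _ _ Hd (polar_derive_t r t))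
        as [_ H2].
      replace (radial_part dh r t)
        with (/ r * snd (Cmult (dh (polar r t)) (- r * sin t, r * cos t))).
      + apply (is_derive_scal (fun s => snd (h (polar r s)))). exact H2.
      + unfold radial_part; simpl. field. lra.
    - intros t _. apply continuity_pt_filterlim.
      pose proof (radial_part_continuous h dh r t H Hr) as Hc.
      apply continuity_pt_locally. intros eps. destruct (Hc eps) as [d Hd].
      exists d. intros s Hs. apply Hd; [|exact Hs].
      rewrite Rminus_diag, Rabs_R0. apply cond_pos. }
  assert (E : RInt (fun t => Derive (fun u => fst (h (polar u t))) r) 0 (2 * PI) = 0).
  { apply is_RInt_unique. eapply is_RInt_ext; [|exact HI].
    intros t _. symmetry. apply is_derive_unique, circle_derive_r; assumption. }
  refine (eq_ind _ (is_derive (fun s => RInt (fun t => fst (h (polar s t))) 0 (2 * PI)) r) _ 0 E).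
  apply (is_derive_RInt_param (fun s t => fst (h (polar s t)))).
  - revert Hloc. apply filter_imp. intros s Hs t _.
    eexists. apply circle_derive_r; eassumption.
  - intros t _. apply continuity_2d_pt_ext_loc with (radial_part dh).
    + destruct Hloc as [d Hd]. exists d. intros u v Hu _.
      symmetry. apply is_derive_unique, circle_derive_r; [exact H|]. apply Hd, Hu.
    + eapply radial_part_continuous; eassumption.
  - revert Hloc. apply filter_imp. intros s Hs.
    apply @ex_RInt_continuous. intros t _. apply @ex_derive_continuous.
    destruct (H (polar s t)) as [Hd _]; [rewrite Cmod_polar; lra|].
    eexists.
    exact (proj1 (path_derive_comp h (fun v => polar s v) t _ _ Hd (polar_derive_t s t))).
Qed.

Lemma circle_integral_const h dh r1 r2 : C1_punctured h dh -> 0 < r1 < 1 -> 0 < r2 < 1 ->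
  RInt (fun t => fst (h (polar r1 t))) 0 (2 * PI) =
  RInt (fun t => fst (h (polar r2 t))) 0 (2 * PI).
Proof.
  intros H H1 H2.
  assert (Hm : forall s, Rmin r1 r2 <= s <= Rmax r1 r2 -> 0 < s < 1).
  { intros s Hs. split.
    - eapply Rlt_le_trans; [|apply Hs]. apply Rmin_pos; lra.
    - eapply Rle_lt_trans; [apply Hs|]. apply Rmax_lub_lt; lra. }
  destruct (MVT_gen (fun s => RInt (fun t => fst (h (polar s t))) 0 (2 * PI)) r1 r2
    (fun _ => 0)) as [c [_ E]].
  - intros s Hs. eapply circle_integral_derive; [exact H|]. apply Hm; lra.
  - intros s Hs. apply derivable_continuous_pt. exists 0.
    apply is_derive_Reals, (circle_integral_derive h dh); [exact H|]. apply Hm; lra.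
  - lra.
Qed.

Lemma circle_ex_RInt h dh r : C1_punctured h dh -> 0 < r < 1 ->
  ex_RInt (fun t => fst (h (polar r t))) 0 (2 * PI).
Proof.
  intros H Hr. apply @ex_RInt_continuous. intros t _. apply @ex_derive_continuous.
  destruct (H (polar r t)) as [Hd _]; [rewrite Cmod_polar; lra|].
  eexists.
  exact (proj1 (path_derive_comp h (fun v => polar r v) t _ _ Hd (polar_derive_t r t))).
Qed.

(** The mean of Re h is the same on all circles. If c were negative, a circle so small that |h| <=
    -c/2 on it would have mean at least c/2, while the circle |z| = r has mean at most c. *)
Lemma mean_value_nonneg h dh r c : C1_punctured h dh -> 0 < r < 1 ->
  (forall eps, 0 < eps -> exists d, 0 < d /\ forall z, 0 < Cmod z < d -> Cmod (h z) <= eps) ->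
  (forall z, Cmod z = r -> fst (h z) <= c) -> 0 <= c.
Proof.
  intros H Hr Hlim Hc. apply Rnot_lt_le. intros Hneg.
  destruct (Hlim (- c / 2)) as [d [Hd0 Hd]]; [lra|].
  set (r' := Rmin (d / 2) (/ 2)).
  assert (Hr' : 0 < r') by (apply Rmin_pos; lra).
  assert (Hr'd : r' <= d / 2) by apply Rmin_l.
  assert (Hr'1 : r' <= / 2) by apply Rmin_r.
  pose proof PI_RGT_0.
  pose proof (circle_integral_const h dh r r' H Hr ltac:(lra)) as E.
  assert (U : RInt (fun t => fst (h (polar r t))) 0 (2 * PI) <= RInt (fun _ => c) 0 (2 * PI)).
  { apply RInt_le; [lra| eapply circle_ex_RInt; eassumption| apply ex_RInt_const|].
    intros t _. apply Hc, Cmod_polar. lra. }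
  assert (L : RInt (fun _ => c / 2) 0 (2 * PI) <= RInt (fun t => fst (h (polar r' t))) 0 (2 * PI)).
  { apply RInt_le; [lra| apply ex_RInt_const|eapply circle_ex_RInt; [eassumption|lra]|].
    intros t _. assert (B : Cmod (h (polar r' t)) <= - c / 2)
      by (apply Hd; rewrite Cmod_polar; lra).
    pose proof (abs_fst_le (h (polar r' t))) as B2.
    assert (B3 := Rle_trans _ _ _ B2 B). apply Rabs_le_between in B3. lra. }
  rewrite RInt_const in U, L. unfold scal in U, L; simpl in U, L.
  unfold mult in U, L; simpl in U, L. nra.
Qed.

(** * Toeplitz contraction for bounded functions *)

(** The bound is also imposed at z = 0, so for n > 0 it forces u to vanish there. *)
Definition bigO (n : nat) (u : C -> C) : Prop :=
  exists M d, 0 <= M /\ 0 < d /\ forall z, Cmod z < d -> Cmod (u z) <= M * Cmod z ^ n.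

Lemma bigO_ext n u v d : 0 < d -> (forall z, Cmod z < d -> u z = v z) ->
  bigO n u -> bigO n v.
Proof.
  intros Hd E [M [d' [HM [Hd' H]]]]. exists M, (Rmin d d').
  split; [exact HM|split; [apply Rmin_pos; assumption|]].
  intros z Hz. rewrite <- E.
  - apply H. eapply Rlt_le_trans; [exact Hz|apply Rmin_r].
  - eapply Rlt_le_trans; [exact Hz|apply Rmin_l].
Qed.

Lemma bigO_plus n u v : bigO n u -> bigO n v -> bigO n (fun z => u z + v z)%C.
Proof.
  intros [M [d [HM [Hd H]]]] [N [d' [HN [Hd' H']]]].
  exists (M + N), (Rmin d d').
  split; [lra|split; [apply Rmin_pos; assumption|]]. intros z Hz.
  eapply Rle_trans; [apply Cmod_triangle|]. rewrite Rmult_plus_distr_r.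
  apply Rplus_le_compat; [apply H|apply H'];
    (eapply Rlt_le_trans; [exact Hz|]); [apply Rmin_l|apply Rmin_r].
Qed.

Lemma bigO_mult n m u v : bigO n u -> bigO m v -> bigO (n + m) (fun z => u z * v z)%C.
Proof.
  intros [M [d [HM [Hd H]]]] [N [d' [HN [Hd' H']]]].
  exists (M * N), (Rmin d d').
  split; [nra|split; [apply Rmin_pos; assumption|]]. intros z Hz.
  rewrite Cmod_mult, pow_add.
  replace (M * N * (Cmod z ^ n * Cmod z ^ m)) with (M * Cmod z ^ n * (N * Cmod z ^ m)) by ring.
  apply Rmult_le_compat; try apply Cmod_ge_0; [apply H|apply H'];
    (eapply Rlt_le_trans; [exact Hz|]); [apply Rmin_l|apply Rmin_r].
Qed.

Lemma bigO_const c : bigO 0 (fun _ => c).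
Proof.
  exists (Cmod c), 1. split; [apply Cmod_ge_0|split; [lra|]]. intros z _. simpl. lra.
Qed.

Lemma bigO_id : bigO 1 (fun z => z).
Proof. exists 1, 1. split; [lra|split; [lra|]]. intros z _. simpl. lra. Qed.

Lemma bigO_weaken n m u : (n <= m)%nat -> bigO m u -> bigO n u.
Proof.
  intros Hnm [M [d [HM [Hd H]]]]. exists M, (Rmin d 1).
  split; [exact HM|split; [apply Rmin_pos; lra|]]. intros z Hz.
  assert (H1 : Cmod z < 1) by (eapply Rlt_le_trans; [exact Hz|apply Rmin_r]).
  eapply Rle_trans; [apply H; eapply Rlt_le_trans; [exact Hz|apply Rmin_l]|].
  apply Rmult_le_compat_l; [exact HM|].
  replace m with (n + (m - n))%nat by lia. rewrite pow_add.
  pose proof (Cmod_ge_0 z) as H0.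
  rewrite <- (Rmult_1_r (Cmod z ^ n)) at 2. apply Rmult_le_compat_l; [apply pow_le, H0|].
  rewrite <- (pow1 (m - n)). apply pow_incr. lra.
Qed.

Lemma bigO_scal n c u : bigO n u -> bigO n (fun z => c * u z)%C.
Proof. intros H. exact (bigO_mult 0 n _ _ (bigO_const c) H). Qed.

Lemma bigO_div n u : bigO (S n) u -> bigO n (fun z => u z * / z)%C.
Proof.
  intros [M [d [HM [Hd H]]]]. exists M, d. split; [exact HM|split; [exact Hd|]].
  intros z Hz. specialize (H z Hz).
  destruct (Ceq_dec z 0) as [E|E].
  (* At the origin u vanishes, so the default value of [/ 0] is multiplied by 0. *)
  - assert (E0 : u z = 0%C).
    { apply Cmod_eq_0, Rle_antisym; [|apply Cmod_ge_0].
      subst z. rewrite Cmod_0 in H. simpl in H. lra. }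
    rewrite E0, Cmult_0_l, Cmod_0. apply Rmult_le_pos; [exact HM|].
    apply pow_le, Cmod_ge_0.
  - rewrite Cmod_mult, Cmod_inv by exact E. pose proof (proj1 (Cmod_gt_0 z) E).
    apply (Rmult_le_reg_r (Cmod z)); [assumption|].
    rewrite Rmult_assoc, Rinv_l, Rmult_1_r by lra. simpl in H. lra.
Qed.

Lemma bigO_comp n u v : bigO n u -> bigO 1 v -> bigO n (fun z => u (v z)).
Proof.
  intros [M [d [HM [Hd H]]]] [N [d' [HN [Hd' H']]]].
  exists (M * N ^ n), (Rmin d' (d / (N + 1))).
  split; [apply Rmult_le_pos; [exact HM|apply pow_le, HN]|].
  split; [apply Rmin_pos; [exact Hd'|apply Rdiv_lt_0_compat; lra]|].
  intros z Hz.
  assert (H1 : Cmod (v z) <= N * Cmod z).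
  { rewrite <- (pow_1 (Cmod z)). apply H'. eapply Rlt_le_trans; [exact Hz|apply Rmin_l]. }
  assert (H2 : (N + 1) * Cmod z < d).
  { replace d with ((N + 1) * (d / (N + 1))) by (field; lra).
    apply Rmult_lt_compat_l; [lra|]. eapply Rlt_le_trans; [exact Hz|apply Rmin_r]. }
  pose proof (Cmod_ge_0 z).
  eapply Rle_trans; [apply H; lra|]. rewrite Rmult_assoc, <- Rpow_mult_distr.
  apply Rmult_le_compat_l; [exact HM|]. apply pow_incr. split; [apply Cmod_ge_0|exact H1].
Qed.

Definition C1_off0 (h : C -> C) : Prop := exists dh, C1_punctured h dh.

Lemma C1_off0_const c : C1_off0 (fun _ => c).
Proof. exists (fun _ => RtoC 0). intros z _; split; [apply cderiv_const|apply ccont_const]. Qed.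

Lemma C1_off0_id : C1_off0 (fun z => z).
Proof. exists (fun _ => RtoC 1). intros z _; split; [apply cderiv_id|apply ccont_const]. Qed.

Lemma C1_off0_inv : C1_off0 (fun z => / z)%C.
Proof.
  exists (fun z => - / (z * z))%C. intros z [Hz _]. apply Cmod_gt_0 in Hz.
  split; [apply cderiv_inv, Hz|].
  apply (ccont_ext_loc (fun z => (RtoC (-1)) * / (z * z))%C _ z 1 Rlt_0_1).
  { intros y _. ring. }
  apply ccont_mult; [apply ccont_const|].
  apply ccont_inv; [apply ccont_mult; apply ccont_id|]. apply Cmult_neq_0; assumption.
Qed.

Lemma C1_off0_plus u v : C1_off0 u -> C1_off0 v -> C1_off0 (fun z => u z + v z)%C.
Proof.
  intros [du Hu] [dv Hv]. exists (fun z => du z + dv z)%C. intros z Hz.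
  destruct (Hu z Hz), (Hv z Hz). split; [apply cderiv_plus|apply ccont_plus]; assumption.
Qed.

Lemma C1_off0_mult u v : C1_off0 u -> C1_off0 v -> C1_off0 (fun z => u z * v z)%C.
Proof.
  intros [du Hu] [dv Hv]. exists (fun z => du z * v z + u z * dv z)%C. intros z Hz.
  destruct (Hu z Hz) as [H1 H2], (Hv z Hz) as [H3 H4].
  split; [apply cderiv_mult; assumption|].
  apply ccont_plus; apply ccont_mult; try assumption; eapply cderiv_ccont; eassumption.
Qed.

Lemma Cmod_sq (z : C) : Cmod z ^ 2 = fst z ^ 2 + snd z ^ 2.
Proof. apply Cmod2_alt. Qed.

(** Since z conj z = rho, all cross terms together are the real part of a polynomial in z without
    constant term, which has mean 0 on the circle. What remains is Parseval's sum. *)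
Lemma Cmod_sq_quadratic (u0 u1 u2 z : C) (rho : R) : Cmod z ^ 2 = rho ->
  Cmod (u0 + u1 * z + u2 * (z * z))%C ^ 2 =
  Cmod u0 ^ 2 + Cmod u1 ^ 2 * rho + Cmod u2 ^ 2 * rho ^ 2 +
  2 * fst ((u1 * Cconj u0 + RtoC rho * (u2 * Cconj u1)) * z + u2 * Cconj u0 * (z * z))%C.
Proof.
  intros <-. rewrite !Cmod_sq. destruct u0, u1, u2, z. simpl. ring.
Qed.

Lemma Cmod_sq_plus (x y : C) :
  Cmod (x + y)%C ^ 2 = Cmod x ^ 2 + Cmod y ^ 2 + 2 * fst (x * Cconj y)%C.
Proof. rewrite !Cmod_sq. destruct x, y. simpl. ring. Qed.

Lemma Cconj_on_circle (z : C) rho : Cmod z ^ 2 = rho -> 0 < rho ->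
  Cconj z = (RtoC rho * / z)%C.
Proof.
  intros E Hr.
  assert (Hz : z <> RtoC 0).
  { intros ->. rewrite Cmod_0 in E. simpl in E. lra. }
  rewrite <- E, Cmod2_conj. field. exact Hz.
Qed.

(** One writes w q = z D + e, where z D collects the terms of degree at most 3 of (c1 z + c2 z^2 +
    c3 z^3) q and e = O(z^4). Averaging |z D + e|^2 <= |q|^2 over |z| = r and dropping |e|^2 gives
    the claim, because the cross terms form the real part of the function [h] below, which tends to
    0 at 0. *)
Lemma schur_contraction_radius (w : C -> C) (c1 c2 c3 q0 q1 q2 : C) (r : R) :
  C1_off0 w -> (forall z, Cmod z < 1 -> Cmod (w z) <= 1) ->
  bigO 4 (fun z => w z - (c1 * z + c2 * z ^ 2 + c3 * z ^ 3))%C ->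
  0 < r < 1 ->
  let d1 := (c1 * q0)%C in let d2 := (c1 * q1 + c2 * q0)%C in
  let d3 := (c1 * q2 + c2 * q1 + c3 * q0)%C in
  0 <= Cmod q0 ^ 2 + Cmod q1 ^ 2 * r ^ 2 + Cmod q2 ^ 2 * (r ^ 2) ^ 2
       - r ^ 2 * (Cmod d1 ^ 2 + Cmod d2 ^ 2 * r ^ 2 + Cmod d3 ^ 2 * (r ^ 2) ^ 2).
Proof.
  intros w_C1 w_le w_exp Hr d1 d2 d3. set (rho := r ^ 2).
  assert (Hrho : 0 < rho) by (apply pow_lt; lra).
  set (e := fun z => (w z * (q0 + q1 * z + q2 * (z * z))
                      + - (z * (d1 + d2 * z + d3 * (z * z))))%C).
  (* On |z|^2 = rho this equals conj z; unlike the conjugate it is holomorphic off 0. *)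
  set (v := fun z : C => (RtoC rho * / z)%C).
  (* Twice the following: rho times the oscillating part of |D|^2, plus e conj(z D), minus the
     oscillating part of |q|^2. *)
  set (h := fun z => (RtoC (2 * rho) *
        ((d2 * Cconj d1 + RtoC rho * (d3 * Cconj d2)) * z + d3 * Cconj d1 * (z * z))
      + RtoC 2 * (Cconj d1 * (e z * v z) + Cconj d2 * (e z * v z * v z)
                  + Cconj d3 * (e z * v z * v z * v z))
      + RtoC (-2) * ((q1 * Cconj q0 + RtoC rho * (q2 * Cconj q1)) * z
                  + q2 * Cconj q0 * (z * z)))%C).
  assert (He : bigO 4 e).
  { apply (bigO_ext 4 (fun z => (w z - (c1 * z + c2 * z ^ 2 + c3 * z ^ 3))
        * (q0 + q1 * z + q2 * (z * z))
        + (z * z * (z * z)) * ((c2 * q2 + c3 * q1) + c3 * q2 * z))%C _ 1 Rlt_0_1).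
    - intros z _. unfold e, d1, d2, d3. ring.
    - apply bigO_plus.
      + apply (bigO_mult 4 0); [exact w_exp|].
        apply bigO_plus; [apply bigO_plus; [apply bigO_const|]|].
        * apply (bigO_weaken 0 1); [lia|]. apply bigO_scal, bigO_id.
        * apply (bigO_weaken 0 2); [lia|]. apply bigO_scal, (bigO_mult 1 1); apply bigO_id.
      + apply (bigO_mult 4 0).
        * apply (bigO_mult 2 2); apply (bigO_mult 1 1); apply bigO_id.
        * apply bigO_plus; [apply bigO_const|].
          apply (bigO_weaken 0 1); [lia|]. apply bigO_scal, bigO_id. }
  assert (Hv : forall n u, bigO (S n) u -> bigO n (fun z => u z * v z)%C).
  { intros n u Hu.
    apply (bigO_ext n (fun z => RtoC rho * (u z * / z))%C _ 1 Rlt_0_1).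
    - intros z _. unfold v. ring.
    - apply bigO_scal, bigO_div, Hu. }
  assert (Hlin : forall a b : C, bigO 1 (fun z => a * z + b * (z * z))%C).
  { intros a b. apply bigO_plus; apply bigO_scal; [apply bigO_id|].
    apply (bigO_weaken 1 2); [lia|]. apply (bigO_mult 1 1); apply bigO_id. }
  assert (Hh : bigO 1 h).
  { apply bigO_plus; [apply bigO_plus|]; apply bigO_scal; [apply Hlin| |apply Hlin].
    apply bigO_plus; [apply bigO_plus|]; apply bigO_scal.
    - apply Hv, (bigO_weaken 2 4); [lia|exact He].
    - apply Hv, Hv, (bigO_weaken 3 4); [lia|exact He].
    - apply Hv, Hv, Hv, He. }
  assert (Cz : forall a b : C, C1_off0 (fun z => a * z + b * (z * z))%C).
  { intros a b. apply C1_off0_plus; apply C1_off0_mult; try apply C1_off0_const; try apply C1_off0_id.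
    apply C1_off0_mult; apply C1_off0_id. }
  assert (Cv : C1_off0 v) by (apply C1_off0_mult; [apply C1_off0_const|apply C1_off0_inv]).
  assert (Ce : C1_off0 e).
  { apply C1_off0_plus.
    - apply C1_off0_mult; [exact w_C1|].
      apply C1_off0_plus; [apply C1_off0_plus; [apply C1_off0_const|]|];
        (apply C1_off0_mult; [apply C1_off0_const|]); [apply C1_off0_id|apply C1_off0_mult; apply C1_off0_id].
    - assert (E : C1_off0 (fun z => RtoC (-1) * (z * (d1 + (d2 * z + d3 * (z * z)))))%C).
      { apply C1_off0_mult; [apply C1_off0_const|]. apply C1_off0_mult; [apply C1_off0_id|].
        apply C1_off0_plus; [apply C1_off0_const|apply Cz]. }
      destruct E as [dE HE]. exists dE. intros z Hz. destruct (HE z Hz). split; trivial.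
      eapply (cderiv_ext_loc _ _ z _ 1 Rlt_0_1); [|eassumption].
      intros y _. simpl. ring. }
  assert (Ch : C1_off0 h).
  { apply C1_off0_plus; [apply C1_off0_plus|]; (apply C1_off0_mult; [apply C1_off0_const|]); try apply Cz.
    apply C1_off0_plus; [apply C1_off0_plus|]; (apply C1_off0_mult; [apply C1_off0_const|]);
      repeat first [assumption|apply C1_off0_mult]. }
  destruct Ch as [dh Hdh]. apply (mean_value_nonneg h dh r); [exact Hdh|exact Hr| |].
  - destruct Hh as [M [d [HM [Hd H]]]]. intros eps Heps.
    exists (Rmin d (eps / (M + 1))).
    split; [apply Rmin_pos; [exact Hd|apply Rdiv_lt_0_compat; lra]|].
    intros z [Hz0 Hz].
    eapply Rle_trans; [apply H; eapply Rlt_le_trans; [exact Hz|apply Rmin_l]|].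
    rewrite pow_1.
    assert (H1 : Cmod z < eps / (M + 1)) by (eapply Rlt_le_trans; [exact Hz|apply Rmin_r]).
    apply (Rmult_lt_compat_l (M + 1)) in H1; [|lra].
    replace ((M + 1) * (eps / (M + 1))) with eps in H1 by (field; lra). lra.
  - intros z Hz.
    assert (Hz2 : Cmod z ^ 2 = rho) by (rewrite Hz; reflexivity).
    set (Q := (q0 + q1 * z + q2 * (z * z))%C).
    set (D := (d1 + d2 * z + d3 * (z * z))%C).
    assert (HQ : Cmod (w z * Q)%C ^ 2 <= Cmod Q ^ 2).
    { apply pow_incr. split; [apply Cmod_ge_0|]. rewrite Cmod_mult.
      pose proof (w_le z ltac:(lra)). pose proof (Cmod_ge_0 Q). nra. }
    replace (w z * Q)%C with (e z + z * D)%C in HQ by (unfold e, Q, D; ring).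
    rewrite Cmod_sq_plus, Cmod_mult, Rpow_mult_distr, Hz2 in HQ.
    unfold Q, D in HQ. rewrite !(Cmod_sq_quadratic _ _ _ _ _ Hz2) in HQ.
    fold D in HQ.
    assert (Ev : Cconj (z * D)%C
      = (Cconj d1 * v z + Cconj d2 * (v z * v z) + Cconj d3 * (v z * v z * v z))%C).
    { unfold v. rewrite <- (Cconj_on_circle z rho Hz2 Hrho). unfold D.
      rewrite !Cmult_conj, !Cplus_conj, !Cmult_conj. ring. }
    rewrite Ev in HQ.
    pose proof (pow2_ge_0 (Cmod (e z))).
    set (X := ((d2 * Cconj d1 + RtoC rho * (d3 * Cconj d2)) * z + d3 * Cconj d1 * (z * z))%C) in *.
    set (Y := ((q1 * Cconj q0 + RtoC rho * (q2 * Cconj q1)) * z + q2 * Cconj q0 * (z * z))%C) in *.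
    replace (h z) with (RtoC (2 * rho) * X + RtoC 2 * (e z *
      (Cconj d1 * v z + Cconj d2 * (v z * v z) + Cconj d3 * (v z * v z * v z)))
      + RtoC (-2) * Y)%C by (unfold h; fold X Y; ring).
    assert (S : forall (a : R) (u : C), fst (RtoC a * u)%C = a * fst u)
      by (intros a u; simpl; ring).
    change (fst (RtoC (2 * rho) * X)%C + fst (RtoC 2 * (e z *
      (Cconj d1 * v z + Cconj d2 * (v z * v z) + Cconj d3 * (v z * v z * v z))))%C
      + fst (RtoC (-2) * Y)%C <=
      Cmod q0 ^ 2 + Cmod q1 ^ 2 * rho + Cmod q2 ^ 2 * rho ^ 2
      - rho * (Cmod d1 ^ 2 + Cmod d2 ^ 2 * rho + Cmod d3 ^ 2 * rho ^ 2)).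
    rewrite !S. lra.
Qed.

Lemma schur_contraction (w : C -> C) (c1 c2 c3 q0 q1 q2 : C) :
  C1_off0 w -> (forall z, Cmod z < 1 -> Cmod (w z) <= 1) ->
  bigO 4 (fun z => w z - (c1 * z + c2 * z ^ 2 + c3 * z ^ 3))%C ->
  Cmod (c1 * q0)%C ^ 2 + Cmod (c1 * q1 + c2 * q0)%C ^ 2
  + Cmod (c1 * q2 + c2 * q1 + c3 * q0)%C ^ 2
  <= Cmod q0 ^ 2 + Cmod q1 ^ 2 + Cmod q2 ^ 2.
Proof.
  intros w_C1 w_le w_exp.
  pose proof (fun r => schur_contraction_radius w c1 c2 c3 q0 q1 q2 r w_C1 w_le w_exp) as H. cbv zeta in H.
  set (A1 := Cmod (c1 * q0)%C ^ 2) in *. set (A2 := Cmod (c1 * q1 + c2 * q0)%C ^ 2) in *.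
  set (A3 := Cmod (c1 * q2 + c2 * q1 + c3 * q0)%C ^ 2) in *.
  set (B1 := Cmod q0 ^ 2) in *. set (B2 := Cmod q1 ^ 2) in *. set (B3 := Cmod q2 ^ 2) in *.
  assert (0 <= A1) by apply pow2_ge_0. assert (0 <= A2) by apply pow2_ge_0.
  assert (0 <= A3) by apply pow2_ge_0. assert (0 <= B1) by apply pow2_ge_0.
  assert (0 <= B2) by apply pow2_ge_0. assert (0 <= B3) by apply pow2_ge_0.
  apply Rnot_lt_le. intros Hlt.
  set (S := A1 + A2 + A3) in *. set (T := B1 + B2 + B3) in *.
  (* At radius r the contraction only yields r^6 S <= T. *)
  assert (HS : forall r, 0 < r < 1 -> r ^ 6 * S <= T).
  { intros r Hr. specialize (H r Hr).
    assert (Hp : 0 < r ^ 2 < 1) by (simpl; nra). set (p := r ^ 2) in *.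
    replace (r ^ 6) with (p ^ 3) by (unfold p; ring).
    assert (Hp2 : 0 < p ^ 2 < 1) by (simpl; nra).
    assert (p ^ 3 <= p) by (simpl in *; nra). assert (p ^ 3 <= p ^ 2) by (simpl in *; nra).
    unfold S, T.
    assert (p ^ 3 * A1 <= p * A1) by (apply Rmult_le_compat_r; assumption).
    assert (p ^ 3 * A2 <= p * p * A2) by (apply Rmult_le_compat_r; [assumption|simpl in *; nra]).
    assert (B2 * p <= B2) by nra. assert (B3 * p ^ 2 <= B3) by nra.
    replace (p * (A1 + A2 * p + A3 * p ^ 2)) with (p * A1 + p * p * A2 + p ^ 3 * A3) in H by ring.
    lra. }
  (* Bernoulli's inequality at r = 1 - (S - T) / (12 S). *)
  assert (HSp : 0 < S) by (unfold S, T in *; lra).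
  set (x := (S - T) / (12 * S)).
  assert (Hx : 0 < x) by (unfold x; apply Rdiv_lt_0_compat; lra).
  assert (Hx1 : x * (12 * S) = S - T) by (unfold x; field; lra).
  assert (HT : 0 <= T) by (unfold T; lra).
  assert (Hx2 : x < 1) by nra.
  specialize (HS (1 - x) ltac:(lra)).
  assert (HB : 1 - 6 * x <= (1 - x) ^ 6).
  { assert (1 - 2 * x <= (1 - x) ^ 2) by nra.
    assert (1 - 3 * x <= (1 - x) ^ 3) by (simpl in *; nra).
    replace ((1 - x) ^ 6) with ((1 - x) ^ 3 * (1 - x) ^ 3) by ring.
    destruct (Rle_lt_dec 0 (1 - 3 * x)); [nra|].
    pose proof (pow2_ge_0 ((1 - x) ^ 3)). nra. }
  nra.
Qed.

(** * Coefficient inequalities *)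

(** The hypothesis is tested at q = -s conj B: with s = 1/A when A > 0, and when A = 0 with an s
    that makes the form equal to -1 unless B = 0. *)
Lemma quadratic_nonneg_discr (A K : R) (B : C) : 0 <= A ->
  (forall q : C, 0 <= A * Cmod q ^ 2 + 2 * fst (q * B)%C + K) -> Cmod B ^ 2 <= A * K.
Proof.
  intros HA H. set (b := Cmod B ^ 2).
  assert (Hb : 0 <= b) by apply pow2_ge_0.
  assert (Hs : forall s, 0 <= A * s ^ 2 * b - 2 * s * b + K).
  { intros s. specialize (H (RtoC (- s) * Cconj B)%C).
    replace (fst (RtoC (- s) * Cconj B * B)%C) with (- s * b) in H
      by (unfold b; rewrite Cmod_sq; destruct B; simpl; ring).
    replace (Cmod (RtoC (- s) * Cconj B)%C ^ 2) with (s ^ 2 * b) in H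
      by (unfold b; rewrite !Cmod_sq; destruct B; simpl; ring).
    lra. }
  destruct (Rle_lt_or_eq_dec 0 A HA) as [HA1|HA0].
  - specialize (Hs (/ A)).
    replace (A * (/ A) ^ 2 * b - 2 * / A * b + K) with (K - b / A) in Hs by (field; lra).
    apply (Rmult_le_compat_l A) in Hs; [|lra].
    replace (A * (K - b / A)) with (A * K - b) in Hs by (field; lra). lra.
  - subst A. destruct (Rle_lt_or_eq_dec 0 b Hb) as [Hb1|Hb0]; [|lra].
    specialize (Hs ((K + 1) / (2 * b))).
    replace (0 * ((K + 1) / (2 * b)) ^ 2 * b - 2 * ((K + 1) / (2 * b)) * b + K)
      with (-1) in Hs by (field; lra). lra.
Qed.

Definition toeplitz_contraction (c1 c2 c3 : C) : Prop := forall q0 q1 q2 : C,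
  Cmod (c1 * q0)%C ^ 2 + Cmod (c1 * q1 + c2 * q0)%C ^ 2
  + Cmod (c1 * q2 + c2 * q1 + c3 * q0)%C ^ 2
  <= Cmod q0 ^ 2 + Cmod q1 ^ 2 + Cmod q2 ^ 2.

Lemma contraction_norm c1 c2 c3 : toeplitz_contraction c1 c2 c3 ->
  Cmod c1 ^ 2 + Cmod c2 ^ 2 + Cmod c3 ^ 2 <= 1.
Proof.
  intros H. specialize (H (RtoC 1) (RtoC 0) (RtoC 0)).
  rewrite !Cmult_0_r, !Cmult_1_r, !Cplus_0_l, Cmod_0, Cmod_1 in H. lra.
Qed.

(** The vectors (1, t, 0), with the third output coordinate discarded, give a nonnegative quadratic
    in t; its discriminant condition rearranges to |c2|^2 <= (1 - |c1|^2)^2. *)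
Lemma contraction_c2 c1 c2 c3 : toeplitz_contraction c1 c2 c3 ->
  Cmod c2 <= 1 - Cmod c1 ^ 2.
Proof.
  intros H. pose proof (contraction_norm _ _ _ H) as H1.
  pose proof (pow2_ge_0 (Cmod c2)). pose proof (pow2_ge_0 (Cmod c3)).
  assert (D : Cmod (- (c1 * Cconj c2))%C ^ 2
      <= (1 - Cmod c1 ^ 2) * (1 - Cmod c1 ^ 2 - Cmod c2 ^ 2)).
  { apply quadratic_nonneg_discr; [lra|]. intros t.
    specialize (H (RtoC 1) t (RtoC 0)).
    rewrite Cmult_0_r, !Cmult_1_r, Cplus_0_l, Cmod_0, Cmod_1 in H.
    pose proof (pow2_ge_0 (Cmod (c2 * t + c3)%C)) as H9.
    revert H H9. generalize (Cmod (c2 * t + c3)%C ^ 2). rewrite !Cmod_sq.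
    destruct c1, c2, t; simpl. intros. lra. }
  rewrite Cmod_opp, Cmod_mult, Cmod_conj, Rpow_mult_distr in D.
  apply Rsqr_incr_0_var; [|lra]. unfold Rsqr. nra.
Qed.

(** The vectors (1, q, q2) with q2 optimal leave a nonnegative quadratic in q with leading
    coefficient al^2 - |c2|^2. By the identity [E], the gap in its discriminant inequality [D] is
    exactly the gap in the square of the claim. *)
Lemma contraction_c3 c1 c2 c3 : toeplitz_contraction c1 c2 c3 ->
  Cmod (RtoC (1 - Cmod c1 ^ 2) * c3 + Cconj c1 * (c2 * c2))%C
    <= (1 - Cmod c1 ^ 2) ^ 2 - Cmod c2 ^ 2.
Proof.
  intros H. pose proof (contraction_norm _ _ _ H) as H1.
  pose proof (contraction_c2 _ _ _ H) as H2.
  pose proof (pow2_ge_0 (Cmod c2)). pose proof (pow2_ge_0 (Cmod c3)).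
  pose proof (Cmod_ge_0 c2) as Hy.
  set (al := 1 - Cmod c1 ^ 2) in *.
  assert (Hal : 0 <= al) by (unfold al; lra).
  destruct (Rle_lt_or_eq_dec 0 al Hal) as [Ha|Ha].
  2: { assert (E : c2 = RtoC 0) by (apply Cmod_eq_0; lra).
       subst c2. rewrite <- Ha, !Cmult_0_r, Cmult_0_l, Cplus_0_l, Cmod_0. simpl. lra. }
  assert (HA : 0 <= al ^ 2 - Cmod c2 ^ 2) by nra.
  assert (D : Cmod (- (RtoC al * (c1 * Cconj c2) + c2 * Cconj c3))%C ^ 2
      <= (al ^ 2 - Cmod c2 ^ 2) * (al ^ 2 - al * Cmod c2 ^ 2 - Cmod c3 ^ 2)).
  { apply quadratic_nonneg_discr; [exact HA|]. intros q.
    set (m := (c2 * q + c3)%C).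
    (* The last coordinate q2 minimises |q2|^2 - |c1 q2 + m|^2. *)
    specialize (H (RtoC 1) q (RtoC (/ al) * (Cconj c1 * m))%C).
    rewrite !Cmult_1_r, Cmod_1 in H.
    replace (c1 * (RtoC (/ al) * (Cconj c1 * m)) + c2 * q + c3)%C
      with (RtoC (/ al) * m)%C in H.
    2: { transitivity (RtoC (/ al) * (c1 * Cconj c1) * m + m)%C; [|unfold m; ring].
         rewrite <- Cmod2_conj.
         replace (RtoC (Cmod c1 ^ 2)) with (1 - RtoC al)%C
           by (unfold al; rewrite <- RtoC_minus; f_equal; lra).
         rewrite RtoC_inv by lra. field. intros E. apply RtoC_inj in E. lra. }
    rewrite !Cmod_mult, Cmod_R, Cmod_conj, Rabs_pos_eq in H
      by (apply Rlt_le, Rinv_0_lt_compat, Ha).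
    apply (Rmult_le_compat_l al) in H; [|lra].
    assert (E1 : al * (Cmod c1 ^ 2 + Cmod (c1 * q + c2)%C ^ 2 + (/ al * Cmod m) ^ 2)
      = al * (1 - al) + al * Cmod (c1 * q + c2)%C ^ 2 + Cmod m ^ 2 / al)
      by (replace (Cmod c1 ^ 2) with (1 - al) by (unfold al; ring); field; lra).
    assert (E2 : al * (1 ^ 2 + Cmod q ^ 2 + (/ al * (Cmod c1 * Cmod m)) ^ 2)
      = al + al * Cmod q ^ 2 + (Cmod m ^ 2 / al - Cmod m ^ 2)).
    { transitivity (al + al * Cmod q ^ 2 + Cmod c1 ^ 2 * Cmod m ^ 2 / al); [field; lra|].
      replace (Cmod c1 ^ 2) with (1 - al) by (unfold al; ring). field; lra. }
    rewrite E1, E2 in H.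
    assert (H9 : 0 <= al ^ 2 + al * Cmod q ^ 2 - al * Cmod (c1 * q + c2)%C ^ 2 - Cmod m ^ 2)
      by lra.
    eapply Rle_trans; [exact H9|]. apply Req_le.
    assert (Ec : Cmod c1 ^ 2 = 1 - al) by (unfold al; ring).
    unfold m. rewrite Cmod_sq in Ec. rewrite !Cmod_sq.
    destruct c1 as [p1 p2], c2 as [s1 s2], c3, q as [t1 t2]; simpl in *.
    replace al with (1 - (p1 * (p1 * 1) + p2 * (p2 * 1))) by lra. ring. }
  apply Rsqr_incr_0_var; [|exact HA]. rewrite !Rsqr_pow2.
  assert (E : (al ^ 2 - Cmod c2 ^ 2) ^ 2
      - Cmod (RtoC al * c3 + Cconj c1 * (c2 * c2))%C ^ 2
    = (al ^ 2 - Cmod c2 ^ 2) * (al ^ 2 - al * Cmod c2 ^ 2 - Cmod c3 ^ 2)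
      - Cmod (- (RtoC al * (c1 * Cconj c2) + c2 * Cconj c3))%C ^ 2).
  { unfold al. rewrite !Cmod_sq. destruct c1, c2, c3; simpl. ring. }
  lra.
Qed.

(** From |c2| <= 1 - |c1|^2 the left side is at most (1 - |c1|^2) * 1 + |c1|^2 |v|, a convex
    combination of 1 and |v|. *)
Lemma contraction_fekete_szego c1 c2 c3 (v : C) : toeplitz_contraction c1 c2 c3 ->
  Cmod (c2 - v * c1 * c1)%C <= Rmax 1 (Cmod v).
Proof.
  intros H. pose proof (contraction_norm _ _ _ H). pose proof (contraction_c2 _ _ _ H).
  pose proof (pow2_ge_0 (Cmod c2)). pose proof (pow2_ge_0 (Cmod c3)).
  eapply Rle_trans; [apply Cmod_triangle_sub|]. rewrite !Cmod_mult.
  pose proof (Cmod_ge_0 v). pose proof (pow2_ge_0 (Cmod c1)).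
  pose proof (Rmax_l 1 (Cmod v)). pose proof (Rmax_r 1 (Cmod v)).
  set (M := Rmax 1 (Cmod v)) in *. nra.
Qed.

(** After multiplication by al = 1 - |c1|^2 the coefficient c3 can be traded for [N], whose modulus
    is at most al^2 - |c2|^2. When al = 0, both c2 and c3 vanish and the left side is 1/6. *)
Lemma contraction_cubic c1 c2 c3 : toeplitz_contraction c1 c2 c3 ->
  Cmod (c3 - RtoC (/ 3) * (c1 * c2) - RtoC (/ 6) * (c1 * c1 * c1))%C <= 1.
Proof.
  intros H. pose proof (contraction_norm _ _ _ H) as H1.
  pose proof (contraction_c2 _ _ _ H) as H2. pose proof (contraction_c3 _ _ _ H) as H3.
  pose proof (pow2_ge_0 (Cmod c2)). pose proof (pow2_ge_0 (Cmod c3)) as H5.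
  pose proof (Cmod_ge_0 c2). pose proof (Cmod_ge_0 c1). pose proof (Cmod_ge_0 c3).
  set (al := 1 - Cmod c1 ^ 2) in *.
  set (N := (RtoC al * c3 + Cconj c1 * (c2 * c2))%C) in *.
  assert (Hx : Cmod c1 <= 1) by nra.
  assert (Hal : 0 <= al) by (unfold al; lra).
  destruct (Rle_lt_or_eq_dec 0 al Hal) as [Ha|Ha].
  - apply (Rmult_le_reg_l al); [exact Ha|]. rewrite Rmult_1_r.
    rewrite <- (Rabs_pos_eq al) at 1 by lra. rewrite <- Cmod_R, <- Cmod_mult.
    replace (RtoC al * (c3 - RtoC (/ 3) * (c1 * c2) - RtoC (/ 6) * (c1 * c1 * c1)))%C
      with (N - Cconj c1 * (c2 * c2) - RtoC (al / 3) * (c1 * c2)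
            - RtoC (al / 6) * (c1 * c1 * c1))%C.
    2: { unfold N, Rdiv. rewrite !RtoC_mult. ring. }
    eapply Rle_trans; [apply Cmod_triangle_sub|].
    eapply Rle_trans; [apply Rplus_le_compat_r, Cmod_triangle_sub|].
    eapply Rle_trans; [apply Rplus_le_compat_r, Rplus_le_compat_r, Cmod_triangle_sub|].
    rewrite !Cmod_mult, !Cmod_R, Cmod_conj, !Rabs_pos_eq by lra.
    set (x := Cmod c1) in *. set (y := Cmod c2) in *.
    (* The triangle inequality leaves al^2 - y^2 + x y^2 + al x y/3 + al x^3/6. Its distance to al
       is a quadratic in y; completing the square turns it into the right side of [K6] plus that of
       [K7]. *)
    assert (K6 : 0 <= (1 - x) * (y - (1 + x) * x / 6) ^ 2)
      by (apply Rmult_le_pos; [lra|apply pow2_ge_0]).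
    assert (K7 : 0 <= al * (x ^ 2 * (1 - (1 + x) / 36 - x / 6)))
      by (apply Rmult_le_pos; [lra|apply Rmult_le_pos; [apply pow2_ge_0|lra]]).
    unfold al in *. nra.
  - assert (E2 : c2 = RtoC 0) by (apply Cmod_eq_0; lra).
    assert (E3 : c3 = RtoC 0) by (apply Cmod_eq_0; unfold al in *; nra).
    subst c2 c3.
    replace (0 - RtoC (/ 3) * (c1 * 0) - RtoC (/ 6) * (c1 * c1 * c1))%C
      with (RtoC (- / 6) * (c1 * c1 * c1))%C by (rewrite RtoC_opp; ring).
    rewrite !Cmod_mult, Cmod_R, Rabs_Ropp, Rabs_pos_eq by lra.
    assert (0 <= Cmod c1 * Cmod c1 <= 1) by nra. nra.
Qed.

Lemma contraction_hankel c1 c2 c3 : toeplitz_contraction c1 c2 c3 ->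
  Cmod (RtoC (/ 12) * (c1 * c3) - RtoC (/ 144) * (c1 * c1 * c2) - RtoC (/ 16) * (c2 * c2))%C
    <= / 16.
Proof.
  intros H. pose proof (contraction_norm _ _ _ H) as H1.
  pose proof (contraction_c2 _ _ _ H) as H2. pose proof (contraction_c3 _ _ _ H) as H3.
  pose proof (pow2_ge_0 (Cmod c2)). pose proof (pow2_ge_0 (Cmod c3)) as H5.
  pose proof (Cmod_ge_0 c2). pose proof (Cmod_ge_0 c1). pose proof (Cmod_ge_0 c3).
  set (al := 1 - Cmod c1 ^ 2) in *.
  set (N := (RtoC al * c3 + Cconj c1 * (c2 * c2))%C) in *.
  assert (Hx : Cmod c1 <= 1) by nra.
  assert (Hal : 0 <= al) by (unfold al; lra).
  destruct (Rle_lt_or_eq_dec 0 al Hal) as [Ha|Ha].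
  - apply (Rmult_le_reg_l al); [exact Ha|].
    rewrite <- (Rabs_pos_eq al) at 1 by lra. rewrite <- Cmod_R, <- Cmod_mult.
    replace (RtoC al * (RtoC (/ 12) * (c1 * c3) - RtoC (/ 144) * (c1 * c1 * c2)
                - RtoC (/ 16) * (c2 * c2)))%C
      with (RtoC (/ 12) * (c1 * N) - RtoC (Cmod c1 ^ 2 / 12) * (c2 * c2)
            - RtoC (al / 144) * (c1 * c1 * c2) - RtoC (al / 16) * (c2 * c2))%C.
    2: { unfold N, Rdiv. rewrite !RtoC_mult, Cmod2_conj. ring. }
    eapply Rle_trans; [apply Cmod_triangle_sub|].
    eapply Rle_trans; [apply Rplus_le_compat_r, Cmod_triangle_sub|].
    eapply Rle_trans; [apply Rplus_le_compat_r, Rplus_le_compat_r, Cmod_triangle_sub|].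
    pose proof (pow2_ge_0 (Cmod c1)).
    rewrite !Cmod_mult, !Cmod_R, !Rabs_pos_eq by lra.
    assert (HN : Cmod c1 * Cmod N <= Cmod c1 * (al ^ 2 - Cmod c2 ^ 2))
      by (apply Rmult_le_compat_l; assumption).
    set (x := Cmod c1) in *. set (y := Cmod c2) in *.
    (* The bound times 144 is 12 x al^2 + 3 (1 - x)(3 - x) y^2 + al x^2 y. It increases with y, so y
       may be replaced by its maximum al; what is then missing to 9 al is the quantity in [K8]. *)
    assert (Hy2 : y ^ 2 <= al ^ 2) by (apply pow_incr; lra).
    assert (K6 : (1 - x) * (3 - x) * y ^ 2 <= (1 - x) * (3 - x) * al ^ 2)
      by (apply Rmult_le_compat_l; [nra|exact Hy2]).
    assert (K7 : al * x ^ 2 * y <= al * x ^ 2 * al)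
      by (apply Rmult_le_compat_l; [nra|exact H2]).
    assert (K8 : 0 <= al * (x ^ 2 * (5 + 4 * x ^ 2)))
      by (apply Rmult_le_pos; [lra|nra]).
    assert (E : (1 - x) * (3 - x) * y ^ 2 = (4 * x ^ 2 - 4 * x + 3 * al) * y ^ 2)
      by (unfold al; ring).
    assert (E' : (1 - x) * (3 - x) * al ^ 2 = (4 * x ^ 2 - 4 * x + 3 * al) * al ^ 2)
      by (unfold al; ring).
    assert (E8 : al * (x ^ 2 * (5 + 4 * x ^ 2)) =
       9 * al - 12 * x ^ 2 * al ^ 2 - al ^ 2 * x ^ 2 - 9 * al ^ 3) by (unfold al; ring).
    nra.
  - assert (E2 : c2 = RtoC 0) by (apply Cmod_eq_0; lra).
    assert (E3 : c3 = RtoC 0) by (apply Cmod_eq_0; unfold al in *; nra).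
    subst c2 c3. rewrite !Cmult_0_r.
    replace (0 - 0 - 0)%C with (RtoC 0) by ring. rewrite Cmod_0. lra.
Qed.

(** * Complex power series *)

Notation Cis_series := (is_series (K := C_AbsRing) (V := C_NormedModule)).
Notation Csum := (sum_n (G := C_AbelianMonoid)).

Lemma fst_Csum (u : nat -> C) n : fst (Csum u n) = sum_n (fun k => fst (u k)) n.
Proof.
  induction n as [|n IH]; [rewrite !sum_O; reflexivity|].
  rewrite !sum_Sn, <- IH. reflexivity.
Qed.

Lemma snd_Csum (u : nat -> C) n : snd (Csum u n) = sum_n (fun k => snd (u k)) n.
Proof.
  induction n as [|n IH]; [rewrite !sum_O; reflexivity|].
  rewrite !sum_Sn, <- IH. reflexivity.
Qed.

Lemma Cis_series_components (u : nat -> C) (l : C) :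
  Cis_series u l <->
  is_series (fun n => fst (u n)) (fst l) /\ is_series (fun n => snd (u n)) (snd l).
Proof.
  split.
  - intros H. pose proof (proj1 (filterlim_locally _ _) H) as H'.
    split; apply filterlim_locally; intros eps; destruct (H' eps) as [N HN];
      exists N; intros n Hn; destruct (HN n Hn) as [B1 B2].
    + exact (eq_ind _ (ball (M := R_UniformSpace) (fst l) eps) B1 _ (fst_Csum u n)).
    + exact (eq_ind _ (ball (M := R_UniformSpace) (snd l) eps) B2 _ (snd_Csum u n)).
  - intros [H1 H2]. apply filterlim_locally. intros eps.
    destruct (proj1 (filterlim_locally _ _) H1 eps) as [N1 HN1].
    destruct (proj1 (filterlim_locally _ _) H2 eps) as [N2 HN2].
    exists (Nat.max N1 N2). intros n Hn.
    specialize (HN1 n ltac:(lia)). specialize (HN2 n ltac:(lia)).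
    split.
    + exact (eq_ind_r (ball (M := R_UniformSpace) (fst l) eps) HN1 (fst_Csum u n)).
    + exact (eq_ind_r (ball (M := R_UniformSpace) (snd l) eps) HN2 (snd_Csum u n)).
Qed.

Lemma Cis_series_unique (u : nat -> C) (l m : C) : Cis_series u l -> Cis_series u m -> l = m.
Proof.
  rewrite !Cis_series_components. intros [H1 H2] [H3 H4].
  apply is_series_unique in H1, H2, H3, H4.
  rewrite (surjective_pairing l), (surjective_pairing m). congruence.
Qed.

Lemma Cis_series_norm_le (u : nat -> C) (l : C) (b : nat -> R) (s : R) :
  Cis_series u l -> (forall n, Cmod (u n) <= b n) -> is_series b s -> Cmod l <= s.
Proof.
  intros Hu Hb Hs.
  apply (is_lim_seq_le (fun n => Cmod (Csum u n)) (sum_n b) (Cmod l) s).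
  - intros n. induction n as [|n IH]; [rewrite !sum_O; apply Hb|].
    rewrite !sum_Sn. eapply Rle_trans; [apply Cmod_triangle|].
    apply Rplus_le_compat; [exact IH|apply Hb].
  - apply (filterlim_comp _ _ _ _ _ _ _ _ Hu).
    apply (filterlim_norm (V := C_NormedModule)).
  - exact Hs.
Qed.

Definition Cseries (u : nat -> C) : C :=
  (Series (fun n => fst (u n)), Series (fun n => snd (u n))).

Lemma Cseries_correct (u : nat -> C) : ex_series (fun n => Cmod (u n)) ->
  Cis_series u (Cseries u).
Proof.
  intros H. apply Cis_series_components. split; apply Series_correct;
    apply (ex_series_le (V := R_CompleteNormedModule) _ (fun n => Cmod (u n))); trivial;
    intros n; [apply abs_fst_le|apply abs_snd_le].
Qed.

(** Stated through the moduli, so that the real results on [CV_radius] (shift, derivative) carry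
    over to complex coefficients. *)
Definition radius_ge_1 (a : nat -> C) : Prop :=
  forall x, 0 <= x < 1 -> Rbar_lt x (CV_radius (fun n => Cmod (a n))).

Lemma radius_ge_1_of_bounds (a : nat -> C) :
  (forall r, 0 < r < 1 -> exists M, forall n, Cmod (a n) * r ^ n <= M) -> radius_ge_1 a.
Proof.
  intros H x Hx.
  destruct (CV_radius_bounded (fun n => Cmod (a n))) as [Hub _].
  apply Rbar_lt_le_trans with (Finite ((x + 1) / 2)); [simpl; lra|].
  apply Hub. destruct (H ((x + 1) / 2)) as [M HM]; [lra|].
  exists M. intros n. rewrite Rabs_pos_eq; [apply HM|].
  apply Rmult_le_pos; [apply Cmod_ge_0|apply pow_le; lra].
Qed.

Lemma radius_ge_1_of_bounded (a : nat -> C) M : (forall n, Cmod (a n) <= M) -> radius_ge_1 a.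
Proof.
  intros H. apply radius_ge_1_of_bounds. intros r Hr. exists M. intros n.
  eapply Rle_trans; [|apply (H n)]. rewrite <- (Rmult_1_r (Cmod (a n))) at 2.
  apply Rmult_le_compat_l; [apply Cmod_ge_0|]. rewrite <- (pow1 n). apply pow_incr. lra.
Qed.

Lemma radius_ge_1_abs (a : nat -> C) z : radius_ge_1 a -> Cmod z < 1 ->
  ex_series (fun n => Cmod (a n * z ^ n)%C).
Proof.
  intros H Hz. pose proof (Cmod_ge_0 z).
  apply (ex_series_ext (fun n => Rabs (Cmod (a n) * Cmod z ^ n))).
  - intros n. rewrite Cmod_mult, Cmod_pow. apply Rabs_pos_eq.
    apply Rmult_le_pos; [apply Cmod_ge_0|apply pow_le; assumption].
  - apply (CV_disk_inside (fun n => Cmod (a n))). rewrite Rabs_pos_eq by assumption.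
    apply H. lra.
Qed.

(** Convergence at the real point r bounds the terms there, and bounded terms at every r < 1 are
    enough. *)
Lemma radius_ge_1_of_taylor f a : taylor_coeffs f a -> radius_ge_1 a.
Proof.
  intros H. apply radius_ge_1_of_bounds. intros r Hr.
  assert (Hd : in_disk (RtoC r)) by (unfold in_disk; rewrite Cmod_R, Rabs_pos_eq; lra).
  specialize (H _ Hd). apply Cis_series_components in H. destruct H as [H1 H2].
  assert (B : forall u : nat -> R, ex_series u -> exists M, forall n, Rabs (u n) <= M).
  { intros u Hu. apply ex_series_lim_0 in Hu.
    destruct (filterlim_bounded u) as [M HM]; [exists 0; exact Hu|].
    exists M. exact HM. }
  destruct (B _ (ex_intro _ _ H1)) as [M1 HM1].
  destruct (B _ (ex_intro _ _ H2)) as [M2 HM2].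
  exists (M1 + M2). intros n.
  replace (Cmod (a n) * r ^ n) with (Cmod (a n * RtoC r ^ n)%C).
  - eapply Rle_trans; [apply Cmod_le_abs|]. apply Rplus_le_compat; trivial.
  - rewrite Cmod_mult, Cmod_pow, Cmod_R, Rabs_pos_eq; lra.
Qed.

Definition power_series (a : nat -> C) (z : C) : C := Cseries (fun n => a n * z ^ n)%C.

Lemma power_series_taylor a : radius_ge_1 a -> taylor_coeffs (power_series a) a.
Proof. intros H z Hz. apply Cseries_correct, radius_ge_1_abs; assumption. Qed.

Lemma taylor_unique f g a z : taylor_coeffs f a -> taylor_coeffs g a -> in_disk z -> f z = g z.
Proof. intros Hf Hg Hz. exact (Cis_series_unique _ _ _ (Hf z Hz) (Hg z Hz)). Qed.

Lemma taylor_ext f g a b : (forall z, in_disk z -> f z = g z) -> (forall n, a n = b n) ->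
  taylor_coeffs f a -> taylor_coeffs g b.
Proof.
  intros E1 E2 H z Hz. rewrite <- E1 by exact Hz.
  apply (is_series_ext (fun n => a n * z ^ n)%C); [|apply H, Hz].
  intros n. rewrite E2. reflexivity.
Qed.

Lemma radius_ge_1_shift a : radius_ge_1 a -> radius_ge_1 (fun n => a (S n)).
Proof.
  intros H x Hx.
  change (Rbar_lt x (CV_radius (PS_decr_1 (fun n => Cmod (a n))))).
  rewrite CV_radius_decr_1. apply H, Hx.
Qed.

Definition deriv_coeffs (a : nat -> C) (n : nat) : C := (RtoC (INR (S n)) * a (S n))%C.

Lemma Cmod_deriv_coeffs a n :
  Cmod (deriv_coeffs a n) = PS_derive (fun k => Cmod (a k)) n.
Proof.
  unfold deriv_coeffs, PS_derive. rewrite Cmod_mult, Cmod_R, Rabs_pos_eq; [reflexivity|].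
  apply pos_INR.
Qed.

Lemma radius_ge_1_deriv a : radius_ge_1 a -> radius_ge_1 (deriv_coeffs a).
Proof.
  intros H x Hx. rewrite (CV_radius_ext _ _ (Cmod_deriv_coeffs a)), CV_radius_derive.
  apply H, Hx.
Qed.

Lemma Cis_series_tail (u : nat -> C) (l : C) : Cis_series u l ->
  Cis_series (fun n => u (S n)) (l - u 0%nat)%C.
Proof.
  intros H. apply is_series_incr_1.
  refine (eq_ind _ (Cis_series u) H _ _).
  change (l = l - u 0%nat + u 0%nat)%C. ring.
Qed.

Lemma Cis_series_cons (u : nat -> C) (l : C) : Cis_series (fun n => u (S n)) l ->
  Cis_series u (u 0%nat + l)%C.
Proof.
  intros H. apply is_series_decr_1.
  refine (eq_ind _ (Cis_series (fun n => u (S n))) H _ _).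
  change (l = u 0%nat + l + - u 0%nat)%C. ring.
Qed.

Lemma Cis_series_scal c (u : nat -> C) (l : C) : Cis_series u l ->
  Cis_series (fun n => c * u n)%C (c * l)%C.
Proof. intros H. exact (is_series_scal (K := C_AbsRing) (V := C_NormedModule) c u l H). Qed.

Lemma Cis_series_plus (u v : nat -> C) (l m : C) : Cis_series u l -> Cis_series v m ->
  Cis_series (fun n => u n + v n)%C (l + m)%C.
Proof. intros H1 H2. exact (is_series_plus _ _ _ _ H1 H2). Qed.

(** Powers of z are split off one at a time; four iterations yield the expansion with remainder
    O(z^4). *)
Lemma taylor_shift f a : taylor_coeffs f a ->
  taylor_coeffs (power_series (fun n => a (S n))) (fun n => a (S n)) /\
  forall z, in_disk z -> f z = (a 0%nat + z * power_series (fun n => a (S n)) z)%C.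
Proof.
  intros H.
  assert (Hs := power_series_taylor _ (radius_ge_1_shift _ (radius_ge_1_of_taylor _ _ H))).
  split; [exact Hs|]. intros z Hz.
  apply (Cis_series_unique _ _ _ (H z Hz)).
  replace (a 0%nat + z * power_series (fun n => a (S n)) z)%C
    with (a 0%nat * z ^ 0 + z * power_series (fun n => a (S n)) z)%C
    by (simpl; ring).
  apply (Cis_series_cons (fun n => a n * z ^ n)%C).
  apply (is_series_ext (fun n => z * (a (S n) * z ^ n))%C).
  - intros n. simpl. ring.
  - apply Cis_series_scal, Hs, Hz.
Qed.

Lemma taylor_unshift g a : taylor_coeffs g (fun n => a (S n)) ->
  taylor_coeffs (fun z => a 0%nat + z * g z)%C a.
Proof.
  intros Hs z Hz.
  replace (a 0%nat + z * g z)%C with (a 0%nat * z ^ 0 + z * g z)%C by (simpl; ring).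
  apply (Cis_series_cons (fun n => a n * z ^ n)%C).
  apply (is_series_ext (fun n => z * (a (S n) * z ^ n))%C).
  - intros n. simpl. ring.
  - apply Cis_series_scal, Hs, Hz.
Qed.

(** The remainders satisfy E' = (z + h) E + h^2 (m + 2) z^(m+1) when m grows by one. The constant is
    the coefficient of the second derivative, so that the bounds can be summed against the
    coefficients of a power series. *)
Lemma pow_second_order (z h : C) (r : R) m : Cmod z <= r -> Cmod (z + h)%C <= r ->
  Cmod ((z + h) ^ S (S m) - z ^ S (S m) - h * (RtoC (INR (S (S m))) * z ^ S m))%C
  <= Cmod h ^ 2 * (INR (S m) * INR (S (S m)) * r ^ m).
Proof.
  intros Hz Hzh. pose proof (Cmod_ge_0 z) as Hz0. pose proof (Cmod_ge_0 h) as Hh0.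
  assert (Hr : 0 <= r) by lra.
  induction m as [|m IH].
  - replace ((z + h) ^ 2 - z ^ 2 - h * (RtoC (INR 2) * z ^ 1))%C with (h ^ 2)%C.
    + rewrite Cmod_pow. simpl. pose proof (pow2_ge_0 (Cmod h)). simpl in *. nra.
    + simpl (INR 2). rewrite RtoC_plus. simpl. ring.
  - replace ((z + h) ^ S (S (S m)) - z ^ S (S (S m)) - h * (RtoC (INR (S (S (S m)))) * z ^ S (S m)))%C
      with ((z + h) * ((z + h) ^ S (S m) - z ^ S (S m) - h * (RtoC (INR (S (S m))) * z ^ S m))
            + h ^ 2 * (RtoC (INR (S (S m))) * z ^ S m))%C.
    2: { rewrite (S_INR (S (S m))), RtoC_plus. simpl. ring. }
    eapply Rle_trans; [apply Cmod_triangle|]. rewrite !Cmod_mult, !Cmod_pow, Cmod_R.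
    rewrite (Rabs_pos_eq (INR _)) by apply pos_INR.
    set (E := Cmod _) in IH |- *.
    set (n := INR (S m)) in *.
    assert (En : INR (S (S m)) = n + 1) by (unfold n; rewrite <- S_INR; reflexivity).
    assert (En2 : INR (S (S (S m))) = n + 2) by (rewrite S_INR, En; ring).
    rewrite En2. rewrite En in *.
    assert (Hn : 0 <= n) by apply pos_INR.
    assert (Hp : Cmod z ^ S m <= r ^ S m) by (apply pow_incr; lra).
    assert (Hrm : 0 <= r ^ m) by (apply pow_le, Hr).
    assert (Hh2 : 0 <= Cmod h ^ 2) by apply pow2_ge_0.
    assert (H1 : Cmod (z + h)%C * E <= r * (Cmod h ^ 2 * (n * (n + 1) * r ^ m))).
    { apply Rmult_le_compat; try assumption; apply Cmod_ge_0. }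
    assert (H2 : Cmod h ^ 2 * ((n + 1) * Cmod z ^ S m) <= Cmod h ^ 2 * ((n + 1) * (r * r ^ m))).
    { apply Rmult_le_compat_l; [exact Hh2|]. apply Rmult_le_compat_l; [lra|exact Hp]. }
    assert (H3 : 0 <= Cmod h ^ 2 * ((n + 1) * (r * r ^ m))).
    { apply Rmult_le_pos; [exact Hh2|]. apply Rmult_le_pos; [lra|].
      apply Rmult_le_pos; assumption. }
    change (r ^ S m) with (r * r ^ m). nra.
Qed.

Lemma power_series_cderiv f g a z : taylor_coeffs f a -> taylor_coeffs g (deriv_coeffs a) ->
  in_disk z -> cderiv f z (g z).
Proof.
  intros Hf Hg Hz. unfold in_disk in Hz. pose proof (Cmod_ge_0 z) as Hz0.
  set (r := (1 + Cmod z) / 2).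
  assert (Hr : Cmod z < r < 1) by (unfold r; lra).
  assert (Hb : ex_series (fun m => INR (S m) * INR (S (S m)) * Cmod (a (S (S m))) * r ^ m)).
  { pose proof (radius_ge_1_abs _ (RtoC r) (radius_ge_1_deriv _ (radius_ge_1_deriv _
      (radius_ge_1_of_taylor _ _ Hf)))) as H.
    rewrite Cmod_R, Rabs_pos_eq in H by lra. specialize (H ltac:(lra)).
    eapply ex_series_ext; [|exact H]. intros n. cbv beta.
    unfold deriv_coeffs. rewrite !Cmod_mult, Cmod_pow, !Cmod_R, !(Rabs_pos_eq (INR _)) by apply pos_INR.
    rewrite Rabs_pos_eq by lra. match goal with |- ?x = ?y => change (@eq R x y) end. ring. }
  destruct Hb as [K HK].
  assert (Key : forall h, Cmod h < r - Cmod z ->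
    Cmod (f (z + h) - f z - h * g z)%C <= Cmod h ^ 2 * K).
  { intros h Hh.
    assert (Hzh : Cmod (z + h)%C <= r)
      by (eapply Rle_trans; [apply Cmod_triangle|lra]).
    (* The derivative series is delayed by one index: [T n] becomes a_n times the second-order
       remainder of the n-th power, and [T 0] and [T 1] vanish. *)
    set (T := fun n => (a n * (z + h) ^ n + (-1) * (a n * z ^ n)
       + (- h) * match n with O => RtoC 0 | S k => deriv_coeffs a k * z ^ k end)%C).
    assert (HT : Cis_series T (f (z + h) + (-1) * f z + (- h) * (RtoC 0 + g z))%C).
    { apply Cis_series_plus; [apply Cis_series_plus|].
      - apply Hf. unfold in_disk. lra.
      - apply Cis_series_scal, Hf, Hz.
      - apply Cis_series_scal.
        apply (Cis_series_cons (fun n => match n with O => RtoC 0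
           | S k => deriv_coeffs a k * z ^ k end)%C).
        apply Hg, Hz. }
    apply Cis_series_tail, Cis_series_tail in HT.
    replace (f (z + h) - f z - h * g z)%C with
      (f (z + h) + (-1) * f z + - h * (RtoC 0 + g z) - T 0%nat - T 1%nat)%C.
    2: { unfold T, deriv_coeffs. simpl. ring. }
    apply (Cis_series_norm_le _ _ (fun m =>
      Cmod h ^ 2 * (INR (S m) * INR (S (S m)) * Cmod (a (S (S m))) * r ^ m)) _ HT).
    - intros m. unfold T.
      replace (a (S (S m)) * (z + h) ^ S (S m) + -1 * (a (S (S m)) * z ^ S (S m))
        + - h * (deriv_coeffs a (S m) * z ^ S m))%C
        with (a (S (S m)) * ((z + h) ^ S (S m) - z ^ S (S m)
           - h * (RtoC (INR (S (S m))) * z ^ S m)))%C by (unfold deriv_coeffs; ring).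
      rewrite Cmod_mult.
      replace (Cmod h ^ 2 * (INR (S m) * INR (S (S m)) * Cmod (a (S (S m))) * r ^ m))
        with (Cmod (a (S (S m))) * (Cmod h ^ 2 * (INR (S m) * INR (S (S m)) * r ^ m))) by ring.
      apply Rmult_le_compat_l; [apply Cmod_ge_0|]. apply pow_second_order; lra.
    - exact (is_series_scal (V := R_NormedModule) (Cmod h ^ 2) _ _ HK). }
  assert (HK0 : 0 <= K).
  { pose proof (Key (RtoC ((r - Cmod z) / 2))) as H.
    rewrite Cmod_R, Rabs_pos_eq in H by lra. specialize (H ltac:(lra)).
    set (u := Cmod _) in H. assert (0 <= u) by apply Cmod_ge_0.
    assert (0 < ((r - Cmod z) / 2) ^ 2) by (apply pow_lt; lra). nra. }
  intros eps He. exists (Rmin (r - Cmod z) (eps / (K + 1))).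
  split; [apply Rmin_pos; [lra|apply Rdiv_lt_0_compat; lra]|].
  intros y Hy.
  assert (H1 : Cmod (y - z)%C < r - Cmod z) by (eapply Rlt_le_trans; [exact Hy|apply Rmin_l]).
  assert (H2 : Cmod (y - z)%C < eps / (K + 1)) by (eapply Rlt_le_trans; [exact Hy|apply Rmin_r]).
  specialize (Key _ H1). replace (z + (y - z))%C with y in Key by ring.
  eapply Rle_trans; [exact Key|].
  apply (Rmult_lt_compat_l (K + 1)) in H2; [|lra].
  replace ((K + 1) * (eps / (K + 1))) with eps in H2 by (field; lra).
  pose proof (Cmod_ge_0 (y - z)%C). simpl. nra.
Qed.

Lemma taylor_deriv f a : taylor_coeffs f a ->
  taylor_coeffs (power_series (deriv_coeffs a)) (deriv_coeffs a) /\
  forall z, in_disk z -> cderiv f z (power_series (deriv_coeffs a) z).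
Proof.
  intros H.
  assert (Hd := power_series_taylor _ (radius_ge_1_deriv _ (radius_ge_1_of_taylor _ _ H))).
  split; [exact Hd|]. intros z Hz. eapply power_series_cderiv; eassumption.
Qed.

Lemma Cis_series_mult (u v : nat -> C) (l m : C) :
  Cis_series u l -> Cis_series v m ->
  ex_series (fun n => Cmod (u n)) -> ex_series (fun n => Cmod (v n)) ->
  Cis_series (fun n => Csum (fun k => u k * v (n - k)%nat)%C n) (l * m)%C.
Proof.
  intros Hu Hv Au Av. apply Cis_series_components in Hu, Hv.
  destruct Hu as [Hu1 Hu2], Hv as [Hv1 Hv2].
  assert (Abs : forall (p : C -> R) (s : nat -> C), (forall z, Rabs (p z) <= Cmod z) ->
    ex_series (fun n => Cmod (s n)) -> ex_series (fun n => Rabs (p (s n)))).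
  { intros p s Hp Hs.
    apply (ex_series_le (V := R_CompleteNormedModule) _ (fun n => Cmod (s n))); [|exact Hs].
    intros n. eapply Rle_trans; [|apply Hp]. apply Req_le, Rabs_Rabsolu. }
  pose proof (Abs fst u abs_fst_le Au). pose proof (Abs snd u abs_snd_le Au).
  pose proof (Abs fst v abs_fst_le Av). pose proof (Abs snd v abs_snd_le Av).
  apply Cis_series_components. split.
  - eapply is_series_ext; [|exact (is_series_minus _ _ _ _
      (is_series_mult _ _ _ _ Hu1 Hv1 ltac:(assumption) ltac:(assumption))
      (is_series_mult _ _ _ _ Hu2 Hv2 ltac:(assumption) ltac:(assumption)))].
    intros n. rewrite fst_Csum, sum_n_Reals.
    change (sum_f_R0 (fun k => fst (u k) * fst (v (n - k)%nat)) n
      - sum_f_R0 (fun k => snd (u k) * snd (v (n - k)%nat)) n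
      = sum_f_R0 (fun k => fst (u k * v (n - k)%nat)%C) n).
    rewrite <- minus_sum. reflexivity.
  - eapply is_series_ext; [|exact (is_series_plus _ _ _ _
      (is_series_mult _ _ _ _ Hu1 Hv2 ltac:(assumption) ltac:(assumption))
      (is_series_mult _ _ _ _ Hu2 Hv1 ltac:(assumption) ltac:(assumption)))].
    intros n. rewrite snd_Csum, sum_n_Reals.
    change (sum_f_R0 (fun k => fst (u k) * snd (v (n - k)%nat)) n
      + sum_f_R0 (fun k => snd (u k) * fst (v (n - k)%nat)) n
      = sum_f_R0 (fun k => snd (u k * v (n - k)%nat)%C) n).
    rewrite <- plus_sum. reflexivity.
Qed.

Lemma taylor_mult f g a b : taylor_coeffs f a -> taylor_coeffs g b ->
  taylor_coeffs (fun z => f z * g z)%C (fun n => Csum (fun k => a k * b (n - k)%nat)%C n).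
Proof.
  intros Hf Hg z Hz.
  eapply is_series_ext; [|exact (Cis_series_mult _ _ _ _ (Hf z Hz) (Hg z Hz)
    (radius_ge_1_abs _ _ (radius_ge_1_of_taylor _ _ Hf) Hz)
    (radius_ge_1_abs _ _ (radius_ge_1_of_taylor _ _ Hg) Hz))].
  intros n.
  transitivity (Csum (fun k => a k * b (n - k)%nat * z ^ n)%C n).
  - apply sum_n_ext_loc. intros k Hk.
    replace (z ^ n)%C with (z ^ k * z ^ (n - k))%C; 
      [match goal with |- ?x = ?y => change (@eq C x y) end; ring|].
    rewrite <- Cpow_add_r. f_equal. lia.
  - exact (sum_n_mult_r (K := C_AbsRing) (z ^ n)%C (fun k => a k * b (n - k)%nat)%C n).
Qed.

(** * The logarithm *)

Definition log1p (z : C) : C := Clog (1 + z).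

Lemma re_1_plus_pos (z : C) : Cmod z < 1 -> 0 < 1 + fst z.
Proof.
  intros H. pose proof (abs_fst_le z) as H1.
  assert (H2 := Rle_lt_trans _ _ _ H1 H). apply Rabs_def2 in H2. lra.
Qed.

Lemma one_plus_neq_0 (z : C) : Cmod z < 1 -> (1 + z)%C <> RtoC 0.
Proof.
  intros H E. pose proof (re_1_plus_pos z H) as H1.
  apply (f_equal fst) in E. simpl in E. lra.
Qed.

Lemma log1p_0 : log1p 0 = RtoC 0.
Proof.
  unfold log1p, Clog, Carg.
  replace (Cmod (1 + 0)%C) with 1 by (rewrite Cplus_0_r, Cmod_1; reflexivity).
  rewrite ln_1. simpl. destruct (Rlt_dec 0 (1 + 0)); [|lra].
  replace ((0 + 0) / (1 + 0)) with 0 by field. rewrite atan_0. reflexivity.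
Qed.

(** The point 1 + z lies in the right half plane, where [Carg] takes its first branch; the
    components are then ln sqrt(X^2 + Y^2) and atan(Y / X). *)
Lemma log1p_path z h t : Cmod (z + RtoC t * h)%C < 1 ->
  path_derive (fun s => log1p (z + RtoC s * h)%C) t (/ (1 + (z + RtoC t * h)) * h)%C.
Proof.
  intros H. destruct z as [p q], h as [a b].
  assert (HX : 0 < 1 + (p + t * a)).
  { pose proof (re_1_plus_pos _ H) as H1. simpl in H1. lra. }
  assert (Hloc : locally t (fun s => 0 < 1 + (p + s * a))).
  { assert (Hc : continuous (fun s => 1 + (p + s * a)) t)
      by (apply @ex_derive_continuous; auto_derive; trivial).
    exact (Hc (fun y => 0 < y) (open_gt 0 _ HX)). }
  set (X := fun s => 1 + (p + s * a)) in *. set (Y := fun s => q + s * b).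
  assert (HS : 0 < X t * X t + Y t * Y t).
  { change (0 < X t) in HX. nra. }
  split.
  - apply (is_derive_ext (fun s => ln (sqrt (X s * X s + Y s * Y s)))).
    + intros s. unfold log1p, Clog, Cmod, X, Y. simpl. f_equal. f_equal. ring.
    + unfold X, Y in *. auto_derive.
      * split; [assumption|]. split; [|trivial]. apply sqrt_lt_R0. assumption.
      * set (S := sqrt _).
        assert (HSS : S * S = (1 + (p + t * a)) * (1 + (p + t * a)) + (q + t * b) * (q + t * b))
          by (apply sqrt_sqrt; lra).
        assert (HSp : 0 < S) by (apply sqrt_lt_R0; assumption).
        simpl.
        replace (1 + (p + (t * a - 0 * b))) with (1 + (p + t * a)) by ring.
        replace (0 + (q + (t * b + 0 * a))) with (q + t * b) by ring.
        set (x := 1 + (p + t * a)) in *. set (y := q + t * b) in *.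
        transitivity ((x * a + y * b) / (S * S)); [field; lra|].
        rewrite HSS. field. simpl in *. nra.
  - apply (is_derive_ext_loc (fun s => atan (Y s / X s))).
    + revert Hloc. apply filter_imp. intros s Hs.
      unfold log1p, Clog, Carg. simpl.
      replace (1 + (p + (s * a - 0 * b))) with (X s) by (unfold X; ring).
      replace (0 + (q + (s * b + 0 * a))) with (Y s) by (unfold Y; ring).
      destruct (Rlt_dec 0 (X s)) as [_|N]; [reflexivity|]. exfalso; apply N, Hs.
    + unfold X, Y in *. auto_derive.
      * lra.
      * simpl.
        replace (1 + (p + (t * a - 0 * b))) with (1 + (p + t * a)) by ring.
        replace (0 + (q + (t * b + 0 * a))) with (q + t * b) by ring.
        set (x := 1 + (p + t * a)) in *. set (y := q + t * b) in *.
        field. split; simpl in *; nra.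
Qed.

Lemma log1p_cderiv z : Cmod z < 1 -> cderiv log1p z (/ (1 + z))%C.
Proof.
  intros Hz. apply (cderiv_of_segments log1p (fun y => / (1 + y))%C z (1 - Cmod z)); [lra| |].
  - intros h t Hh Ht. apply log1p_path.
    eapply Rle_lt_trans; [apply Cmod_triangle|]. rewrite Cmod_mult, Cmod_R, Rabs_pos_eq by lra.
    pose proof (Cmod_ge_0 h). nra.
  - apply ccont_inv; [|apply one_plus_neq_0, Hz].
    apply ccont_plus; [apply ccont_const|apply ccont_id].
Qed.

Lemma re_inv_pos (z : C) : 0 < fst z -> 0 < fst (/ z)%C.
Proof.
  intros H. destruct z as [x y]. simpl in *. apply Rdiv_lt_0_compat; [exact H|]. nra.
Qed.

Lemma Cmod_scale_lt (z : C) t : Cmod z < 1 -> 0 <= t <= 1 -> Cmod (RtoC t * z)%C < 1.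
Proof.
  intros H Ht. rewrite Cmod_mult, Cmod_R, Rabs_pos_eq by lra.
  pose proof (Cmod_ge_0 z). nra.
Qed.

(** log(1 + z)/z is the mean of 1/(1 + t z) over 0 <= t <= 1, whose real part is positive. The mean
    value theorem for the real part stands in for the integral. *)
Lemma log1p_quotient_re_pos (z : C) : Cmod z < 1 -> z <> RtoC 0 ->
  0 < fst (log1p z * / z)%C.
Proof.
  intros Hz Hz0.
  destruct (real_MVT (fun t => fst (/ z * log1p (0 + RtoC t * z))%C)
    (fun t => fst (/ z * (/ (1 + (0 + RtoC t * z)) * z))%C)) as [t [Ht E]].
  - intros t Ht. refine (proj1 (path_derive_scal (/ z)%C _ t _ (log1p_path 0 z t _))).
    rewrite Cplus_0_l. apply Cmod_scale_lt; assumption.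
  - assert (H1 : Cmod (RtoC t * z)%C < 1) by (apply Cmod_scale_lt; [exact Hz|lra]).
    replace (/ z * (/ (1 + (0 + RtoC t * z)) * z))%C with (/ (1 + RtoC t * z))%C in E.
    2: { field. split; [|exact Hz0]. apply one_plus_neq_0, H1. }
    replace (0 + RtoC 1 * z)%C with z in E by ring.
    replace (0 + RtoC 0 * z)%C with (RtoC 0) in E by ring.
    rewrite log1p_0, Cmult_0_r, Cmult_comm in E.
    change (fst (RtoC 0)) with 0 in E. rewrite Rminus_0_r in E. rewrite E.
    apply re_inv_pos. exact (re_1_plus_pos _ H1).
Qed.

Lemma log1p_neq_0 (z : C) : Cmod z < 1 -> z <> RtoC 0 -> log1p z <> RtoC 0.
Proof.
  intros Hz Hz0 E. pose proof (log1p_quotient_re_pos z Hz Hz0) as H.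
  rewrite E, Cmult_0_l in H. simpl in H. lra.
Qed.

(** The numerator of Psi': with L = log(1 + z), Psi' = ((1 + z) L - z) / ((1 + z) L^2). *)
Definition psi_denom (z : C) : C := ((1 + z) * log1p z + (-1) * z)%C.

Lemma psi_denom_cderiv z : Cmod z < 1 -> cderiv psi_denom z (log1p z).
Proof.
  intros Hz.
  pose proof (cderiv_plus _ _ z _ _
    (cderiv_mult _ _ z _ _ (cderiv_plus _ _ z _ _ (cderiv_const 1 z) (cderiv_id z))
      (log1p_cderiv z Hz))
    (cderiv_mult _ _ z _ _ (cderiv_const (-1) z) (cderiv_id z))) as H.
  cbv beta in H.
  replace ((0 + 1) * log1p z + (1 + z) * / (1 + z) + (0 * z + -1 * 1))%C
    with (log1p z) in H; [exact H|].
  field. apply one_plus_neq_0, Hz.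
Qed.

(* psi_denom z / z^2 = int_0^1 (1 - t) / (1 + t z) dt has positive real part. *)
Lemma psi_denom_neq_0 (z : C) : Cmod z < 1 -> z <> RtoC 0 -> psi_denom z <> RtoC 0.
Proof.
  intros Hz Hz0 E0.
  destruct (real_MVT (fun t => fst (/ (z * z) * psi_denom (0 + RtoC t * z))%C)
    (fun t => fst (/ (z * z) * (log1p (0 + RtoC t * z) * z))%C)) as [t [Ht E]].
  - intros t Ht.
    refine (proj1 (path_derive_scal (/ (z * z))%C _ t _
      (path_derive_comp psi_denom _ t _ _ (psi_denom_cderiv _ _) (path_derive_segment 0 z t)))).
    rewrite Cplus_0_l. apply Cmod_scale_lt; assumption.
  - assert (Ht0 : RtoC t <> RtoC 0) by (intros X; apply RtoC_inj in X; lra).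
    replace (0 + RtoC 1 * z)%C with z in E by ring.
    replace (0 + RtoC 0 * z)%C with (RtoC 0) in E by ring.
    replace (psi_denom 0) with (RtoC 0) in E by (unfold psi_denom; rewrite log1p_0; ring).
    rewrite E0, Cmult_0_r, Cplus_0_l, Rminus_diag in E.
    replace (/ (z * z) * (log1p (RtoC t * z) * z))%C
      with (RtoC t * (log1p (RtoC t * z) * / (RtoC t * z)))%C in E
      by (field; split; assumption).
    assert (H : 0 < fst (log1p (RtoC t * z) * / (RtoC t * z))%C).
    { apply log1p_quotient_re_pos; [apply Cmod_scale_lt; [exact Hz|lra]|].
      apply Cmult_neq_0; assumption. }
    set (v := (log1p (RtoC t * z) * / (RtoC t * z))%C) in *.
    replace (fst (RtoC t * v)%C) with (t * fst v) in E by (simpl; ring). nra.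
Qed.

(** The derivative of the difference from the Taylor polynomial is y^4/(1 + y), of modulus at most
    2|z|^4 along the segment when |z| < 1/2; [path_MVT_bound] doubles the constant to 4. *)
Lemma log1p_expansion : bigO 5 (fun z => log1p z + - (z - RtoC (/ 2) * z ^ 2
  + RtoC (/ 3) * z ^ 3 - RtoC (/ 4) * z ^ 4))%C.
Proof.
  (* Horner form: the derivative follows by iterating the single rule [Step]. *)
  set (T := fun z : C => (z * (1 + z * (RtoC (- / 2) + z * (RtoC (/ 3) + z * RtoC (- / 4)))))%C).
  set (dT := fun z : C => (1 - z + z ^ 2 - z ^ 3)%C).
  assert (HT : forall z, cderiv T z (dT z)).
  { intros z.
    assert (Step : forall c u du, cderiv u z du ->
      cderiv (fun y => c + y * u y)%C z (0 + (1 * u z + z * du))%C).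
    { intros c u du Hu. apply (cderiv_plus (fun _ => c)); [apply cderiv_const|].
      apply (cderiv_mult (fun y => y)); [apply cderiv_id|exact Hu]. }
    pose proof (Step 0%C _ _ (Step 1%C _ _ (Step (RtoC (- / 2)) _ _
      (Step (RtoC (/ 3)) _ _ (cderiv_const (RtoC (- / 4)) z))))) as H.
    eapply (cderiv_ext_loc _ T z _ 1 Rlt_0_1).
    2: { match type of H with cderiv _ _ ?l => replace (dT z) with l end; [exact H|].
         unfold dT. rewrite !RtoC_opp, !RtoC_inv by lra. field. }
    intros y _. unfold T. ring. }
  exists 4, (/ 2). split; [lra|split; [lra|]]. intros z Hz.
  assert (HM : Cmod ((log1p (0 + RtoC 1 * z) + RtoC (-1) * T (0 + RtoC 1 * z)) -
     (log1p (0 + RtoC 0 * z) + RtoC (-1) * T (0 + RtoC 0 * z)))%C <= 2 * (2 * Cmod z ^ 5)).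
  { pose proof (Cmod_ge_0 z) as Hz0.
    apply (path_MVT_bound (fun t => log1p (0 + RtoC t * z) + RtoC (-1) * T (0 + RtoC t * z))%C
      (fun t => (/ (1 + (0 + RtoC t * z)) * z) + RtoC (-1) * (dT (0 + RtoC t * z) * z))%C).
    - intros t Ht. apply path_derive_plus.
      + apply log1p_path. rewrite Cplus_0_l. apply Cmod_scale_lt; [lra|exact Ht].
      + apply path_derive_scal. apply (path_derive_comp T); [apply HT|apply path_derive_segment].
    - intros t Ht. rewrite Cplus_0_l.
      assert (Hy : Cmod (RtoC t * z)%C <= Cmod z).
      { rewrite Cmod_mult, Cmod_R, Rabs_pos_eq by lra. nra. }
      set (y := (RtoC t * z)%C) in *.
      assert (H1 : (1 + y)%C <> RtoC 0) by (apply one_plus_neq_0; lra).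
      replace (/ (1 + y) * z + RtoC (-1) * (dT y * z))%C
        with (/ (1 + y) * (y ^ 4 * z))%C by (unfold dT; field; exact H1).
      rewrite !Cmod_mult, Cmod_inv, Cmod_pow by exact H1.
      assert (H2 : / 2 <= Cmod (1 + y)%C).
      { pose proof (Cmod_ge_sub 1%C y) as H. rewrite Cmod_1 in H. lra. }
      assert (H3 : / Cmod (1 + y)%C <= 2).
      { rewrite <- (Rinv_inv 2). apply Rinv_le_contravar; lra. }
      replace (2 * Cmod z ^ 5) with (2 * (Cmod z ^ 4 * Cmod z)) by ring.
      apply Rmult_le_compat; trivial.
      + apply Rlt_le, Rinv_0_lt_compat; lra.
      + apply Rmult_le_pos; [apply pow_le, Cmod_ge_0|exact Hz0].
      + apply Rmult_le_compat_r; [exact Hz0|]. apply pow_incr. split; [apply Cmod_ge_0|exact Hy]. }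
  replace (0 + RtoC 1 * z)%C with z in HM by ring.
  replace (0 + RtoC 0 * z)%C with (RtoC 0) in HM by ring.
  rewrite log1p_0 in HM.
  replace (log1p z + - (z - RtoC (/ 2) * z ^ 2 + RtoC (/ 3) * z ^ 3 - RtoC (/ 4) * z ^ 4))%C
    with (log1p z + RtoC (-1) * T z - (0 + RtoC (-1) * T 0%C))%C.
  - lra.
  - unfold T. rewrite !RtoC_opp. ring.
Qed.

(** * The function Psi *)

(** Near 0 the leading term c u^n dominates the remainder. This supplies the lower bound on the
    denominator that [bigO_quotient] asks for. *)
Lemma bigO_lower n (D : C -> C) (c : C) : c <> RtoC 0 ->
  bigO (S n) (fun u => D u + - (c * u ^ n))%C ->
  exists d, 0 < d /\ forall u, Cmod u < d -> Cmod c / 2 * Cmod u ^ n <= Cmod (D u).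
Proof.
  intros Hc [M [d [HM [Hd H]]]]. apply Cmod_gt_0 in Hc.
  exists (Rmin d (Cmod c / (2 * (M + 1)))).
  split; [apply Rmin_pos; [exact Hd|apply Rdiv_lt_0_compat; lra]|].
  intros u Hu.
  assert (H1 : Cmod u < d) by (eapply Rlt_le_trans; [exact Hu|apply Rmin_l]).
  assert (H2 : Cmod u < Cmod c / (2 * (M + 1))) by (eapply Rlt_le_trans; [exact Hu|apply Rmin_r]).
  specialize (H u H1).
  apply (Rmult_lt_compat_l (M + 1)) in H2; [|lra].
  replace ((M + 1) * (Cmod c / (2 * (M + 1)))) with (Cmod c / 2) in H2 by (field; lra).
  pose proof (Cmod_ge_sub (c * u ^ n)%C (D u + - (c * u ^ n))%C) as H3.
  replace (c * u ^ n + (D u + - (c * u ^ n)))%C with (D u) in H3 by ring.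
  rewrite Cmod_mult, Cmod_pow in H3.
  assert (H4 : 0 <= Cmod u ^ n) by (apply pow_le, Cmod_ge_0).
  pose proof (Cmod_ge_0 u). simpl in H.
  assert (M * (Cmod u * Cmod u ^ n) <= Cmod c / 2 * Cmod u ^ n).
  { rewrite <- Rmult_assoc. apply Rmult_le_compat_r; [exact H4|]. lra. }
  lra.
Qed.

(** Asymptotic division: the expansion of a quotient is verified by multiplying out. The value of g
    at 0 is a separate hypothesis because the product relation is assumed only off 0. *)
Lemma bigO_quotient n m (N D g : C -> C) (c d : R) : 0 < c -> 0 < d -> bigO (n + m) N ->
  (forall u, Cmod u < d -> c * Cmod u ^ m <= Cmod (D u)) ->
  (forall u, Cmod u < d -> u <> RtoC 0 -> (g u * D u)%C = N u) -> g 0%C = 0%C -> bigO n g.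
Proof.
  intros Hc Hd [M [d' [HM [Hd' H]]]] HD Hg H0.
  exists (M / c), (Rmin d d'). split; [apply Rdiv_le_0_compat; lra|].
  split; [apply Rmin_pos; assumption|]. intros u Hu.
  assert (H1 : Cmod u < d) by (eapply Rlt_le_trans; [exact Hu|apply Rmin_l]).
  assert (H2 : Cmod u < d') by (eapply Rlt_le_trans; [exact Hu|apply Rmin_r]).
  destruct (Ceq_dec u 0) as [E|E].
  - subst u. rewrite H0, Cmod_0 at 1. apply Rmult_le_pos; [apply Rdiv_le_0_compat; lra|].
    apply pow_le, Cmod_ge_0.
  - pose proof (proj1 (Cmod_gt_0 u) E) as Hp.
    specialize (H u H2). rewrite <- (Hg u H1 E), Cmod_mult, pow_add in H.
    specialize (HD u H1).
    assert (Hm : 0 < c * Cmod u ^ m) by (apply Rmult_lt_0_compat; [exact Hc|apply pow_lt, Hp]).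
    apply (Rmult_le_reg_r (c * Cmod u ^ m)); [exact Hm|].
    replace (M / c * Cmod u ^ n * (c * Cmod u ^ m)) with (M * (Cmod u ^ n * Cmod u ^ m))
      by (field; lra).
    eapply Rle_trans; [|exact H]. apply Rmult_le_compat_l; [apply Cmod_ge_0|exact HD].
Qed.

Lemma bigO_monomial n (c : C) : bigO n (fun u => c * u ^ n)%C.
Proof.
  exists (Cmod c), 1. split; [apply Cmod_ge_0|split; [lra|]]. intros u _.
  rewrite Cmod_mult, Cmod_pow. lra.
Qed.

Lemma log1p_expansion_1 : bigO 2 (fun z => log1p z + - (1 * z ^ 1))%C.
Proof.
  apply (bigO_ext 2 (fun z => (log1p z + - (z - RtoC (/ 2) * z ^ 2
    + RtoC (/ 3) * z ^ 3 - RtoC (/ 4) * z ^ 4)) + (RtoC (- / 2) * z ^ 2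
    + RtoC (/ 3) * z ^ 3 + RtoC (- / 4) * z ^ 4))%C _ 1 Rlt_0_1).
  - intros z _. rewrite !RtoC_opp. ring.
  - apply bigO_plus; [apply (bigO_weaken 2 5); [lia|apply log1p_expansion]|].
    apply bigO_plus; [apply bigO_plus|]; [| |];
      (eapply bigO_weaken; [|apply bigO_monomial]; lia).
Qed.

Lemma log1p_expansion_2 : bigO 3 (fun z => log1p z + - (z + RtoC (- / 2) * z ^ 2))%C.
Proof.
  apply (bigO_ext 3 (fun z => (log1p z + - (z - RtoC (/ 2) * z ^ 2
    + RtoC (/ 3) * z ^ 3 - RtoC (/ 4) * z ^ 4)) +
    (RtoC (/ 3) * z ^ 3 + RtoC (- / 4) * z ^ 4))%C _ 1 Rlt_0_1).
  - intros z _. rewrite !RtoC_opp. ring.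
  - apply bigO_plus; [apply (bigO_weaken 3 5); [lia|apply log1p_expansion]|].
    apply bigO_plus; (eapply bigO_weaken; [|apply bigO_monomial]; lia).
Qed.

Lemma RtoC_neq_0 (x : R) : x <> 0 -> RtoC x <> RtoC 0.
Proof. intros H E. apply H, RtoC_inj, E. Qed.

(** The Gregory coefficients 1, 1/2, -1/12, 1/24 are verified through u - P(u) log(1 + u) = O(u^5),
    followed by division by log(1 + u), which has order 1. *)
Lemma psi_expansion : bigO 4 (fun u => Psi u + - (1 + RtoC (/ 2) * u + RtoC (- / 12) * u ^ 2
  + RtoC (/ 24) * u ^ 3))%C.
Proof.
  destruct (bigO_lower 1 log1p 1%C (RtoC_neq_0 1 R1_neq_R0) log1p_expansion_1) as [d [Hd Hlow]].
  rewrite Cmod_1 in Hlow.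
  set (P := fun u : C => (1 + RtoC (/ 2) * u + RtoC (- / 12) * u ^ 2 + RtoC (/ 24) * u ^ 3)%C).
  set (T := fun z : C => (z - RtoC (/ 2) * z ^ 2 + RtoC (/ 3) * z ^ 3 - RtoC (/ 4) * z ^ 4)%C).
  assert (HP : bigO 0 P).
  { assert (H : forall n c, bigO 0 (fun u => c * u ^ n)%C)
      by (intros n c; eapply bigO_weaken; [|apply bigO_monomial]; lia).
    apply bigO_plus; [apply bigO_plus; [apply bigO_plus|]|]; try apply H; [apply bigO_const|].
    apply (bigO_ext 0 (fun u => RtoC (/ 2) * u ^ 1)%C _ 1 Rlt_0_1); [|apply H].
    intros u _. simpl. ring. }
  apply (bigO_quotient 4 1 (fun u => u + - (P u * log1p u))%C log1p _ (1 / 2) (Rmin d 1)).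
  - lra.
  - apply Rmin_pos; lra.
  (* The three fractions are the coefficients of degree 5, 6, 7 in u - P T; all lower ones
     cancel. *)
  - apply (bigO_ext 5 (fun u => RtoC (- 1) * (P u * (log1p u + - T u))
       + (RtoC (25 / 144) * u ^ 5 + RtoC (- 5 / 144) * u ^ 6 + RtoC (/ 96) * u ^ 7))%C _ 1 Rlt_0_1).
    + intros u _. unfold P, T.
      apply injective_projections; simpl; field.
    + apply bigO_plus.
      * apply bigO_scal, (bigO_mult 0 5); [exact HP|apply log1p_expansion].
      * apply bigO_plus; [apply bigO_plus|]; (eapply bigO_weaken; [|apply bigO_monomial]; lia).
  - intros u Hu. apply Hlow. eapply Rlt_le_trans; [exact Hu|apply Rmin_l].
  - intros u Hu Hu0. unfold Psi. destruct (Ceq_dec u 0) as [E|_]; [contradiction|].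
    fold (log1p u). fold (P u). field. apply log1p_neq_0; [|exact Hu0].
    eapply Rlt_le_trans; [exact Hu|apply Rmin_r].
  - unfold Psi. destruct (Ceq_dec 0 0) as [_|N]; [|contradiction]. simpl. ring.
Qed.

Lemma bigO_cderiv f a b : bigO 2 (fun u => f u + - (a + b * u))%C -> cderiv f 0%C b.
Proof.
  intros [M [d [HM [Hd H]]]].
  assert (E0 : f 0%C = a).
  { specialize (H 0%C). rewrite Cmod_0 in H. specialize (H Hd).
    pose proof (Cmod_ge_0 (f 0%C + - (a + b * 0))%C) as H1.
    assert (E : Cmod (f 0%C + - (a + b * 0))%C = 0) by (simpl in *; lra).
    apply Cmod_eq_0 in E.
    replace (f 0%C) with ((f 0%C + - (a + b * 0)) + a)%C by ring. rewrite E. ring. }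
  intros eps He. exists (Rmin d (eps / (M + 1))).
  split; [apply Rmin_pos; [exact Hd|apply Rdiv_lt_0_compat; lra]|].
  intros y Hy. rewrite E0. replace (y - 0)%C with y in * by ring.
  assert (H1 : Cmod y < d) by (eapply Rlt_le_trans; [exact Hy|apply Rmin_l]).
  assert (H2 : Cmod y < eps / (M + 1)) by (eapply Rlt_le_trans; [exact Hy|apply Rmin_r]).
  specialize (H y H1).
  replace (f y - a - y * b)%C with (f y + - (a + b * y))%C by ring.
  apply (Rmult_lt_compat_l (M + 1)) in H2; [|lra].
  replace ((M + 1) * (eps / (M + 1))) with eps in H2 by (field; lra).
  eapply Rle_trans; [exact H|]. pose proof (Cmod_ge_0 y). simpl. nra.
Qed.

Lemma psi_cderiv_0 : cderiv Psi 0%C (RtoC (/ 2)).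
Proof.
  apply (bigO_cderiv Psi 1%C).
  apply (bigO_ext 2 (fun u => (Psi u + - (1 + RtoC (/ 2) * u + RtoC (- / 12) * u ^ 2
    + RtoC (/ 24) * u ^ 3)) + (RtoC (- / 12) * u ^ 2 + RtoC (/ 24) * u ^ 3))%C _ 1 Rlt_0_1).
  - intros u _. ring.
  - apply bigO_plus; [apply (bigO_weaken 2 4); [lia|apply psi_expansion]|].
    apply bigO_plus; (eapply bigO_weaken; [|apply bigO_monomial]; lia).
Qed.

(* The reciprocal of Psi'. *)
Definition inv_dpsi (u : C) : C :=
  match Ceq_dec u 0 with
  | left _ => RtoC 2
  | right _ => ((1 + u) * log1p u * log1p u / psi_denom u)%C
  end.

(** Gives continuity at 0, where the formula reads 0/0: the leading terms are u^2 above and u^2/2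
    below, hence the value 2. *)
Lemma inv_dpsi_expansion : bigO 1 (fun u => inv_dpsi u + RtoC (- 2))%C.
Proof.
  set (E := fun u => (log1p u + - (u + RtoC (- / 2) * u ^ 2))%C).
  assert (HE : bigO 3 E) by apply log1p_expansion_2.
  assert (HL : bigO 1 log1p).
  { apply (bigO_ext 1 (fun z => (log1p z + - (1 * z ^ 1)) + z)%C _ 1 Rlt_0_1).
    - intros z _. simpl. ring.
    - apply bigO_plus; [apply (bigO_weaken 1 2); [lia|apply log1p_expansion_1]|apply bigO_id]. }
  destruct (bigO_lower 2 psi_denom (RtoC (/ 2))) as [d [Hd Hlow]].
  { apply RtoC_neq_0. lra. }
  { apply (bigO_ext 3 (fun u => (1 + u) * E u + RtoC (- / 2) * u ^ 3)%C _ 1 Rlt_0_1).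
    - intros u _. unfold E, psi_denom. apply injective_projections; simpl; field.
    - apply bigO_plus; [|apply bigO_monomial]. apply (bigO_mult 0 3); [|exact HE].
      apply bigO_plus; [apply bigO_const|apply (bigO_weaken 0 1); [lia|apply bigO_id]]. }
  rewrite Cmod_R, Rabs_pos_eq in Hlow by lra.
  apply (bigO_quotient 1 2 (fun u => (1 + u) * log1p u * log1p u + RtoC (- 2) * psi_denom u)%C
    psi_denom _ (/ 2 / 2) (Rmin d 1)).
  - lra.
  - apply Rmin_pos; lra.
  - apply (bigO_ext 3 (fun u => (1 + u) * (E u * log1p u + (u + RtoC (- / 2) * u ^ 2) * E u)
       + RtoC (- 2) * ((1 + u) * E u) + (1 * u ^ 3
       + (RtoC (- 3 / 4) * u ^ 4 + RtoC (/ 4) * u ^ 5)))%C _ 1 Rlt_0_1).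
    + intros u _. unfold E, psi_denom. apply injective_projections; simpl; field.
    + assert (H1 : bigO 0 (fun u => 1 + u)%C)
        by (apply bigO_plus; [apply bigO_const|apply (bigO_weaken 0 1); [lia|apply bigO_id]]).
      apply bigO_plus; [apply bigO_plus|].
      * apply (bigO_mult 0 3); [exact H1|]. apply (bigO_weaken 3 4); [lia|].
        apply bigO_plus; [apply (bigO_mult 3 1); assumption|]. apply (bigO_mult 1 3); [|exact HE].
        apply bigO_plus; [apply bigO_id|]. apply (bigO_weaken 1 2); [lia|apply bigO_monomial].
      * apply bigO_scal, (bigO_mult 0 3); assumption.
      * apply bigO_plus; [apply bigO_monomial|].
        apply bigO_plus; (eapply bigO_weaken; [|apply bigO_monomial]; lia).
  - intros u Hu. apply Hlow. eapply Rlt_le_trans; [exact Hu|apply Rmin_l].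
  - intros u Hu Hu0. unfold inv_dpsi. destruct (Ceq_dec u 0) as [X|_]; [contradiction|].
    field. apply psi_denom_neq_0; [|exact Hu0]. eapply Rlt_le_trans; [exact Hu|apply Rmin_r].
  - unfold inv_dpsi. destruct (Ceq_dec 0 0) as [_|N]; [|contradiction]. ring.
Qed.

Lemma inv_dpsi_continuous u : Cmod u < 1 -> ccont inv_dpsi u.
Proof.
  intros Hu. destruct (Ceq_dec u 0) as [E|E].
  - subst u. destruct inv_dpsi_expansion as [M [d [HM [Hd H]]]].
    intros eps He. exists (Rmin d (eps / (M + 1))).
    split; [apply Rmin_pos; [exact Hd|apply Rdiv_lt_0_compat; lra]|].
    intros y Hy. replace (y - 0)%C with y in Hy by ring.
    assert (H1 : Cmod y < d) by (eapply Rlt_le_trans; [exact Hy|apply Rmin_l]).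
    assert (H2 : Cmod y < eps / (M + 1)) by (eapply Rlt_le_trans; [exact Hy|apply Rmin_r]).
    specialize (H y H1). rewrite pow_1 in H.
    replace (inv_dpsi 0) with (RtoC 2).
    2: { unfold inv_dpsi. destruct (Ceq_dec 0 0) as [_|N]; [reflexivity|contradiction]. }
    replace (inv_dpsi y - 2)%C with (inv_dpsi y + RtoC (- 2))%C by ring.
    eapply Rle_lt_trans; [exact H|].
    apply (Rmult_lt_compat_l (M + 1)) in H2; [|lra].
    replace ((M + 1) * (eps / (M + 1))) with eps in H2 by (field; lra).
    pose proof (Cmod_ge_0 y). lra.
  - pose proof (proj1 (Cmod_gt_0 u) E) as Hp.
    apply (ccont_ext_loc (fun u => (1 + u) * log1p u * log1p u * / psi_denom u)%C _ u _ Hp).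
    + intros y Hy. unfold inv_dpsi. destruct (Ceq_dec y 0) as [X|_]; [|reflexivity].
      subst y. replace (0 - u)%C with (- u)%C in Hy by ring. rewrite Cmod_opp in Hy. lra.
    + assert (HL : ccont log1p u) by (eapply cderiv_ccont, log1p_cderiv, Hu).
      apply ccont_mult; [apply ccont_mult; [apply ccont_mult|]|]; trivial.
      * apply ccont_plus; [apply ccont_const|apply ccont_id].
      * apply ccont_inv; [|apply psi_denom_neq_0; assumption].
        eapply cderiv_ccont, psi_denom_cderiv, Hu.
Qed.

Lemma psi_log1p u : Cmod u < 1 -> (Psi u * log1p u)%C = u.
Proof.
  intros Hu. unfold Psi. destruct (Ceq_dec u 0) as [E|E].
  - subst u. rewrite log1p_0. ring.
  - fold (log1p u). field. apply log1p_neq_0; assumption.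
Qed.

(* dw = dp / Psi'(w), hence the derivative of w inherits the continuity of dp. *)
Lemma subordinate_C1 (p dp w dw : C -> C) : C1_punctured p dp ->
  (forall z, in_disk z -> cderiv w z (dw z)) -> (forall z, in_disk z -> Cmod (w z) < 1) ->
  (forall z, in_disk z -> p z = Psi (w z)) -> C1_off0 w.
Proof.
  intros Hp Hw Hw1 Hpw. exists (fun z => dp z * inv_dpsi (w z))%C.
  intros z Hz. assert (Hzd : in_disk z) by (unfold in_disk; lra).
  destruct (Hp z Hz) as [Hpz Hcp]. pose proof (Hw z Hzd) as Hwz.
  split.
  2: { apply ccont_mult; [exact Hcp|]. apply (ccont_comp inv_dpsi w).
       - apply inv_dpsi_continuous, Hw1, Hzd.
       - eapply cderiv_ccont, Hwz. }
  replace (dp z * inv_dpsi (w z))%C with (dw z); [exact Hwz|].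
  assert (Hr : 0 < 1 - Cmod z) by lra.
  assert (Hin : forall y, Cmod (y - z)%C < 1 - Cmod z -> in_disk y).
  { intros y Hy. unfold in_disk. pose proof (Cmod_triangle z (y - z)%C) as H.
    replace (z + (y - z))%C with y in H by ring. lra. }
  (* At a zero of w the derivative of Psi at 0 enters. Elsewhere the identity p log(1 + w) = w is
     differentiated and solved for w', which avoids differentiating Psi off 0. *)
  unfold inv_dpsi. destruct (Ceq_dec (w z) 0) as [E|E].
  - assert (H : cderiv p z (dw z * RtoC (/ 2))%C).
    { apply (cderiv_ext_loc (fun y => Psi (w y)) _ z _ (1 - Cmod z) Hr).
      - intros y Hy. symmetry. apply Hpw, Hin, Hy.
      - apply cderiv_comp; [|exact Hwz]. rewrite E. apply psi_cderiv_0. }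
    rewrite (cderiv_unique _ _ _ _ Hpz H). apply injective_projections; simpl; field.
  - pose proof (cderiv_mult p (fun y => log1p (w y)) z _ _ Hpz
      (cderiv_comp log1p w z _ _ (log1p_cderiv _ (Hw1 z Hzd)) Hwz)) as H. cbv beta in H.
    apply (cderiv_ext_loc _ w z _ (1 - Cmod z) Hr) in H.
    2: { intros y Hy. rewrite (Hpw y (Hin y Hy)). apply psi_log1p, Hw1, Hin, Hy. }
    pose proof (cderiv_unique _ _ _ _ Hwz H) as Eq.
    assert (N1 : (1 + w z)%C <> RtoC 0) by (apply one_plus_neq_0, Hw1, Hzd).
    assert (N2 := log1p_neq_0 _ (Hw1 z Hzd) E).
    assert (N3 := psi_denom_neq_0 _ (Hw1 z Hzd) E).
    assert (Ep : p z = (w z / log1p (w z))%C).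
    { rewrite (Hpw z Hzd). unfold Psi. destruct (Ceq_dec (w z) 0); [contradiction|reflexivity]. }
    rewrite Ep in Eq.
    assert (Eq2 : (dw z * psi_denom (w z) = dp z * ((1 + w z) * log1p (w z) * log1p (w z)))%C).
    { transitivity (dw z * ((1 + w z) * log1p (w z)) - dw z * w z)%C; [unfold psi_denom; ring|].
      rewrite Eq at 1. field. split; assumption. }
    transitivity (dw z * psi_denom (w z) / psi_denom (w z))%C; [field; exact N3|].
    rewrite Eq2. field. exact N3.
Qed.

(** * The estimates *)

Lemma C1_off0_ext u v : (forall z, 0 < Cmod z < 1 -> u z = v z) -> C1_off0 u -> C1_off0 v.
Proof.
  intros E [du Hu]. exists du. intros z Hz. destruct (Hu z Hz) as [H1 H2]. split; [|exact H2].
  apply (cderiv_ext_loc u v z _ (Rmin (Cmod z) (1 - Cmod z))); [apply Rmin_pos; lra| |exact H1].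
  intros y Hy.
  assert (Hy1 : Cmod (y - z)%C < Cmod z) by (eapply Rlt_le_trans; [exact Hy|apply Rmin_l]).
  assert (Hy2 : Cmod (y - z)%C < 1 - Cmod z) by (eapply Rlt_le_trans; [exact Hy|apply Rmin_r]).
  apply E. split.
  - pose proof (Cmod_ge_sub z (y - z)%C) as H. replace (z + (y - z))%C with y in H by ring. lra.
  - pose proof (Cmod_triangle z (y - z)%C) as H. replace (z + (y - z))%C with y in H by ring. lra.
Qed.

Lemma C1_off0_inv_fun u : C1_off0 u -> (forall z, 0 < Cmod z < 1 -> u z <> RtoC 0) ->
  C1_off0 (fun z => / u z)%C.
Proof.
  intros [du Hu] H0. exists (fun z => du z * ((-1) * / (u z * u z)))%C. intros z Hz.
  destruct (Hu z Hz) as [H1 H2]. specialize (H0 z Hz).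
  assert (Hc : ccont u z) by (eapply cderiv_ccont; exact H1).
  split.
  - replace (-1 * / (u z * u z))%C with (- / (u z * u z))%C by ring.
    apply (cderiv_comp (fun y => / y)%C u); [apply cderiv_inv, H0|exact H1].
  - apply ccont_mult; [exact H2|]. apply ccont_mult; [apply ccont_const|].
    apply ccont_inv; [apply ccont_mult; exact Hc|]. apply Cmult_neq_0; exact H0.
Qed.

Lemma taylor_C1_off0 u a : taylor_coeffs u a -> C1_off0 u.
Proof.
  intros H. destruct (taylor_deriv u a H) as [H1 H2].
  destruct (taylor_deriv _ _ H1) as [_ H3].
  eexists. intros z Hz. split; [apply H2; unfold in_disk; lra|].
  eapply cderiv_ccont, H3. unfold in_disk; lra.
Qed.

Lemma in_disk_0 : in_disk 0.
Proof. unfold in_disk. rewrite Cmod_0. lra. Qed.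

Lemma taylor_at_0 u a : taylor_coeffs u a -> u 0%C = a 0%nat.
Proof.
  intros H. rewrite (proj2 (taylor_shift _ _ H) _ in_disk_0). ring.
Qed.

Lemma cderiv_bounded_near_0 u l : cderiv u 0%C l -> bigO 0 u.
Proof.
  intros H. destruct (cderiv_bound _ _ _ H) as [d [Hd Hb]].
  exists (Cmod (u 0%C) + (Cmod l + 1)), (Rmin d 1).
  pose proof (Cmod_ge_0 (u 0%C)). pose proof (Cmod_ge_0 l).
  split; [lra|split; [apply Rmin_pos; lra|]]. intros z Hz.
  assert (Hzd : Cmod z < d) by (eapply Rlt_le_trans; [exact Hz|apply Rmin_l]).
  assert (Hz1 : Cmod z < 1) by (eapply Rlt_le_trans; [exact Hz|apply Rmin_r]).
  specialize (Hb z). replace (z - 0)%C with z in Hb by ring. specialize (Hb Hzd).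
  pose proof (Cmod_triangle (u 0%C) (u z - u 0%C)%C) as H3.
  replace (u 0%C + (u z - u 0%C))%C with (u z) in H3 by ring.
  pose proof (Cmod_ge_0 z). simpl. nra.
Qed.

Lemma taylor_bounded_near_0 u a : taylor_coeffs u a -> bigO 0 u.
Proof. intros H. eapply cderiv_bounded_near_0, (proj2 (taylor_deriv _ _ H)), in_disk_0. Qed.

Lemma taylor_expansion_4 u a : taylor_coeffs u a ->
  bigO 4 (fun z => u z + - (a 0%nat + a 1%nat * z + a 2%nat * z ^ 2 + a 3%nat * z ^ 3))%C.
Proof.
  intros H. destruct (taylor_shift _ _ H) as [H1 E1].
  destruct (taylor_shift _ _ H1) as [H2 E2].
  destruct (taylor_shift _ _ H2) as [H3 E3].
  destruct (taylor_shift _ _ H3) as [H4 E4].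
  apply (bigO_ext 4 (fun z => power_series (fun n => a (S (S (S (S n))))) z * (1 * z ^ 4))%C
    _ 1 Rlt_0_1).
  - intros z Hz. rewrite (E1 z Hz), (E2 z Hz), (E3 z Hz), (E4 z Hz). ring.
  - apply (bigO_mult 0 4); [eapply taylor_bounded_near_0, H4|apply bigO_monomial].
Qed.

(** Inverting Psi gives w = 2(p - 1) + w^2/6 - w^3/12 + O(z^4). Each substitution of the current
    approximation of w gains one order, from w = O(z) through [S1] and [S2] to the claim; c1, c2, c3
    are the coefficients so produced. *)
Lemma psi_compose_expansion (w p : C -> C) (p1 p2 p3 : C) : bigO 1 w ->
  bigO 4 (fun z => p z + - (1 + p1 * z + p2 * z ^ 2 + p3 * z ^ 3))%C ->
  (forall z, in_disk z -> p z = Psi (w z)) ->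
  let c1 := (2 * p1)%C in let c2 := (2 * p2 + RtoC (/ 6) * c1 ^ 2)%C in
  let c3 := (2 * p3 + RtoC (/ 3) * c1 * c2 + RtoC (- / 12) * c1 ^ 3)%C in
  bigO 4 (fun z => w z - (c1 * z + c2 * z ^ 2 + c3 * z ^ 3))%C.
Proof.
  intros Hw Hp Hpw c1 c2 c3.
  set (R := fun z => (1 + p1 * z + p2 * z ^ 2 + p3 * z ^ 3
    + - (1 + RtoC (/ 2) * w z + RtoC (- / 12) * w z ^ 2 + RtoC (/ 24) * w z ^ 3))%C).
  assert (HR : bigO 4 R).
  { apply (bigO_ext 4 (fun z => (Psi (w z) + - (1 + RtoC (/ 2) * w z
      + RtoC (- / 12) * w z ^ 2 + RtoC (/ 24) * w z ^ 3))
      + RtoC (- 1) * (p z + - (1 + p1 * z + p2 * z ^ 2 + p3 * z ^ 3)))%C _ 1 Rlt_0_1).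
    - intros z Hz. rewrite (Hpw z Hz). unfold R. ring.
    - apply bigO_plus; [exact (bigO_comp 4 _ w psi_expansion Hw)|].
      apply bigO_scal, Hp. }
  assert (Hmono : forall n m c, (n <= m)%nat -> bigO n (fun z => c * z ^ m)%C).
  { intros n m c Hnm. eapply bigO_weaken; [exact Hnm|apply bigO_monomial]. }
  assert (Hlin : bigO 1 (fun z => c1 * z)%C) by apply bigO_scal, bigO_id.
  assert (Hw2 : bigO 2 (fun z => w z * w z)%C) by (apply (bigO_mult 1 1); exact Hw).
  assert (Hw3 : bigO 3 (fun z => w z * w z * w z)%C) by (apply (bigO_mult 2 1); assumption).
  assert (S1 : bigO 2 (fun z => w z + - (c1 * z))%C).
  { apply (bigO_ext 2 (fun z => 2 * p2 * z ^ 2 + 2 * p3 * z ^ 3 + RtoC (/ 6) * (w z * w z)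
      + RtoC (- / 12) * (w z * w z * w z) + RtoC (- 2) * R z)%C _ 1 Rlt_0_1).
    - intros z _. unfold R, c1. apply injective_projections; simpl; field.
    - repeat apply bigO_plus; try (apply Hmono; lia); apply bigO_scal; [exact Hw2| |].
      + apply (bigO_weaken 2 3); [lia|exact Hw3].
      + apply (bigO_weaken 2 4); [lia|exact HR]. }
  assert (S2 : bigO 3 (fun z => w z + - (c1 * z + c2 * z ^ 2))%C).
  { apply (bigO_ext 3 (fun z => 2 * p3 * z ^ 3
      + RtoC (/ 6) * ((w z + - (c1 * z)) * (w z + c1 * z))
      + RtoC (- / 12) * (w z * w z * w z) + RtoC (- 2) * R z)%C _ 1 Rlt_0_1).
    - intros z _. unfold R, c2, c1. apply injective_projections; simpl; field.
    - repeat apply bigO_plus; try (apply Hmono; lia); apply bigO_scal.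
      + apply (bigO_mult 2 1); [exact S1|]. apply bigO_plus; assumption.
      + exact Hw3.
      + apply (bigO_weaken 3 4); [lia|exact HR]. }
  apply (bigO_ext 4 (fun z => RtoC (/ 6) * ((w z + - (c1 * z + c2 * z ^ 2))
        * (w z + (c1 * z + c2 * z ^ 2)))
      + (RtoC (/ 6) * c2 ^ 2) * z ^ 4
      + RtoC (- / 12) * ((w z + - (c1 * z)) * (w z * w z + c1 * z * w z + (c1 * z) * (c1 * z)))
      + RtoC (- 2) * R z)%C _ 1 Rlt_0_1).
  - intros z _. unfold R, c3.
    (* Expressing p1 and p2 through the abstracted c1 and c2 keeps the final polynomial identity
       small. *)
    set (k1 := c1). set (k2 := c2).
    replace p1 with (RtoC (/ 2) * k1)%C
      by (unfold k1, c1; apply injective_projections; simpl; field).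
    replace p2 with (RtoC (/ 2) * (k2 - RtoC (/ 6) * k1 ^ 2))%C
      by (unfold k2, c2, k1; apply injective_projections; simpl; field).
    clearbody k1 k2. apply injective_projections; simpl; field.
  - repeat apply bigO_plus; try (apply Hmono; lia); apply bigO_scal.
    + apply (bigO_mult 3 1); [exact S2|]. apply bigO_plus; [exact Hw|].
      apply bigO_plus; [exact Hlin|apply Hmono; lia].
    + apply (bigO_mult 2 2); [exact S1|].
      apply bigO_plus; [apply bigO_plus; [exact Hw2|]|]; apply (bigO_mult 1 1); assumption.
    + exact HR.
Qed.

(** With F = f/z and g = f', the relation p F = g gives p = z f'/f the coefficients a2, 2 a3 - a2^2
    and 3 a4 - 3 a2 a3 + a2^3; inverting Psi turns them into c1, c2, c3. *)
Lemma class_SG_contraction f df a : class_SG f df -> taylor_coeffs f a ->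
  let c1 := (2 * a 2%nat)%C in
  let c2 := (2 * (2 * a 3%nat - a 2%nat ^ 2) + RtoC (/ 6) * c1 ^ 2)%C in
  let c3 := (2 * (3 * a 4%nat - 3 * a 2%nat * a 3%nat + a 2%nat ^ 3)
    + RtoC (/ 3) * c1 * c2 + RtoC (- / 12) * c1 ^ 3)%C in
  toeplitz_contraction c1 c2 c3.
Proof.
  intros [[Hf [Hinj [Hf0 Hdf0]]] [w [dw [Hw [Hw0 [Hw1 Hsub]]]]]] Ha c1 c2 c3.
  assert (Hfd : forall z, in_disk z -> cderiv f z (df z))
    by (intros z Hz; apply cderiv_is_derive, Hf, Hz).
  assert (Hwd : forall z, in_disk z -> cderiv w z (dw z))
    by (intros z Hz; apply cderiv_is_derive, Hw, Hz).
  destruct (taylor_shift _ _ Ha) as [HF EF]. destruct (taylor_deriv _ _ Ha) as [Hg Hfg].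
  set (F := power_series (fun n => a (S n))) in *.
  set (g := power_series (deriv_coeffs a)) in *.
  assert (Edf : forall z, in_disk z -> df z = g z).
  { intros z Hz. exact (cderiv_unique _ _ _ _ (Hfd z Hz) (Hfg z Hz)). }
  assert (a0 : a 0%nat = RtoC 0) by (rewrite <- (taylor_at_0 _ _ Ha); exact Hf0).
  assert (a1 : a 1%nat = RtoC 1).
  { rewrite <- Hdf0, (Edf _ in_disk_0), (taylor_at_0 _ _ Hg). unfold deriv_coeffs.
    simpl. ring. }
  (* Injectivity makes the origin the only zero of f, so that z f'/f is C^1 off 0. *)
  assert (Hnz : forall z, in_disk z -> z <> RtoC 0 -> f z <> RtoC 0).
  { intros z Hz Hz0 E. apply Hz0, Hinj; [exact Hz|apply in_disk_0|].
    rewrite E. symmetry. exact Hf0. }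
  set (p := zfp_over_f f df).
  assert (Hp : C1_off0 p).
  { apply (C1_off0_ext (fun z => z * g z * / f z)%C).
    - intros z Hz. unfold p, zfp_over_f. destruct (Ceq_dec z 0) as [E|E].
      + subst z. rewrite Cmod_0 in Hz. lra.
      + rewrite (Edf z); [reflexivity|]. unfold in_disk; lra.
    - apply C1_off0_mult; [apply C1_off0_mult; [apply C1_off0_id|eapply taylor_C1_off0, Hg]|].
      apply C1_off0_inv_fun; [eapply taylor_C1_off0, Ha|].
      intros z Hz. apply Hnz; [unfold in_disk; lra|]. apply Cmod_gt_0; lra. }
  assert (HpF : forall z, in_disk z -> (p z * F z)%C = g z).
  { intros z Hz. unfold p, zfp_over_f. destruct (Ceq_dec z 0) as [E|E].
    - subst z. rewrite (taylor_at_0 _ _ HF), (taylor_at_0 _ _ Hg). unfold deriv_coeffs.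
      simpl. ring.
    - pose proof (Hnz z Hz E) as Hn. rewrite (Edf z Hz).
      rewrite (EF z Hz), a0, Cplus_0_l in *. field.
      split; [|exact E]. intros X. apply Hn. rewrite X. ring. }
  pose proof (taylor_expansion_4 _ _ HF) as XF. pose proof (taylor_expansion_4 _ _ Hg) as Xg.
  set (p1 := a 2%nat) in *. set (p2 := (2 * a 3%nat - a 2%nat ^ 2)%C) in *.
  set (p3 := (3 * a 4%nat - 3 * a 2%nat * a 3%nat + a 2%nat ^ 3)%C) in *.
  assert (Xp : bigO 4 (fun z => p z + - (1 + p1 * z + p2 * z ^ 2 + p3 * z ^ 3))%C).
  { destruct (bigO_lower 0 F 1%C (RtoC_neq_0 1 R1_neq_R0)) as [d [Hd Hlow]].
    { apply (bigO_ext 1 (fun z => (F z + - (a 1%nat + a 2%nat * z + a 3%nat * z ^ 2 + a 4%nat * z ^ 3))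
        + (a 2%nat * z ^ 1 + a 3%nat * z ^ 2 + a 4%nat * z ^ 3))%C _ 1 Rlt_0_1).
      - intros z _. rewrite a1. simpl. ring.
      - apply bigO_plus; [apply (bigO_weaken 1 4); [lia|exact XF]|].
        apply bigO_plus; [apply bigO_plus|];
          (eapply bigO_weaken; [|apply bigO_monomial]; lia). }
    rewrite Cmod_1 in Hlow.
    apply (bigO_quotient 4 0 (fun z => g z + - ((1 + p1 * z + p2 * z ^ 2 + p3 * z ^ 3) * F z))%C
      F _ (1 / 2) (Rmin d 1)).
    - lra.
    - apply Rmin_pos; lra.
    - apply (bigO_ext 4 (fun z =>
        (g z + - (deriv_coeffs a 0 + deriv_coeffs a 1 * z + deriv_coeffs a 2 * z ^ 2
           + deriv_coeffs a 3 * z ^ 3))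
        + RtoC (- 1) * ((1 + p1 * z + p2 * z ^ 2 + p3 * z ^ 3) *
            (F z + - (a 1%nat + a 2%nat * z + a 3%nat * z ^ 2 + a 4%nat * z ^ 3)))
        + ((- (p1 * a 4%nat + p2 * a 3%nat + p3 * a 2%nat)) * z ^ 4
           + (- (p2 * a 4%nat + p3 * a 3%nat)) * z ^ 5 + (- (p3 * a 4%nat)) * z ^ 6))%C
        _ 1 Rlt_0_1).
      + intros z _. unfold deriv_coeffs, p1, p2, p3. rewrite a1. simpl INR.
        rewrite !RtoC_plus. ring.
      + apply bigO_plus; [apply bigO_plus; [exact Xg|]|].
        * apply bigO_scal, (bigO_mult 0 4); [|exact XF].
          assert (H0 : forall n c, bigO 0 (fun u => c * u ^ n)%C)
            by (intros n c; eapply bigO_weaken; [|apply bigO_monomial]; lia).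
          apply bigO_plus; [apply bigO_plus; [apply bigO_plus; [apply bigO_const|]|]|];
            try apply H0.
          apply bigO_scal, (bigO_weaken 0 1); [lia|apply bigO_id].
        * apply bigO_plus; [apply bigO_plus|];
            (eapply bigO_weaken; [|apply bigO_monomial]; lia).
    - intros u Hu. apply Hlow. eapply Rlt_le_trans; [exact Hu|apply Rmin_l].
    - intros u Hu _. rewrite <- (HpF u); [ring|].
      eapply Rlt_le_trans; [exact Hu|apply Rmin_r].
    - unfold p, zfp_over_f. destruct (Ceq_dec 0 0) as [_|N]; [|contradiction]. ring. }
  assert (Hw01 : bigO 1 w).
  { destruct (cderiv_bound _ _ _ (Hwd _ in_disk_0)) as [d [Hd Hb]].
    exists (Cmod (dw 0%C) + 1), d. pose proof (Cmod_ge_0 (dw 0%C)).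
    split; [lra|split; [exact Hd|]]. intros z Hz. specialize (Hb z).
    rewrite Hw0 in Hb. replace (z - 0)%C with z in Hb by ring.
    replace (w z - 0)%C with (w z) in Hb by ring. rewrite pow_1. apply Hb, Hz. }
  destruct Hp as [dp Hdp].
  intros q0 q1 q2. apply (schur_contraction w c1 c2 c3 q0 q1 q2).
  - exact (subordinate_C1 p dp w dw Hdp Hwd Hw1 Hsub).
  - intros z Hz. apply Rlt_le, Hw1, Hz.
  - exact (psi_compose_expansion w p p1 p2 p3 Hw01 Xp Hsub).
Qed.

Lemma class_SG_estimates f df a : class_SG f df -> taylor_coeffs f a ->
  (forall mu : C, Cmod (a 3%nat - mu * a 2%nat * a 2%nat)%C
     <= / 4 * Rmax 1 (Cmod (mu - RtoC (/ 3))%C)) /\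
  Cmod (a 2%nat * a 3%nat - a 4%nat)%C <= / 6 /\
  Cmod (a 2%nat * a 4%nat - a 3%nat * a 3%nat)%C <= / 16.
Proof.
  intros Hf Ha. pose proof (class_SG_contraction f df a Hf Ha) as H. cbv zeta in H.
  set (c1 := (2 * a 2%nat)%C) in H.
  set (c2 := (2 * (2 * a 3%nat - a 2%nat ^ 2) + RtoC (/ 6) * c1 ^ 2)%C) in H.
  set (c3 := (2 * (3 * a 4%nat - 3 * a 2%nat * a 3%nat + a 2%nat ^ 3)
    + RtoC (/ 3) * c1 * c2 + RtoC (- / 12) * c1 ^ 3)%C) in H.
  assert (Hsc : forall (r : R) (u : C), 0 < r -> Cmod (RtoC r * u)%C = r * Cmod u).
  { intros r u Hr. rewrite Cmod_mult, Cmod_R, Rabs_pos_eq; lra. }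
  split; [|split].
  - intros mu.
    replace (a 3%nat - mu * a 2%nat * a 2%nat)%C
      with (RtoC (/ 4) * (c2 - (mu - RtoC (/ 3)) * c1 * c1))%C
      by (unfold c2, c1; apply injective_projections; simpl; field).
    rewrite Hsc by lra. apply Rmult_le_compat_l; [lra|].
    apply (contraction_fekete_szego _ _ _ _ H).
  - rewrite Cmod_sub_sym.
    replace (a 4%nat - a 2%nat * a 3%nat)%C
      with (RtoC (/ 6) * (c3 - RtoC (/ 3) * (c1 * c2) - RtoC (/ 6) * (c1 * c1 * c1)))%C
      by (unfold c3, c2, c1; apply injective_projections; simpl; field).
    rewrite Hsc by lra. pose proof (contraction_cubic _ _ _ H). lra.
  - replace (a 2%nat * a 4%nat - a 3%nat * a 3%nat)%C
      with (RtoC (/ 12) * (c1 * c3) - RtoC (/ 144) * (c1 * c1 * c2) - RtoC (/ 16) * (c2 * c2))%C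
      by (unfold c3, c2, c1; apply injective_projections; simpl; field).
    apply (contraction_hankel _ _ _ H).
Qed.

(** * Univalence of functions with Re (z f'/f) > 0 *)

Definition Cexp (z : C) : C := (exp (fst z) * cos (snd z), exp (fst z) * sin (snd z)).

Lemma Cmod_Cexp z : Cmod (Cexp z) = exp (fst z).
Proof. exact (Cmod_polar (exp (fst z)) (snd z) (Rlt_le _ _ (exp_pos _))). Qed.

Lemma Cexp_neq_0 z : Cexp z <> RtoC 0.
Proof. apply Cmod_gt_0. rewrite Cmod_Cexp. apply exp_pos. Qed.

Lemma Cexp_plus x y : Cexp (x + y) = (Cexp x * Cexp y)%C.
Proof.
  unfold Cexp. simpl. rewrite exp_plus, cos_plus, sin_plus.
  apply injective_projections; simpl; ring.
Qed.

Lemma Cexp_0 : Cexp 0 = RtoC 1.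
Proof. unfold Cexp. simpl. rewrite exp_0, cos_0, sin_0. apply injective_projections; simpl; ring. Qed.

Lemma Cexp_path z h t :
  path_derive (fun s => Cexp (z + RtoC s * h)%C) t (Cexp (z + RtoC t * h) * h)%C.
Proof.
  destruct z as [p q], h as [a b].
  assert (E : forall s, ((p, q) + RtoC s * (a, b))%C = (p + s * a, q + s * b)).
  { intros s. apply injective_projections; simpl; ring. }
  apply (path_derive_ext (fun s => Cexp (p + s * a, q + s * b))).
  { intros s. rewrite E. reflexivity. }
  rewrite E. split; unfold Cexp; simpl; auto_derive; trivial; ring.
Qed.

Lemma Cexp_cderiv z : cderiv Cexp z (Cexp z).
Proof.
  apply (cderiv_of_segments Cexp Cexp z 1 Rlt_0_1).
  { intros h t _ _. apply Cexp_path. }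
  intros eps He. set (K := 2 * exp (fst z + 1)).
  assert (HK : 0 < K) by (unfold K; pose proof (exp_pos (fst z + 1)); lra).
  exists (Rmin 1 (eps / K)). split; [apply Rmin_pos; [lra|apply Rdiv_lt_0_compat; lra]|].
  intros y Hy. set (h := (y - z)%C) in *.
  assert (H1 : Cmod h < 1) by (eapply Rlt_le_trans; [exact Hy|apply Rmin_l]).
  assert (H2 : Cmod h < eps / K) by (eapply Rlt_le_trans; [exact Hy|apply Rmin_r]).
  apply Rle_lt_trans with (2 * (exp (fst z + 1) * Cmod h)).
  - replace y with (z + RtoC 1 * h)%C by (unfold h; ring).
    replace z with (z + RtoC 0 * h)%C at 2 by ring.
    apply (path_MVT_bound (fun s => Cexp (z + RtoC s * h)%C)
      (fun t => Cexp (z + RtoC t * h) * h)%C); [intros t _; apply Cexp_path|].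
    intros t Ht. rewrite Cmod_mult, Cmod_Cexp. apply Rmult_le_compat_r; [apply Cmod_ge_0|].
    assert (H3 : fst (z + RtoC t * h)%C <= fst z + 1).
    { pose proof (abs_fst_le h) as H. assert (H4 := Rle_lt_trans _ _ _ H H1).
      apply Rabs_def2 in H4.
      replace (fst (z + RtoC t * h)%C) with (fst z + t * fst h) by (simpl; ring). nra. }
    destruct H3 as [H3|H3]; [left; apply exp_increasing, H3|rewrite H3; right; reflexivity].
  - apply (Rmult_lt_compat_l K) in H2; [|exact HK].
    replace (K * (eps / K)) with eps in H2 by (field; lra). unfold K in H2. lra.
Qed.

(** The angle is acos of the normalized real part, with the sign of the imaginary part. *)
Lemma Cexp_surjective (z : C) : z <> RtoC 0 -> exists zeta, Cexp zeta = z.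
Proof.
  intros Hz. pose proof (proj1 (Cmod_gt_0 z) Hz) as Hr.
  set (r := Cmod z) in *.
  pose proof (Cmod_sq z) as Hsq. fold r in Hsq.
  set (x := fst z / r). set (y := snd z / r).
  assert (Exy : x * x + y * y = 1).
  { unfold x, y. transitivity ((fst z ^ 2 + snd z ^ 2) / (r ^ 2)); [field; lra|].
    rewrite Hsq. field. rewrite <- Hsq. apply pow_nonzero. lra. }
  assert (Hx : -1 <= x <= 1) by nra.
  assert (Ht : exists t, cos t = x /\ sin t = y).
  { assert (Hs : sin (acos x) = Rabs y).
    { rewrite sin_acos by exact Hx. rewrite <- sqrt_Rsqr_abs. f_equal. unfold Rsqr. lra. }
    destruct (Rle_lt_dec 0 y) as [Hy|Hy].
    - exists (acos x). rewrite cos_acos by exact Hx. rewrite Hs, Rabs_pos_eq; auto.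
    - exists (- acos x). rewrite cos_neg, sin_neg, cos_acos by exact Hx.
      rewrite Hs, Rabs_left by exact Hy. split; [reflexivity|ring]. }
  destruct Ht as [t [E1 E2]]. exists (ln r, t).
  unfold Cexp. simpl. rewrite exp_ln by exact Hr. rewrite E1, E2.
  apply injective_projections; simpl; unfold x, y; field; lra.
Qed.

Lemma cderiv_zero_const u : (forall z, in_disk z -> cderiv u z 0%C) ->
  forall z, in_disk z -> u z = u 0%C.
Proof.
  intros H z Hz.
  assert (B : Cmod (u (0 + RtoC 1 * z) - u (0 + RtoC 0 * z))%C <= 2 * 0).
  { apply (path_MVT_bound (fun t => u (0 + RtoC t * z)%C) (fun t => 0 * z)%C).
    - intros t Ht. apply path_derive_comp; [|apply path_derive_segment].
      apply H. rewrite Cplus_0_l. apply Cmod_scale_lt; assumption.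
    - intros t _. rewrite Cmult_0_l, Cmod_0. lra. }
  replace (0 + RtoC 1 * z)%C with z in B by ring.
  replace (0 + RtoC 0 * z)%C with (RtoC 0) in B by ring.
  assert (E : (u z - u 0%C)%C = RtoC 0).
  { apply Cmod_eq_0, Rle_antisym; [lra|apply Cmod_ge_0]. }
  replace (u z) with ((u z - u 0%C) + u 0%C)%C by ring. rewrite E. ring.
Qed.

(** Course-of-values recursion: [step n] receives a whole sequence but, by hypothesis, depends only
    on its values up to n. *)
Lemma strong_recursion {T : Type} (t0 : T) (step : nat -> (nat -> T) -> T) :
  (forall n u v, (forall k, (k <= n)%nat -> u k = v k) -> step n u = step n v) ->
  exists u, u 0%nat = t0 /\ forall n, u (S n) = step n u.
Proof.
  intros Hext.
  (* [build n] is a sequence with the right values up to index n; [build (S m)] copies them and puts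
     the new value at every later index. *)
  set (build := fix build (n : nat) : nat -> T :=
    match n with
    | O => fun _ => t0
    | S m => fun k => if Nat.leb k m then build m k else step m (build m)
    end).
  assert (Hb : forall n k, (k <= n)%nat -> build n k = build k k).
  { induction n as [|n IH]; intros k Hk; [replace k with 0%nat by lia; reflexivity|].
    destruct (Nat.eq_dec k (S n)) as [->|Hne]; [reflexivity|].
    simpl. destruct (Nat.leb_spec k n) as [H|H]; [apply IH, H|lia]. }
  exists (fun n => build n n). split; [reflexivity|]. intros n.
  transitivity (if Nat.leb (S n) n then build n (S n) else step n (build n)); [reflexivity|].
  destruct (Nat.leb_spec (S n) n) as [H|_]; [lia|].
  apply Hext. intros k Hk. apply Hb, Hk.
Qed.

Lemma Csum_Cmod_le (u : nat -> C) n : (forall k, (k <= n)%nat -> Cmod (u k) <= 1) ->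
  Cmod (Csum u n) <= INR (S n).
Proof.
  induction n as [|n IH]; intros H.
  - rewrite sum_O. simpl. apply H. lia.
  - rewrite sum_Sn, S_INR. eapply Rle_trans; [apply Cmod_triangle|].
    apply Rplus_le_compat; [apply IH; intros; apply H; lia|apply H; lia].
Qed.

(* Solution of z f' = f (1 + z gam(z)), f = z al(z): the recursion for al keeps |al_n| <= 1. *)
Lemma starlike_coeffs (gam : nat -> C) : (forall n, Cmod (gam n) <= 1) ->
  exists al : nat -> C, al 0%nat = RtoC 1 /\ (forall n, Cmod (al n) <= 1) /\
    forall n, deriv_coeffs al n = Csum (fun j => gam j * al (n - j)%nat)%C n.
Proof.
  intros Hg.
  destruct (strong_recursion (RtoC 1) (fun n u =>
    (RtoC (/ INR (S n)) * Csum (fun j => gam j * u (n - j)%nat)%C n)%C)) as [al [H0 HS]].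
  { intros n u v E. f_equal. apply sum_n_ext_loc. intros k Hk. rewrite E by lia. reflexivity. }
  exists al. split; [exact H0|].
  assert (Hpos : forall n, 0 < INR (S n)) by (intros n; apply lt_0_INR; lia).
  split.
  - intros n. induction n as [n IH] using (well_founded_induction Wf_nat.lt_wf).
    destruct n as [|n]; [rewrite H0, Cmod_1; lra|].
    rewrite HS, Cmod_mult, Cmod_R, Rabs_pos_eq by (apply Rlt_le, Rinv_0_lt_compat, Hpos).
    apply (Rmult_le_reg_l (INR (S n))); [apply Hpos|].
    rewrite <- Rmult_assoc, Rinv_r, Rmult_1_l, Rmult_1_r by (apply Rgt_not_eq, Hpos).
    apply Csum_Cmod_le. intros k Hk. rewrite Cmod_mult.
    pose proof (Hg k). pose proof (IH (n - k)%nat ltac:(lia)).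
    pose proof (Cmod_ge_0 (gam k)). pose proof (Cmod_ge_0 (al (n - k)%nat)). nra.
  - intros n. unfold deriv_coeffs. rewrite HS, Cmult_assoc, <- RtoC_mult, Rinv_r.
    + ring.
    + apply Rgt_not_eq, Hpos.
Qed.

Lemma starlike_univalent (F H Gam : C -> C) :
  (forall z, in_disk z -> F z = Cexp (H z)) ->
  (forall z, in_disk z -> cderiv H z (Gam z)) ->
  (forall z, in_disk z -> 0 < fst (1 + z * Gam z)%C) ->
  univalent_on_disk (fun z => z * F z)%C.
Proof.
  intros HF HH Hpos z1 z2 Hz1 Hz2 E. cbv beta in E.
  assert (Fnz : forall z, in_disk z -> F z <> RtoC 0).
  { intros z Hz. rewrite HF by exact Hz. apply Cexp_neq_0. }
  assert (Zero : forall u v, in_disk v -> u = RtoC 0 -> (u * F u = v * F v)%C -> u = v).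
  { intros u v Hv -> Euv. rewrite Cmult_0_l in Euv.
    destruct (Ceq_dec v 0) as [Ev|Ev]; [symmetry; exact Ev|].
    exfalso. apply (Cmult_neq_0 v (F v)); [exact Ev|apply Fnz, Hv|]. symmetry. exact Euv. }
  destruct (Ceq_dec z1 0) as [E1|E1]; [apply Zero; assumption|].
  destruct (Ceq_dec z2 0) as [E2|E2]; [symmetry; apply Zero; auto|].
  destruct (Cexp_surjective z1 E1) as [s1 Hs1]. destruct (Cexp_surjective z2 E2) as [s2 Hs2].
  set (g := fun s => (s + H (Cexp s))%C).
  assert (Hhalf : forall s : C, in_disk (Cexp s) <-> fst s < 0).
  { intros s. unfold in_disk. rewrite Cmod_Cexp, <- exp_0. split.
    - apply exp_lt_inv.
    - apply exp_increasing. }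
  (* g' = 1 + z Gam(z) has positive real part, so g is injective on the half plane. *)
  assert (Hg : forall s t : C, fst s < 0 -> fst t < 0 -> g s = g t -> s = t).
  { intros s t Hs Ht Eg. destruct (Ceq_dec s t) as [Est|Est]; [exact Est|exfalso].
    set (h := (t - s)%C).
    assert (Hh : h <> RtoC 0).
    { intros X. apply Est. replace t with (s + h)%C by (unfold h; ring). rewrite X, Cplus_0_r. reflexivity. }
    destruct (real_MVT (fun x => fst (/ h * g (s + RtoC x * h))%C)
      (fun x => fst (/ h * ((1 + Cexp (s + RtoC x * h) * Gam (Cexp (s + RtoC x * h))) * h))%C))
      as [x [Hx Ex]].
    - intros x Hx.
      refine (proj1 (path_derive_scal (/ h)%C _ x _
        (path_derive_comp g _ x _ _ _ (path_derive_segment s h x)))).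
      apply cderiv_plus; [apply cderiv_id|].
      apply cderiv_comp; [|apply Cexp_cderiv]. apply HH, Hhalf. unfold h. simpl. nra.
    - replace (s + RtoC 1 * h)%C with t in Ex by (unfold h; ring).
      replace (s + RtoC 0 * h)%C with s in Ex by ring.
      rewrite Eg, Rminus_diag in Ex.
      set (z := Cexp (s + RtoC x * h)) in *.
      replace (/ h * ((1 + z * Gam z) * h))%C with (1 + z * Gam z)%C in Ex by (field; exact Hh).
      assert (Hzd : in_disk z) by (apply Hhalf; unfold h; simpl; nra).
      pose proof (Hpos z Hzd) as Hp. rewrite <- Ex in Hp. lra. }
  assert (Hs1' : fst s1 < 0) by (apply Hhalf; rewrite Hs1; exact Hz1).
  assert (Hs2' : fst s2 < 0) by (apply Hhalf; rewrite Hs2; exact Hz2).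
  assert (Eexp : Cexp (g s1) = Cexp (g s2)).
  { unfold g. rewrite !Cexp_plus, Hs1, Hs2, <- !HF by assumption. exact E. }
  (* Since exp(g s) = f(exp s), d is a period of exp. Shifting s2 by d keeps exp s2 = z2 and adds d
     to g, so g(s2 + d) = g s1. Injectivity of g then concludes without knowing the periods of
     exp. *)
  set (d := (g s1 - g s2)%C).
  assert (Hd : Cexp d = RtoC 1).
  { replace (Cexp d) with (Cexp (d + g s2) * / Cexp (g s2))%C.
    - replace (d + g s2)%C with (g s1) by (unfold d; ring). rewrite Eexp.
      apply Cinv_r, Cexp_neq_0.
    - rewrite Cexp_plus. field. apply Cexp_neq_0. }
  assert (E3 : Cexp (s2 + d) = z2) by (rewrite Cexp_plus, Hs2, Hd; ring).
  assert (E4 : s1 = (s2 + d)%C).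
  { apply Hg; [exact Hs1'|apply Hhalf; rewrite E3; exact Hz2|].
    unfold g at 2. rewrite E3, <- Hs2.
    replace (s2 + d + H (Cexp s2))%C with (g s2 + d)%C by (unfold g; ring).
    unfold d. ring. }
  rewrite <- Hs1, <- E3, E4. reflexivity.
Qed.

Lemma starlike_function (gam : nat -> C) : (forall n, Cmod (gam n) <= 1) ->
  (forall z, in_disk z -> 0 < fst (1 + z * power_series gam z)%C) ->
  exists (f df : C -> C) (a : nat -> C), class_S f df /\ taylor_coeffs f a /\
    (forall z, in_disk z -> zfp_over_f f df z = (1 + z * power_series gam z)%C) /\
    a 1%nat = RtoC 1 /\
    forall n, deriv_coeffs (fun k => a (S k)) n
      = Csum (fun j => gam j * a (S (n - j)))%C n.
Proof.
  intros Hg Hpos. destruct (starlike_coeffs gam Hg) as [al [al0 [Hal Hrec]]].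
  (* Coefficients of H, the primitive of Gam vanishing at 0. Then F = exp H, because F exp(-H) has
     derivative 0 and value 1 at 0. *)
  set (h := fun n => match n with O => RtoC 0 | S m => (RtoC (/ INR (S m)) * gam m)%C end).
  assert (Hpn : forall n, 0 < INR (S n)) by (intros n; apply lt_0_INR; lia).
  assert (Hh : forall n, Cmod (h n) <= 1).
  { intros [|n]; unfold h; [rewrite Cmod_0; lra|].
    rewrite Cmod_mult, Cmod_R, Rabs_pos_eq by (apply Rlt_le, Rinv_0_lt_compat, Hpn).
    apply (Rmult_le_reg_l (INR (S n))); [apply Hpn|].
    rewrite <- Rmult_assoc, Rinv_r, Rmult_1_l, Rmult_1_r by (apply Rgt_not_eq, Hpn).
    eapply Rle_trans; [apply Hg|]. rewrite S_INR. pose proof (pos_INR n). lra. }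
  pose proof (power_series_taylor _ (radius_ge_1_of_bounded _ _ Hg)) as TG.
  pose proof (power_series_taylor _ (radius_ge_1_of_bounded _ _ Hal)) as TF.
  pose proof (power_series_taylor _ (radius_ge_1_of_bounded _ _ Hh)) as TH.
  set (Gam := power_series gam) in *. set (F := power_series al) in *.
  set (H := power_series h) in *.
  assert (DH : forall z, in_disk z -> cderiv H z (Gam z)).
  { intros z Hz. apply (power_series_cderiv H Gam h); [exact TH| |exact Hz].
    apply (taylor_ext Gam Gam gam); [reflexivity| |exact TG].
    intros n. unfold deriv_coeffs, h.
    rewrite Cmult_assoc, <- RtoC_mult, Rinv_r by (apply Rgt_not_eq, Hpn). ring. }
  assert (DF : forall z, in_disk z -> cderiv F z (Gam z * F z)%C).
  { intros z Hz. apply (power_series_cderiv F (fun z => Gam z * F z)%C al); [exact TF| |exact Hz].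
    eapply taylor_ext; [| |exact (taylor_mult _ _ _ _ TG TF)]; [reflexivity|].
    intros n. symmetry. apply Hrec. }
  assert (EF : forall z, in_disk z -> F z = Cexp (H z)).
  { intros z Hz.
    assert (Hc : (F z * Cexp (RtoC (- 1) * H z))%C = RtoC 1).
    { rewrite (cderiv_zero_const (fun z => F z * Cexp (RtoC (- 1) * H z))%C); [| |exact Hz].
      - rewrite (taylor_at_0 _ _ TF), (taylor_at_0 _ _ TH). unfold h.
        rewrite al0, Cmult_0_r, Cexp_0. ring.
      - intros y Hy.
        pose proof (cderiv_mult F (fun z => Cexp (RtoC (- 1) * H z)%C) y _ _ (DF y Hy)
          (cderiv_comp Cexp (fun z => RtoC (- 1) * H z)%C y _ _ (Cexp_cderiv _)
            (cderiv_mult _ _ y _ _ (cderiv_const (RtoC (- 1)) y) (DH y Hy)))) as D.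
        cbv beta in D. match type of D with cderiv _ _ ?l => replace (RtoC 0) with l; [exact D|] end.
        ring. }
    replace (F z) with (F z * Cexp (RtoC (- 1) * H z) * Cexp (H z))%C.
    - rewrite Hc. ring.
    - rewrite <- Cmult_assoc, <- Cexp_plus.
      replace (RtoC (- 1) * H z + H z)%C with (RtoC 0) by ring. rewrite Cexp_0. ring. }
  exists (fun z => z * F z)%C, (fun z => F z * (1 + z * Gam z))%C,
    (fun n => match n with O => RtoC 0 | S m => al m end).
  split; [split; [|split; [|split]]|split; [|split; [|split]]].
  - intros z Hz. apply cderiv_is_derive.
    pose proof (cderiv_mult _ _ z _ _ (cderiv_id z) (DF z Hz)) as D. cbv beta in D.
    match type of D with cderiv _ _ ?l => replace (F z * (1 + z * Gam z))%C with l; [exact D|] end.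
    ring.
  - exact (starlike_univalent F H Gam EF DH Hpos).
  - ring.
  - rewrite (taylor_at_0 _ _ TF), al0. ring.
  - eapply taylor_ext; [| |exact (taylor_unshift F
      (fun n => match n with O => RtoC 0 | S m => al m end) TF)]; [|reflexivity].
    intros z _. simpl. ring.
  - intros z Hz. unfold zfp_over_f. destruct (Ceq_dec z 0) as [E|E]; [subst z; ring|].
    field. split; [|exact E]. rewrite EF by exact Hz. apply Cexp_neq_0.
  - exact al0.
  - exact Hrec.
Qed.

(** * Extremal functions *)

(* Kaluza's argument: (e_n) = (1/(n+1)) is log-convex, so 1 / sum e_n x^n = 1 - sum |d_n| x^n. *)
Lemma kaluza_coeffs : exists d : nat -> R, d 0%nat = 1 /\ (forall n, Rabs (d n) <= 1) /\
  forall n, sum_f_R0 (fun j => d j * / INR (S (S n - j))) (S n) = 0.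
Proof.
  set (e := fun m : nat => / INR (S m)).
  destruct (strong_recursion 1 (fun n u => - sum_f_R0 (fun j => u j * e (S n - j)%nat) n))
    as [d [d0 dS]].
  { intros n u v E. f_equal. apply sum_eq. intros k Hk. rewrite E by exact Hk. reflexivity. }
  assert (He : forall m, 0 < e m) by (intros m; apply Rinv_0_lt_compat, lt_0_INR; lia).
  assert (He0 : e 0%nat = 1) by (unfold e; simpl; apply Rinv_1).
  assert (Hrec : forall n, sum_f_R0 (fun j => d j * e (S n - j)%nat) (S n) = 0).
  { intros n. rewrite tech5, Nat.sub_diag, He0, dS. ring. }
  assert (Hrec' : forall n,
    e (S n) + sum_f_R0 (fun i => d (S i) * e (n - i)%nat) n = 0).
  { intros n. rewrite <- (Hrec n), (decomp_sum _ (S n)) by lia.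
    rewrite d0, Nat.sub_0_r. simpl pred. rewrite Rmult_1_l. reflexivity. }
  assert (Hd : forall n, -1 <= d (S n) <= 0).
  { intros n. induction n as [n IH] using (well_founded_induction Wf_nat.lt_wf).
    destruct n as [|n].
    - rewrite dS. simpl. rewrite d0. unfold e. simpl. lra.
    - pose proof (Hrec' (S n)) as H1. rewrite tech5, Nat.sub_diag, He0 in H1.
      pose proof (Hrec' n) as H2.
      set (q := e (S (S n)) / e (S n)).
      assert (Hq : 0 < q) by (apply Rdiv_lt_0_compat; apply He).
      assert (Hqe : q * e (S n) = e (S (S n))) by (unfold q; field; apply Rgt_not_eq, He).
      assert (Hup : sum_f_R0 (fun i => d (S i) * e (S n - i)%nat) n <= 0).
      { replace 0 with (0 * INR (S n)) by ring. rewrite <- sum_cte.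
        apply sum_Rle. intros i Hi. destruct (IH i ltac:(lia)) as [_ Hi0].
        pose proof (He (S n - i)%nat). nra. }
      (* The ratio e(m+1)/e(m) increases with m, so e(n+1-i) <= q e(n-i), and the factors d <= 0
         reverse this. By [H2] the left side is -e(n+2); [H1] then gives d(n+2) <= 0, while [Hup]
         gives d(n+2) >= -e(n+2). *)
      assert (Hlow : q * sum_f_R0 (fun i => d (S i) * e (n - i)%nat) n
                     <= sum_f_R0 (fun i => d (S i) * e (S n - i)%nat) n).
      { rewrite scal_sum. apply sum_Rle. intros i Hi.
        destruct (IH i ltac:(lia)) as [_ Hi0].
        assert (Hr : e (S n - i)%nat <= q * e (n - i)%nat).
        { unfold q, e. replace (S n - i)%nat with (S (n - i)) by lia.
          rewrite !S_INR. rewrite minus_INR by exact Hi.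
          assert (Hin : INR i <= INR n) by (apply le_INR, Hi).
          pose proof (pos_INR i) as Hi1.
          set (x := INR n) in *. set (y := INR i) in *.
          apply (Rmult_le_reg_r ((x - y + 1 + 1) * (x + 1 + 1 + 1) * (x - y + 1))).
          - apply Rmult_lt_0_compat; [apply Rmult_lt_0_compat|]; lra.
          - replace (/ (x - y + 1 + 1) * ((x - y + 1 + 1) * (x + 1 + 1 + 1) * (x - y + 1)))
              with ((x + 1 + 1 + 1) * (x - y + 1)) by (field; lra).
            replace (/ (x + 1 + 1 + 1) / / (x + 1 + 1) * / (x - y + 1)
                * ((x - y + 1 + 1) * (x + 1 + 1 + 1) * (x - y + 1)))
              with ((x + 1 + 1) * (x - y + 1 + 1)) by (field; lra).
            nra. }
        nra. }
      assert (He1 : e (S (S n)) <= 1).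
      { unfold e. rewrite <- Rinv_1. apply Rinv_le_contravar; [lra|].
        rewrite !S_INR. pose proof (pos_INR n). lra. }
      nra. }
  exists d. split; [exact d0|split; [|exact Hrec]].
  intros [|n]; [rewrite d0, Rabs_R1; lra|]. destruct (Hd n). apply Rabs_le. lra.
Qed.

Lemma sum_alternating (u v : nat -> R) n :
  Csum (fun k => RtoC ((-1) ^ k * u k) * RtoC ((-1) ^ (n - k) * v (n - k)%nat))%C n =
  RtoC ((-1) ^ n * sum_f_R0 (fun k => u k * v (n - k)%nat) n).
Proof.
  apply injective_projections.
  - rewrite fst_Csum, sum_n_Reals. simpl. rewrite scal_sum. apply sum_eq. intros k Hk.
    replace ((-1) ^ n) with ((-1) ^ k * (-1) ^ (n - k))
      by (rewrite <- pow_add; f_equal; lia).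
    ring.
  - rewrite snd_Csum, sum_n_Reals. simpl.
    rewrite (sum_eq _ (fun _ => 0)); [|intros k Hk; ring]. rewrite sum_cte. ring.
Qed.

(** The coefficients of log(1 + z)/z. *)
Definition log_coeffs (n : nat) : C := RtoC ((-1) ^ n * / INR (S n)).

Lemma Cmod_alternating x n : 0 <= x <= 1 -> Cmod (RtoC ((-1) ^ n * x)) <= 1.
Proof.
  intros Hx. rewrite Cmod_R, Rabs_mult, pow_1_abs, Rabs_pos_eq; lra.
Qed.

Lemma log_coeffs_taylor : taylor_coeffs (power_series log_coeffs) log_coeffs.
Proof.
  apply power_series_taylor, (radius_ge_1_of_bounded _ 1). intros n. apply Cmod_alternating.
  split; [apply Rlt_le, Rinv_0_lt_compat, lt_0_INR; lia|].
  rewrite <- Rinv_1. apply Rinv_le_contravar; [lra|]. rewrite S_INR. pose proof (pos_INR n). lra.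
Qed.

(** Both sides vanish at 0 and have derivative 1/(1 + z). The geometric series S is summed from its
    own shift relation S = 1 - z S. *)
Lemma log1p_power_series z : in_disk z -> (z * power_series log_coeffs z)%C = log1p z.
Proof.
  set (b := fun n => match n with O => RtoC 0 | S m => log_coeffs m end).
  assert (Hu : taylor_coeffs (fun z => b 0%nat + z * power_series log_coeffs z)%C b)
    by (apply (taylor_unshift _ b), log_coeffs_taylor).
  set (geo := fun n => RtoC ((-1) ^ n * 1)).
  assert (Tg : taylor_coeffs (power_series geo) geo)
    by (apply power_series_taylor, (radius_ge_1_of_bounded _ 1); intros n;
        apply Cmod_alternating; lra).
  assert (Eg : forall z, in_disk z -> power_series geo z = (/ (1 + z))%C).
  { intros y Hy. destruct (taylor_shift _ _ Tg) as [H1 H2].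
    assert (E : power_series (fun n => geo (S n)) y = (RtoC (- 1) * power_series geo y)%C).
    { apply (taylor_unique _ (fun y => RtoC (- 1) * power_series geo y)%C _ y H1); [|exact Hy].
      intros x Hx. eapply is_series_ext; [|exact (Cis_series_scal (RtoC (- 1)) _ _ (Tg x Hx))].
      intros n. cbv beta. unfold geo. rewrite !Rmult_1_r, <- tech_pow_Rmult, RtoC_mult.
      apply Cmult_assoc. }
    specialize (H2 y Hy). rewrite E in H2.
    assert (N : (1 + y)%C <> RtoC 0) by (apply one_plus_neq_0, Hy).
    replace (geo 0%nat) with (RtoC 1) in H2 by (unfold geo; simpl; f_equal; ring).
    transitivity ((1 + y) * power_series geo y / (1 + y))%C; [field; exact N|].
    replace ((1 + y) * power_series geo y)%C with (RtoC 1); [field; exact N|].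
    transitivity (power_series geo y - (1 + y * (RtoC (- 1) * power_series geo y)) + 1)%C;
      [rewrite <- H2; ring|ring]. }
  intros Hz.
  pose proof (cderiv_zero_const
    (fun y => (b 0%nat + y * power_series log_coeffs y) + RtoC (- 1) * log1p y)%C) as HC.
  cbv beta in HC.
  assert (E : (b 0%nat + z * power_series log_coeffs z + RtoC (- 1) * log1p z)%C
    = (b 0%nat + 0 * power_series log_coeffs 0 + RtoC (- 1) * log1p 0)%C).
  { apply HC; [|exact Hz]. intros y Hy.
    assert (D1 : cderiv (fun y => b 0%nat + y * power_series log_coeffs y)%C y (/ (1 + y))%C).
    { rewrite <- Eg by exact Hy.
      apply (power_series_cderiv _ (power_series geo) b); [exact Hu| |exact Hy].
      eapply taylor_ext; [| |exact Tg]; [reflexivity|]. intros n.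
      unfold geo, deriv_coeffs, b, log_coeffs. rewrite <- RtoC_mult. f_equal. field.
      apply Rgt_not_eq, lt_0_INR. lia. }
    pose proof (cderiv_plus _ _ y _ _ D1 (cderiv_mult _ _ y _ _ (cderiv_const (RtoC (- 1)) y)
      (log1p_cderiv y Hy))) as D. cbv beta in D.
    match type of D with cderiv _ _ ?l => replace (RtoC 0) with l; [exact D|] end. ring. }
  rewrite log1p_0 in E. unfold b in E.
  replace (z * power_series log_coeffs z)%C with
    ((0 + z * power_series log_coeffs z + RtoC (- 1) * log1p z) + log1p z)%C by ring.
  rewrite E. ring.
Qed.

(** Putting x = -z in Kaluza's identity inverts the series of log(1 + z)/z, so the coefficients are
    (-1)^n d_n; the recursion at its first two indices yields 1/2 and -1/12. *)
Lemma psi_power_series : exists G : nat -> C, (forall n, Cmod (G n) <= 1) /\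
  G 0%nat = RtoC 1 /\ G 1%nat = RtoC (/ 2) /\ G 2%nat = RtoC (- / 12) /\
  taylor_coeffs Psi G.
Proof.
  destruct kaluza_coeffs as [d [d0 [Hd Hrec]]].
  set (G := fun n => RtoC ((-1) ^ n * d n)).
  assert (HG : forall n, Cmod (G n) <= 1).
  { intros n. unfold G. rewrite Cmod_R, Rabs_mult, pow_1_abs, Rmult_1_l. apply Hd. }
  assert (TG : taylor_coeffs (power_series G) G)
    by (eapply power_series_taylor, radius_ge_1_of_bounded, HG).
  pose proof (Hrec 0%nat) as R1. pose proof (Hrec 1%nat) as R2. simpl in R1, R2.
  exists G. split; [exact HG|]. split; [|split; [|split]].
  - unfold G. rewrite d0. f_equal. ring.
  - unfold G. f_equal. simpl. lra.
  - unfold G. f_equal. simpl. lra.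
  - assert (G0 : G 0%nat = RtoC 1) by (unfold G; rewrite d0; f_equal; ring).
    refine (taylor_ext _ _ G G _ (fun _ => eq_refl) TG). intros z Hz.
    assert (E1 : (power_series G z * power_series log_coeffs z)%C = RtoC 1).
    { apply (taylor_unique (fun z => power_series G z * power_series log_coeffs z)%C
        (fun _ => RtoC 1) _ z (taylor_mult _ _ _ _ TG log_coeffs_taylor)); [|exact Hz].
      apply (taylor_ext (fun z => RtoC 1 + z * 0)%C _
        (fun n => match n with O => RtoC 1 | S _ => RtoC 0 end)).
      - intros y _. ring.
      - intros n. unfold G, log_coeffs. rewrite (sum_alternating d (fun m => / INR (S m)) n).
        destruct n as [|n].
        + simpl. rewrite d0. f_equal. field.
        + rewrite Hrec, Rmult_0_r. reflexivity.
      - apply (taylor_unshift (fun _ => RtoC 0)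
          (fun n => match n with O => RtoC 1 | S _ => RtoC 0 end)).
        intros y _. apply Cis_series_components.
        split; apply (is_series_ext (fun _ => 0)); try (intros n; simpl; ring);
          apply filterlim_ext with (fun _ : nat => 0); try apply filterlim_const;
          intros n; rewrite sum_n_const; ring. }
    unfold Psi. destruct (Ceq_dec z 0) as [E|E].
    + rewrite E, (taylor_at_0 _ _ TG). exact G0.
    + fold (log1p z). rewrite <- (log1p_power_series z Hz).
      assert (N : power_series log_coeffs z <> RtoC 0).
      { intros X. rewrite X, Cmult_0_r in E1. apply RtoC_inj in E1. lra. }
      transitivity (power_series G z * power_series log_coeffs z / power_series log_coeffs z)%C.
      * field. exact N.
      * rewrite E1. field. split; [exact N|exact E].
Qed.

(** The coefficients of z -> f(z^k) when [G] are those of f. *)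
Definition spread (k : nat) (G : nat -> C) (n : nat) : C :=
  if Nat.eqb (n mod k) 0 then G (n / k)%nat else RtoC 0.

(** Only indices divisible by k contribute, so each partial sum is one of the original series, and
    convergence passes along n -> n / k. *)
Lemma Csum_spread k G z n : (0 < k)%nat ->
  Csum (fun m => spread k G m * z ^ m)%C n = Csum (fun m => G m * (z ^ k) ^ m)%C (n / k).
Proof.
  intros Hk. induction n as [|n IH].
  - rewrite Nat.Div0.div_0_l, !sum_O. unfold spread.
    rewrite Nat.Div0.mod_0_l, Nat.Div0.div_0_l. reflexivity.
  - rewrite sum_Sn, IH. unfold spread.
    pose proof (Nat.div_mod_eq (S n) k) as D1. pose proof (Nat.div_mod_eq n k) as D2.
    pose proof (Nat.mod_upper_bound (S n) k ltac:(lia)) as B1.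
    pose proof (Nat.mod_upper_bound n k ltac:(lia)) as B2.
    destruct (Nat.eqb_spec (S n mod k) 0) as [E|E].
    + assert (Hq : (S n / k = S (n / k))%nat) by nia.
      rewrite Hq, sum_Sn. f_equal. rewrite <- Cpow_mult_r. do 2 f_equal. lia.
    + assert (Hq : (S n / k = n / k)%nat) by nia.
      rewrite Hq, Cmult_0_l. apply Cplus_0_r.
Qed.

Lemma in_disk_pow k z : (0 < k)%nat -> in_disk z -> in_disk (z ^ k).
Proof.
  unfold in_disk. intros Hk Hz. rewrite Cmod_pow. pose proof (Cmod_ge_0 z) as H0.
  destruct k as [|k]; [lia|]. simpl.
  assert (H : Cmod z ^ k <= 1) by (rewrite <- (pow1 k); apply pow_incr; lra).
  assert (0 <= Cmod z ^ k) by (apply pow_le, H0). nra.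
Qed.

Lemma taylor_spread k f G : (0 < k)%nat -> taylor_coeffs f G ->
  taylor_coeffs (fun z => f (z ^ k)%C) (spread k G).
Proof.
  intros Hk H z Hz. specialize (H _ (in_disk_pow k z Hk Hz)).
  apply filterlim_ext with (fun n => Csum (fun m => G m * (z ^ k) ^ m)%C (n / k)%nat).
  { intros n. symmetry. apply Csum_spread, Hk. }
  refine (filterlim_comp _ _ _ (fun n => (n / k)%nat) _ _ eventually _ _ H).
  intros P [N HN]. exists (N * k)%nat. intros n Hn. apply HN.
  apply Nat.div_le_lower_bound; lia.
Qed.

Lemma psi_re_pos u : in_disk u -> 0 < fst (Psi u).
Proof.
  intros Hu. unfold Psi. destruct (Ceq_dec u 0) as [E|E]; [simpl; lra|].
  fold (log1p u). pose proof (log1p_neq_0 u Hu E) as N.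
  replace (u / log1p u)%C with (/ (log1p u * / u))%C by (field; split; assumption).
  apply re_inv_pos, log1p_quotient_re_pos; assumption.
Qed.

(** Psi(z^k) = 1 + z Gam(z) has coefficients of modulus at most 1 and positive real part, as
    [starlike_function] requires; the Schwarz function is z^k. *)
Lemma extremal_function k : (0 < k)%nat -> exists (f df : C -> C) (a : nat -> C) (G : nat -> C),
  class_SG f df /\ taylor_coeffs f a /\
  G 1%nat = RtoC (/ 2) /\ G 2%nat = RtoC (- / 12) /\ a 1%nat = RtoC 1 /\
  forall n, deriv_coeffs (fun m => a (S m)) n
    = Csum (fun j => spread k G (S j) * a (S (n - j)))%C n.
Proof.
  intros Hk. destruct psi_power_series as [G [HG [G0 [G1 [G2 TG]]]]].
  set (gam := fun j => spread k G (S j)).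
  pose proof (taylor_spread k Psi G Hk TG) as TS.
  assert (E : forall z, in_disk z -> (1 + z * power_series gam z)%C = Psi (z ^ k)%C).
  { intros z Hz. rewrite (proj2 (taylor_shift _ _ TS) z Hz). f_equal.
    unfold spread. rewrite Nat.Div0.mod_0_l, Nat.Div0.div_0_l. symmetry. exact G0. }
  destruct (starlike_function gam) as [f [df [a [HS [Ta [Hz [a1 Hrec]]]]]]].
  - intros n. unfold gam, spread. destruct (Nat.eqb _ 0); [apply HG|rewrite Cmod_0; lra].
  - intros z Hz. rewrite E by exact Hz. apply psi_re_pos, in_disk_pow; assumption.
  - exists f, df, a, G. split; [split; [exact HS|]|].
    (* The monomial is read as a power series with one nonzero coefficient, so that its derivative
       comes from [taylor_deriv]. *)
    + destruct (taylor_deriv (fun z => z ^ k)%C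
        (fun n => if Nat.eqb n k then RtoC 1 else RtoC 0)) as [_ D].
      { intros z _. apply filterlim_ext_loc with (fun _ => (z ^ k)%C); [|apply filterlim_const].
        exists k. intros n Hn. symmetry.
        assert (Z : forall m, (m < k)%nat ->
          Csum (fun n => (if Nat.eqb n k then RtoC 1 else RtoC 0) * z ^ n)%C m = RtoC 0).
        { intros m. induction m as [|m IH]; intros Hm.
          - rewrite sum_O. destruct (Nat.eqb_spec 0 k); [lia|]. apply Cmult_0_l.
          - rewrite sum_Sn, IH by lia. destruct (Nat.eqb_spec (S m) k); [lia|].
            rewrite Cmult_0_l. apply Cplus_0_l. }
        induction Hn as [|n Hn IH].
        - destruct k as [|k']; [lia|]. rewrite sum_Sn, Z, Nat.eqb_refl, Cmult_1_l by lia.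
          apply Cplus_0_l.
        - rewrite sum_Sn, IH. destruct (Nat.eqb_spec (S n) k); [lia|].
          rewrite Cmult_0_l. apply Cplus_0_r. }
      eexists (fun z => z ^ k)%C, _. split; [|split; [|split]].
      * intros z Hz'. apply cderiv_is_derive, D, Hz'.
      * destruct k as [|k']; [lia|]. simpl. ring.
      * intros z Hz'. apply in_disk_pow; assumption.
      * intros z Hz'. rewrite Hz by exact Hz'. apply E, Hz'.
    + split; [exact Ta|]. split; [exact G1|]. split; [exact G2|]. split; [exact a1|exact Hrec].
Qed.

Lemma extremal_coeffs k : (0 < k)%nat -> exists (f df : C -> C) (a : nat -> C) (G : nat -> C),
  class_SG f df /\ taylor_coeffs f a /\
  G 1%nat = RtoC (/ 2) /\ G 2%nat = RtoC (- / 12) /\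
  a 2%nat = spread k G 1 /\
  a 3%nat = (RtoC (/ 2) * (spread k G 1 * a 2%nat + spread k G 2))%C /\
  a 4%nat = (RtoC (/ 3) * (spread k G 1 * a 3%nat + spread k G 2 * a 2%nat + spread k G 3))%C.
Proof.
  intros Hk. destruct (extremal_function k Hk) as [f [df [a [G [Hf [Ta [G1 [G2 [a1 H]]]]]]]]].
  exists f, df, a, G. do 4 (split; [assumption|]).
  pose proof (H 0%nat) as H0. pose proof (H 1%nat) as H1. pose proof (H 2%nat) as H2.
  rewrite !sum_Sn, sum_O in H2. rewrite sum_Sn, sum_O in H1. rewrite sum_O in H0.
  unfold deriv_coeffs in H0, H1, H2. simpl Nat.sub in H0, H1, H2. simpl INR in H0, H1, H2.
  rewrite a1 in H0, H1, H2. change (@plus C_AbelianMonoid) with Cplus in H1, H2.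
  split; [|split].
  - transitivity (RtoC 1 * a 2%nat)%C; [ring|]. rewrite H0. ring.
  - transitivity (RtoC (/ 2) * (RtoC (1 + 1) * a 3%nat))%C;
      [apply injective_projections; simpl; field|]. rewrite H1. f_equal. ring.
  - transitivity (RtoC (/ 3) * (RtoC (1 + 1 + 1) * a 4%nat))%C;
      [apply injective_projections; simpl; field|]. rewrite H2. f_equal. ring.
Qed.

Theorem theorem2 :
  (* the estimates *)
  (forall (f df : Complex.C -> Complex.C) (a : nat -> Complex.C),
     class_SG f df -> taylor_coeffs f a ->
     (forall mu : Complex.C,
        (Cmod (a 3%nat - mu * a 2%nat * a 2%nat)%C
          <= / 4 * Rmax 1 (Cmod (mu - RtoC (/ 3))%C))%R) /\
     (Cmod (a 2%nat * a 3%nat - a 4%nat)%C <= / 6)%R /\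
     (Cmod (a 2%nat * a 4%nat - a 3%nat * a 3%nat)%C <= / 16)%R) /\
  (* sharpness: each bound is attained by some function of S*_G *)
  (forall mu : Complex.C,
     exists (f df : Complex.C -> Complex.C) (a : nat -> Complex.C),
       class_SG f df /\ taylor_coeffs f a /\
       (Cmod (a 3%nat - mu * a 2%nat * a 2%nat)%C
         = / 4 * Rmax 1 (Cmod (mu - RtoC (/ 3))%C))%R) /\
  (exists (f df : Complex.C -> Complex.C) (a : nat -> Complex.C),
     class_SG f df /\ taylor_coeffs f a /\
     (Cmod (a 2%nat * a 3%nat - a 4%nat)%C = / 6)%R) /\
  (exists (f df : Complex.C -> Complex.C) (a : nat -> Complex.C),
     class_SG f df /\ taylor_coeffs f a /\
     (Cmod (a 2%nat * a 4%nat - a 3%nat * a 3%nat)%C = / 16)%R).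
Proof.
  destruct (extremal_coeffs 1 ltac:(lia)) as [f1 [df1 [a1 [G1 [S1 [T1 [A1 [B1 [C1 [D1 _]]]]]]]]]].
  destruct (extremal_coeffs 2 ltac:(lia)) as [f2 [df2 [a2 [G2 [S2 [T2 [A2 [_ [C2 [D2 E2]]]]]]]]]].
  destruct (extremal_coeffs 3 ltac:(lia)) as [f3 [df3 [a3 [G3 [S3 [T3 [A3 [_ [C3 [D3 E3]]]]]]]]]].
  (* The resulting values are a2 = 1/2, a3 = 1/12 for k = 1; a2 = 0, a3 = 1/4, a4 = 0 for k = 2; a2
     = a3 = 0, a4 = 1/6 for k = 3. *)
  cbn in C1, D1, C2, D2, E2, C3, D3, E3.
  rewrite A1 in C1. rewrite A1, B1, C1 in D1.
  rewrite C2, A2 in D2. rewrite C2, A2, D2 in E2.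
  rewrite C3 in D3. rewrite C3, A3, D3 in E3.
  split; [exact class_SG_estimates|]. split; [|split].
  (* When |mu - 1/3| <= 1 the bound is 1/4, the value of a3 for k = 2. Otherwise k = 1 gives 1/12 -
     mu/4 = -(mu - 1/3)/4. *)
  - intros mu. destruct (Rle_lt_dec (Cmod (mu - RtoC (/ 3))%C) 1) as [Hmu|Hmu].
    + exists f2, df2, a2. split; [exact S2|split; [exact T2|]].
      rewrite Rmax_left by exact Hmu.
      replace (a2 3%nat - mu * a2 2%nat * a2 2%nat)%C with (RtoC (/ 4)).
      * rewrite Cmod_R, Rabs_pos_eq; lra.
      * rewrite C2, D2. apply injective_projections; simpl; field.
    + exists f1, df1, a1. split; [exact S1|split; [exact T1|]].
      rewrite Rmax_right by lra.
      replace (a1 3%nat - mu * a1 2%nat * a1 2%nat)%C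
        with (RtoC (- / 4) * (mu - RtoC (/ 3)))%C.
      * rewrite Cmod_mult, Cmod_R, Rabs_left; lra.
      * rewrite C1, D1. apply injective_projections; simpl; field.
  - exists f3, df3, a3. split; [exact S3|split; [exact T3|]].
    replace (a3 2%nat * a3 3%nat - a3 4%nat)%C with (RtoC (- / 6)).
    + rewrite Cmod_R, Rabs_left; lra.
    + rewrite C3, E3. apply injective_projections; simpl; field.
  - exists f2, df2, a2. split; [exact S2|split; [exact T2|]].
    replace (a2 2%nat * a2 4%nat - a2 3%nat * a2 3%nat)%C with (RtoC (- / 16)).
    + rewrite Cmod_R, Rabs_left; lra.
    + rewrite C2, D2. apply injective_projections; simpl; field.
Qed.
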